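(* Let $p\in(1,\infty)$, $r\in(0,\infty)$ and $m\in\mathbb{N}$ with $m\ge 2$, and let $p^*:=p/(p-1)\in(1,\infty)$ be the conjugate exponent of $p$. For each sign $\varepsilon\in\{-,+\}$ (identified with $\varepsilon=-1$ and $\varepsilon=+1$; the sign $-$ refers to the minimization problem defining $\mathscr{E}_m^-$ and the sign $+$ to the maximization problem defining $\mathscr{E}_m^+$) there exist parameters $(\mu_1,\ldots,\mu_m)=(\mu_1^\varepsilon,\ldots,\mu_m^\varepsilon)\in\mathbb{R}^m$ and a non-trivial solution $(u_1(x),\ldots,u_m(x))=(u_1^\varepsilon(x),\ldots,u_m^\varepsilon(x))$, $x\in\Omega$, of the system $$-u_i''+\varepsilon\Big(\sum_{j=1}^m u_j^2\Big)^{p^*-1}u_i=\mu_i u_i,\qquad i=1,\ldots,m,$$ such that: (i) each $u_i$ satisfies the Dirichlet boundary condition $u_i(0)=u_i(1)=0$, $i=1,\ldots,m$; (ii) the $u_i$ satisfy $$\int_\Omega\Big(\sum_{i=1}^m u_i^2(x)\Big)^{p^*}\,dx=r^p,$$ and an optimizing potential $q^\varepsilon$ (that is, $q^\varepsilon\in B_{p,r}$ with $\mathscr{E}_m(q^\varepsilon)=\mathscr{E}_m^\varepsilon$) is given by $$q^\varepsilon(x)=\varepsilon\Big(\sum_{i=1}^m (u_i^\varepsilon(x))^2\Big)^{p^*-1},\qquad x\in\Omega;$$ (iii) the minimal and maximal values of the sum of the first $m$ eigenvalues are $$\mathscr{E}_m^-=\sum_{i=1}^m\mu_i^-\quad\text{and}\quad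 \mathscr{E}_m^+=\sum_{i=1}^m\mu_i^+ ,$$ respectively.
   Context: Let $\Omega=[0,1]$ and $\mathcal{L}^p:=L^p(\Omega,\mathbb{R})$ with its usual norm $\|\cdot\|_p$. For $q\in\mathcal{L}^p$ consider the Dirichlet eigenvalue problem for the Sturm–Liouville operator $$-\psi''+q\psi=\lambda\psi,\quad x\in\Omega,\qquad \psi(0)=\psi(1)=0.$$ Its eigenvalues form an increasing sequence $\lambda_1(q)<\lambda_2(q)<\cdots<\lambda_m(q)<\cdots$ with $\lambda_m(q)\to+\infty$. Put $$\mathscr{E}_m(q):=\sum_{i=1}^m\lambda_i(q),\qquad B_{p,r}:=\{q\in\mathcal{L}^p:\|q\|_p\le r\},$$ $$\mathscr{E}_m^-:=\min_{q\in B_{p,r}}\mathscr{E}_m(q),\qquad \mathscr{E}_m^+:=\max_{q\in B_{p,r}}\mathscr{E}_m(q).$$ *)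

(* Defs.v *)
From HB Require Import structures.
From mathcomp Require Import all_boot all_order all_algebra.
From mathcomp Require Import all_classical all_reals all_analysis.

Set Implicit Arguments.
Unset Strict Implicit.
Unset Printing Implicit Defensive.
Import Order.TTheory GRing.Theory Num.Theory.
Import numFieldNormedType.Exports.
Local Open Scope classical_set_scope.
Local Open Scope ring_scope.

Section Defs.
Context {R : realType}.
Implicit Types (q f g u psi : R -> R) (p r lam v : R) (m : nat).

(* A function on [0,1] is represented by a function R -> R; nothing below
   depends on its values outside [0,1]. *)
Definition Omega : set R := `[0, 1]%classic.

Definition absolutely_continuous f :=
  forall e : R, 0 < e -> exists2 d : R, 0 < d &
    forall (n : nat) (a b : 'I_n -> R),
      (forall i, 0 <= a i /\ a i <= b i /\ b i <= 1) ->
      trivIset setT (fun i => `]a i, b i[%classic) ->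
      \sum_(i < n) (b i - a i) < d ->
      \sum_(i < n) `|f (b i) - f (a i)| < e.

(* f is of class C^1 on the closed interval [0,1], with derivative g: the
   one-sided derivatives at 0 and 1 exist and equal g there, by continuity. *)
Definition C1_derivative f g :=
  [/\ {within Omega, continuous f},
      {within Omega, continuous g} &
      forall x : R, 0 < x < 1 -> is_derive x 1 f (g x)].

Definition C2_derivative2 f g :=
  exists f', C1_derivative f f' /\ C1_derivative f' g.

(* Solutions of - psi'' + q psi = lam psi for a potential that is only
   integrable: psi and psi' are absolutely continuous (psi even C^1) and the
   equation holds almost everywhere. *)
Definition SL_solution q lam psi :=
  exists psi', [/\ C1_derivative psi psi', absolutely_continuous psi' &
    {ae @lebesgue_measure R, forall x, Omega x ->
      derivable psi' x 1 /\ - derive1 psi' x + q x * psi x = lam * psi x}].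

Definition dirichlet psi := psi 0 = 0 /\ psi 1 = 0.

Definition dirichlet_eigenvalue q lam :=
  exists psi, [/\ SL_solution q lam psi, dirichlet psi &
    exists2 x, Omega x & psi x != 0].

Definition eigenvalue_sequence q (l : nat -> R) :=
  [/\ forall i j, (i < j)%N -> l i < l j,
      range l = [set lam | dirichlet_eigenvalue q lam] &
      l @ \oo --> +oo].

(* Indexed from 0: nth_eigenvalue q i is the (i+1)-st eigenvalue. An
   eigenvalue_sequence is unique; it exists for every q in L^p, and the default
   value 0 of xget only matters outside this range. *)
Definition nth_eigenvalue q : nat -> R :=
  xget (fun=> 0) [set l | eigenvalue_sequence q l].

Definition eigenvalue_sum m q : R := \sum_(i < m) nth_eigenvalue q i.

Definition Lp_ball p r : set (R -> R) :=
  [set q | q \_ Omega \in Lfun (@lebesgue_measure R) p%:E /\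
    ('N[@lebesgue_measure R]_p%:E [EFin \o (q \_ Omega)] <= r%:E)%E].

Inductive sign := Minus | Plus.

Definition sgn (eps : sign) : R := if eps is Plus then 1 else -1.

(* v is the minimum (eps = Minus) or the maximum (eps = Plus), attained, of
   the sum of the first m eigenvalues over the ball. *)
Definition optimal_value (eps : sign) p r m v :=
  let values := eigenvalue_sum m @` Lp_ball p r in
  values v /\ (if eps is Plus then ubound values v else lbound values v).

End Defs.

(* Main.v *)
Require Import Defs.
From HB Require Import structures.
From mathcomp Require Import all_boot all_order all_algebra.
From mathcomp Require Import all_classical all_reals all_analysis.
From mathcomp Require Import measurable_realfun ring lra.

Set Implicit Arguments.
Unset Strict Implicit.
Unset Printing Implicit Defensive.
Import Order.TTheory GRing.Theory Num.Theory.
Import numFieldNormedType.Exports.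
Local Open Scope classical_set_scope.
Local Open Scope ring_scope.

(** The potential enters through its primitive. If Q' = q and
w = psi' - Q psi, the equation - psi'' + q psi = lam psi becomes the system
psi' = Q psi + w, w' = - Q w - (Q^2 + lam) psi, whose coefficients are
continuous. In polar coordinates psi = rad sin th, w = rad cos th, the angle
th with th(0) = 0 solves a Lipschitz equation of its own, th(1) increases with
lam, and lam is an eigenvalue exactly when th(1) is a multiple of pi. The values
of lam for which th(1) = (i+1) pi define numbers [ev Q i] for every continuous Q,
continuous in Q for uniform convergence ([cvg_ev]). They are the Dirichlet
eigenvalues when Q is the primitive of an integrable q ([nth_eigenvalueE]); the
passage from an equation that holds almost everywhere to the system rests on the
fact that an absolutely continuous function with derivative zero almost
everywhere is constant ([ac_deriv0_cst]).

An optimal potential is found among primitives. The primitives of the potentials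
in the ball have a common modulus of continuity, and Young's inequality gives
  - int Q b' = int q b <= r^p / p + (int |b|^p') / p'
for every b of class C^1 that vanishes at 0 and 1. These two conditions define a
larger set of functions Q ([admissible]) which is convex, and closed for
pointwise convergence, hence compact by Tychonoff's theorem; by equicontinuity
pointwise convergence in it is uniform. So the sum of the first m eigenvalues
attains its extrema on this set ([ev_sum_max]). This takes the place of the weak
compactness of the ball.

Let Q be an extremum and e = 1 or - 1 according to the problem. The derivative of
[ev Q i] in a direction P is - (int P (phi_i^2)') / int phi_i^2, where phi_i is
the eigenfunction ([ev_variation]). With rho = sum_i u_i^2, where the u_i are
multiples of the phi_i such that all u_i have the same norm and
int rho^p' = r^p, the first-order condition says that - e int Q' rho' is maximal
at Q' = Q. The primitive W of the potential e rho^(p'-1) is a competitor for which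
this quantity is r^p. On the other hand the dual bound for Q with b = e rho has
the right-hand side r^p / p + r^p / p' = r^p. Hence equality holds in the dual
bound, and comparing with the neighbouring b = e (rho + t g) shows that
int (Q - W) g' = 0 for all g, that is, Q = W ([dual_bound_equality]). So Q is
the primitive of e rho^(p'-1), which is in the ball, and the system satisfied by
the phi_i turns into the equations of the theorem with mu_i = ev Q i. *)

(** * Derivatives, continuity and integrals on [0,1] *)

Section Calculus.
Context {R : realType}.
Implicit Types (f g : R -> R) (a b x : R).
Notation mu := (@lebesgue_measure R).

Lemma derD f g x a b : is_derive x 1 f a -> is_derive x 1 g b ->
  is_derive x 1 (fun y => f y + g y) (a + b).
Proof. by move=> fa gb; exact: is_deriveD. Qed.

Lemma derB f g x a b : is_derive x 1 f a -> is_derive x 1 g b ->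
  is_derive x 1 (fun y => f y - g y) (a - b).
Proof. by move=> fa gb; exact: is_deriveB. Qed.

Lemma derN f x a : is_derive x 1 f a -> is_derive x 1 (fun y => - f y) (- a).
Proof. by move=> fa; exact: is_deriveN. Qed.

Lemma derM f g x a b : is_derive x 1 f a -> is_derive x 1 g b ->
  is_derive x 1 (fun y => f y * g y) (a * g x + f x * b).
Proof.
by move=> fa gb; apply: is_derive_eq (is_deriveM fa gb) _; rewrite /GRing.scale /= addrC; ring.
Qed.

Lemma derZ (c : R) f x a : is_derive x 1 f a ->
  is_derive x 1 (fun y => c * f y) (c * a).
Proof. by move=> fa; exact: (is_deriveZ c). Qed.

Lemma derZX (c x : R) : is_derive x 1 (fun y => c * y) c.
Proof. by have := derZ c (is_derive_id x (1 : R)); rewrite mulr1. Qed.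

Lemma derC (c x : R) : is_derive x 1 (fun=> c) 0.
Proof. exact: is_derive_cst. Qed.

Lemma derX x : is_derive x 1 (fun y : R => y) 1.
Proof. exact: is_derive_id. Qed.

Lemma der_comp f g x a b : is_derive x 1 f a -> is_derive (f x) 1 g b ->
  is_derive x 1 (fun y => g (f y)) (b * a).
Proof. by move=> fa gb; exact: is_derive1_comp. Qed.

Lemma derive_continuous f x a : is_derive x 1 f a -> {for x, continuous f}.
Proof. by move=> fa; apply/differentiable_continuous/derivable1_diffP. Qed.

Lemma derBC (c : R) f x a : is_derive x 1 f a -> is_derive x 1 (fun y => f y - c) a.
Proof. by move=> fa; have := derB fa (derC c x); rewrite subr0. Qed.

Lemma derCB (c : R) f x a : is_derive x 1 f a -> is_derive x 1 (fun y => c - f y) (- a).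
Proof. by move=> fa; have := derB (derC c x) fa; rewrite sub0r. Qed.

Lemma contC (c : R) : continuous (fun _ : R => c).
Proof. by move=> x; exact: cvg_cst. Qed.

Lemma contX : continuous (fun x : R => x).
Proof. by move=> x; exact: cvg_id. Qed.

Lemma contD f g : continuous f -> continuous g -> continuous (fun x => f x + g x).
Proof. by move=> cf cg x; exact: cvgD (cf x) (cg x). Qed.

Lemma contN f : continuous f -> continuous (fun x => - f x).
Proof. by move=> cf x; exact: cvgN (cf x). Qed.

Lemma contB f g : continuous f -> continuous g -> continuous (fun x => f x - g x).
Proof. by move=> cf cg x; exact: cvgB (cf x) (cg x). Qed.

Lemma contM f g : continuous f -> continuous g -> continuous (fun x => f x * g x).
Proof. by move=> cf cg x; exact: cvgM (cf x) (cg x). Qed.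

Lemma contXn n f : continuous f -> continuous (fun x => f x ^+ n).
Proof.
move=> cf x; apply: (@continuous_comp _ _ _ f (fun y : R => y ^+ n)); first exact: cf.
exact: exprn_continuous.
Qed.

Lemma cont_comp f g : continuous f -> continuous g -> continuous (fun x => g (f x)).
Proof. by move=> cf cg x; apply: (@continuous_comp _ _ _ f g); [exact: cf|exact: cg]. Qed.

(** The derivatives at the end points a and b are two-sided: functions on [a,b]
are first extended beyond it. *)
Definition deriv_on a b f f' := forall x, a <= x <= b -> is_derive x 1 f (f' x).

Lemma deriv_onS a b c d f f' : a <= c -> d <= b ->
  deriv_on a b f f' -> deriv_on c d f f'.
Proof. by move=> ac db H x /andP[cx xd]; apply: H; lra. Qed.

Lemma deriv_on_within a b f f' : deriv_on a b f f' -> {within `[a, b], continuous f}.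
Proof.
move=> H; apply: continuous_in_subspaceT => x; rewrite inE/= in_itv/= => xab.
exact: (derive_continuous (H x xab)).
Qed.

Lemma deriv_on_MVT a b f f' : a <= b -> deriv_on a b f f' ->
  exists2 c, a <= c <= b & f b - f a = f' c * (b - a).
Proof.
move=> ab H; have [||c] := @MVT_segment R f f' a b ab.
- by move=> x; rewrite in_itv/= => /andP[ax xb]; apply: H; rewrite !ltW.
- exact: deriv_on_within H.
- by rewrite in_itv/=; exists c.
Qed.

Lemma deriv_on_ge0 a b f f' : a <= b -> deriv_on a b f f' ->
  (forall x, a <= x <= b -> 0 <= f' x) -> f a <= f b.
Proof.
move=> ab H f0; have [c cab e] := deriv_on_MVT ab H.
by rewrite -subr_ge0 e mulr_ge0 ?f0 ?subr_ge0.
Qed.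

Lemma deriv_on_le a b f f' g g' : a <= b ->
  deriv_on a b f f' -> deriv_on a b g g' ->
  (forall x, a <= x <= b -> f' x <= g' x) -> f b - f a <= g b - g a.
Proof.
move=> ab fd gd fg.
have := @deriv_on_ge0 a b (fun x => g x - f x) (fun x => g' x - f' x) ab.
suff: deriv_on a b (fun x => g x - f x) (fun x => g' x - f' x).
  move=> h /(_ h) h2.
  have : g a - f a <= g b - f b by apply: h2 => x xab; rewrite subr_ge0 fg.
  lra.
by move=> x xab; apply: derB; [exact: gd|exact: fd].
Qed.

Lemma deriv_on_norm_le a b f f' g g' : a <= b ->
  deriv_on a b f f' -> deriv_on a b g g' ->
  (forall x, a <= x <= b -> `|f' x| <= g' x) -> `|f b - f a| <= g b - g a.
Proof.
move=> ab fd gd fg; rewrite ler_norml; apply/andP; split.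
  have : (- f b) - (- f a) <= g b - g a.
    apply: (@deriv_on_le a b (fun x => - f x) (fun x => - f' x) g g') => // x xab.
      by apply: derN; exact: fd.
    by have := fg x xab; rewrite ler_norml => /andP[]; lra.
  lra.
apply: (@deriv_on_le a b f f' g g') => // x xab.
by have := fg x xab; rewrite ler_norml => /andP[]; lra.
Qed.

Lemma deriv_on_eq a b f g h : deriv_on a b f h -> deriv_on a b g h ->
  f a = g a -> forall x, a <= x <= b -> f x = g x.
Proof.
move=> fd gd fga x /andP[ax xb].
have fd' := deriv_onS (lexx a) xb fd; have gd' := deriv_onS (lexx a) xb gd.
have h1 := deriv_on_le ax fd' gd' (fun _ _ => lexx _).
have h2 := deriv_on_le ax gd' fd' (fun _ _ => lexx _).
by apply/eqP; rewrite eq_le; apply/andP; split; lra.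
Qed.

Lemma deriv_on_ext a b f f' g' : deriv_on a b f f' ->
  (forall x, a <= x <= b -> f' x = g' x) -> deriv_on a b f g'.
Proof. by move=> H e x xab; rewrite -e //; exact: H. Qed.

(** The nearest-point projection of the line onto [0,1]: composing with it
turns a function on [0,1] into a continuous function on the whole line, which
makes two-sided derivatives available at 0 and 1. *)
Definition clamp x : R := (`|x| - `|x - 1| + 1) / 2.

Lemma clampE x : 0 <= x <= 1 -> clamp x = x.
Proof.
by move=> /andP[x0 x1]; rewrite /clamp ger0_norm// ler0_norm ?subr_le0//; lra.
Qed.

Lemma clamp01 x : 0 <= clamp x <= 1.
Proof.
rewrite /clamp; have [x0|x0] := leP 0 x; have [x1|x1] := leP 0 (x - 1).
- by rewrite (ger0_norm x0) (ger0_norm x1); lra.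
- by rewrite (ger0_norm x0) (ltr0_norm x1); lra.
- by rewrite (ltr0_norm x0) (ger0_norm x1); lra.
- by rewrite (ltr0_norm x0) (ltr0_norm x1); lra.
Qed.

Lemma clampK x : clamp (clamp x) = clamp x.
Proof. exact/clampE/clamp01. Qed.

Lemma continuous_clamp : continuous clamp.
Proof.
move=> x; apply: cvgM; last exact: cvg_cst.
apply: cvgD; last exact: cvg_cst.
apply: cvgB; first exact: norm_continuous.
by apply: cvg_norm; apply: cvgB; [exact: cvg_id|exact: cvg_cst].
Qed.

Lemma deriv_on_clamp f f' : deriv_on 0 1 f f' -> continuous (fun x => f (clamp x)).
Proof.
move=> fd x; apply: (@continuous_comp _ _ _ clamp f); first exact: continuous_clamp.
by apply: derive_continuous (fd _ _); exact: clamp01.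
Qed.

Lemma continuous_within a b f : continuous f -> {within `[a, b], continuous f}.
Proof. by move=> cf; apply: continuous_subspaceT. Qed.

Lemma continuous_itv_integrable a b f : continuous f ->
  mu.-integrable `[a, b] (EFin \o f).
Proof.
move=> cf; apply: continuous_compact_integrable; first exact: segment_compact.
exact: continuous_within.
Qed.

(** A primitive vanishing at 0. Integrating from -1 keeps 0 in the interior of
the domain, so that the derivative at 0 is two-sided. *)
Definition prim f x : R :=
  \int[mu]_(t in `[-1, x]) f t - \int[mu]_(t in `[-1, 0]) f t.

Lemma prim0 f : prim f 0 = 0. Proof. exact: subrr. Qed.

Lemma is_derive_prim f x : continuous f -> -1 < x -> is_derive x 1 (prim f) (f x).
Proof.
move=> cf x1.
have xx : x < x + 1 by rewrite ltrDl.
have [d e] := continuous_FTC1_closed xx (continuous_itv_integrable (-1) (x + 1) cf) x1 (cf x).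
have h : is_derive x 1 (fun x => \int[mu]_(t in `[-1, x]) f t) (f x).
  by apply: DeriveDef; [exact: d|rewrite -derive1E; exact: e].
by have := derB h (derC (\int[mu]_(t in `[-1, 0]) f t) x); rewrite subr0.
Qed.

Lemma prim_deriv_on f : continuous f -> deriv_on 0 1 (prim f) f.
Proof. by move=> cf x /andP[x0 _]; apply: is_derive_prim => //; lra. Qed.

Lemma prim_Rintegral f x : continuous f -> 0 <= x ->
  prim f x = \int[mu]_(t in `[0, x]) f t.
Proof.
move=> cf x0; rewrite /prim Rintegral_itvB//; last 2 first.
- exact: continuous_itv_integrable.
- by rewrite bnd_simp; lra.
by rewrite Rintegral_itv_obnd_cbnd// ; apply: integrableS (continuous_itv_integrable 0 x cf) => //; apply: subset_itvr; rewrite bnd_simp.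
Qed.

(** Functions continuous on [0,1], whatever they do outside, and their integral
over [0,1]. *)
Definition cont01 f := continuous (fun x => f (clamp x)).

Definition int01 f := prim (fun x => f (clamp x)) 1.

Lemma continuous_cont01 f : continuous f -> cont01 f.
Proof. by move=> cf; exact: cont_comp continuous_clamp cf. Qed.

Lemma cont01D f g : cont01 f -> cont01 g -> cont01 (fun x => f x + g x).
Proof. exact: contD. Qed.

Lemma cont01M f g : cont01 f -> cont01 g -> cont01 (fun x => f x * g x).
Proof. exact: contM. Qed.

Lemma cont01Z (c : R) f : cont01 f -> cont01 (fun x => c * f x).
Proof. by apply: cont01M; exact: contC. Qed.

Lemma prim_cont01 f : cont01 f -> deriv_on 0 1 (prim (fun x => f (clamp x))) f.
Proof. by move=> cf; apply: deriv_on_ext (prim_deriv_on cf) _ => x /clampE->. Qed.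

Lemma eq_int01 f g : (forall x, 0 <= x <= 1 -> f x = g x) -> int01 f = int01 g.
Proof.
by move=> fg; congr (prim _ 1); apply/funext => x; apply: fg; exact: clamp01.
Qed.

Lemma int01E f F : cont01 f -> deriv_on 0 1 F f -> int01 f = F 1 - F 0.
Proof.
move=> cf Ff.
have := @deriv_on_eq 0 1 (prim (fun x => f (clamp x))) (fun x => F x - F 0) f (prim_cont01 cf).
move=> h; apply: h.
- by move=> x x01; have := derB (Ff x x01) (derC (F 0) x); rewrite subr0.
- by rewrite prim0 subrr.
- by rewrite ler01 lexx.
Qed.

Lemma int01D f g : cont01 f -> cont01 g ->
  int01 (fun x => f x + g x) = int01 f + int01 g.
Proof.
move=> cf cg; rewrite (@int01E _ (fun x => prim (fun x => f (clamp x)) x + prim (fun x => g (clamp x)) x)).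
- by rewrite !prim0 addr0 subr0.
- exact: contD.
- by move=> x x01; apply: derD; exact: prim_cont01.
Qed.

Lemma int01Z c f : cont01 f -> int01 (fun x => c * f x) = c * int01 f.
Proof.
move=> cf; rewrite (@int01E _ (fun x => c * prim (fun x => f (clamp x)) x)).
- by rewrite !prim0 mulr0 subr0.
- by apply: contM => //; exact: contC.
- by move=> x x01; apply: derZ; exact: prim_cont01.
Qed.

Lemma int01B f g : cont01 f -> cont01 g ->
  int01 (fun x => f x - g x) = int01 f - int01 g.
Proof.
move=> cf cg; rewrite (@int01E _ (fun x => prim (fun x => f (clamp x)) x - prim (fun x => g (clamp x)) x)).
- by rewrite !prim0 subr0 subr0.
- exact: contB.
- by move=> x x01; apply: derB; exact: prim_cont01.
Qed.

Lemma cont01_sum n (f : 'I_n -> R -> R) : (forall i, cont01 (f i)) ->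
  cont01 (fun x => \sum_(i < n) f i x).
Proof.
elim: n f => [|n IH] f cf.
  by rewrite /cont01; under [X in continuous X]eq_fun do rewrite big_ord0; exact: contC.
rewrite /cont01; under [X in continuous X]eq_fun do rewrite big_ord_recl.
apply: (@contD (fun x => f ord0 (clamp x)) (fun x => \sum_(i < n) f (lift ord0 i) (clamp x))).
  exact: cf.
exact: (IH (fun i => f (lift ord0 i))).
Qed.

Lemma int01_sum n (f : 'I_n -> R -> R) : (forall i, cont01 (f i)) ->
  int01 (fun x => \sum_(i < n) f i x) = \sum_(i < n) int01 (f i).
Proof.
elim: n f => [|n IH] f cf.
  rewrite big_ord0 (@int01E _ (fun=> 0)) ?subrr//; first exact: cont01_sum.
  by move=> x _; rewrite big_ord0; exact: derC.
rewrite big_ord_recl -IH// -int01D//; last by apply: cont01_sum => i; exact: cf.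
by apply: eq_int01 => x _; rewrite big_ord_recl.
Qed.

Lemma int01_le f g : cont01 f -> cont01 g ->
  (forall x, 0 <= x <= 1 -> f x <= g x) -> int01 f <= int01 g.
Proof.
move=> cf cg fg; have := deriv_on_le ler01 (prim_cont01 cf) (prim_cont01 cg) fg.
by rewrite !prim0 !subr0.
Qed.

Lemma int01_ge0 f : cont01 f -> (forall x, 0 <= x <= 1 -> 0 <= f x) -> 0 <= int01 f.
Proof.
move=> cf f0; have := deriv_on_ge0 ler01 (prim_cont01 cf) f0; by rewrite prim0.
Qed.

Lemma int01_eq0 f : cont01 f -> (forall x, 0 <= x <= 1 -> 0 <= f x) -> int01 f <= 0 ->
  forall x, 0 <= x <= 1 -> f x = 0.
Proof.
move=> cf f0 If x /andP[x0 x1].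
pose P := prim (fun x => f (clamp x)).
have dP : deriv_on 0 1 P f by exact: prim_cont01.
have Pm a b : 0 <= a -> a <= b -> b <= 1 -> P a <= P b.
  move=> a0 ab b1; apply: (deriv_on_ge0 ab (deriv_onS a0 b1 dP)) => t tab; apply: f0.
  lra.
have Pz t : 0 <= t <= 1 -> P t = 0.
  move=> /andP[t0 t1]; apply/eqP; rewrite eq_le.
  have := Pm 0 t (lexx _) t0 t1; have := Pm t 1 t0 t1 (lexx _).
  rewrite [P 0]prim0 => h1 ->; rewrite andbT; exact: le_trans h1 If.
(* A positive value of f at x would persist on a nondegenerate interval, on
   which P would increase. *)
apply/eqP; rewrite eq_le f0 ?x0// andbT leNgt; apply/negP => fx.
have /cvgrPdist_lt/(_ (f x)) := cf x; rewrite clampE ?x0// => /(_ fx).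
move=> /nbhs_ballP[d /= d0 hd].
pose a := Num.max 0 (x - d / 2); pose b := Num.min 1 (x + d / 2).
have ab : a < b by rewrite gt_max !lt_min ltr01/=; lra.
have a0 : 0 <= a by rewrite le_max lexx.
have b1 : b <= 1 by rewrite ge_min lexx.
have [c cab e] := deriv_on_MVT (ltW ab) (deriv_onS a0 b1 dP).
move: e; rewrite !Pz; [|lra..]; rewrite subrr => /esym/eqP; rewrite mulf_eq0 => /orP[/eqP fc|/eqP]; last lra.
have xa : x - d / 2 <= a by rewrite le_max lexx orbT.
have xb : b <= x + d / 2 by rewrite ge_min lexx orbT.
have /hd/= : ball x d c by rewrite /ball/= ltr_norml; lra.
rewrite clampE; last lra.
by rewrite fc subr0 gtr0_norm// ltxx.
Qed.

Lemma int01_cst c : int01 (fun=> c) = c.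
Proof.
rewrite (@int01E _ (fun x => c * x)); first by rewrite mulr1 mulr0 subr0.
  exact: contC.
by move=> x _; exact: derZX.
Qed.

Lemma int01_Rintegral f : cont01 f -> int01 f = \int[mu]_(t in `[0, 1]) f t.
Proof.
move=> cf; rewrite /int01 prim_Rintegral//; apply: eq_Rintegral => x.
by rewrite inE/= in_itv/= => /clampE->.
Qed.

End Calculus.

(** * Ordinary differential equations on [0,1] *)

Section ODE.
Context {R : realType}.
Implicit Types (f g : R -> R) (a b x : R).

Lemma continuous_bounded01 f : continuous f ->
  exists2 B : R, 0 <= B & forall x, 0 <= x <= 1 -> `|f x| <= B.
Proof.
move=> cf; have [|c _ h] := @EVT_max R (fun x => `|f x|) 0 1 ler01.
  apply: continuous_within => x; apply: cvg_norm; exact: cf.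
by exists `|f c| => // x x01; apply: h; rewrite in_itv.
Qed.

Lemma archi_exp2_eq0 (a K : R) : (forall n, `|a| <= K / 2 ^+ n) -> a = 0.
Proof.
move=> h; apply/eqP; rewrite -normr_eq0 eq_le normr_ge0 andbT leNgt; apply/negP => a0.
have K0 : 0 <= K by have := h 0%N; rewrite expr0 divr1; lra.
have [n hn] : exists n : nat, K / `|a| < n%:R.
  by exists (Num.truncn (K / `|a|)).+1; exact: truncnS_gt.
have := h n; rewrite ler_pdivlMr ?exprn_gt0// => hn2.
have hn3 : (n%:R : R) <= 2 ^+ n by rewrite -natrX ler_nat ltnW// ltn_expl.
move: hn; rewrite ltr_pdivrMr// => hn.
have : n%:R * `|a| <= `|a| * 2 ^+ n by rewrite mulrC ler_wpM2l.
lra.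
Qed.

(** The intervals of radius 2 D / 2^n around z n are nested, and the supremum of
their left ends lies in all of them. *)
Lemma sandwich_limit (z : nat -> R) (D : R) : 0 <= D ->
  (forall n, `|z n.+1 - z n| <= D / 2 ^+ n) ->
  exists l, forall n, `|l - z n| <= D * 2 / 2 ^+ n.
Proof.
move=> D0 h.
have p2 n : 0 < (2:R) ^+ n by rewrite exprn_gt0.
have e2 n : D * 2 / 2 ^+ n = D * 2 / 2 ^+ n.+1 + D / 2 ^+ n.
  by rewrite exprS; field; rewrite gt_eqF.
pose lo n := z n - D * 2 / 2 ^+ n; pose hi n := z n + D * 2 / 2 ^+ n.
have los n : lo n <= lo n.+1.
  by rewrite /lo; have := h n; rewrite ler_norml (e2 n) => /andP[]; lra.
have his n : hi n.+1 <= hi n.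
  by rewrite /hi; have := h n; rewrite ler_norml (e2 n) => /andP[]; lra.
have lom m k : lo m <= lo (m + k)%N.
  by elim: k => [|k IH]; [rewrite addn0|rewrite addnS (le_trans IH)].
have him m k : hi (m + k)%N <= hi m.
  by elim: k => [|k IH]; [rewrite addn0|rewrite addnS (le_trans _ IH)].
have lohi n m : lo n <= hi m.
  apply: (le_trans (lom n m)); rewrite addnC; apply: le_trans (him m n).
  rewrite /lo /hi addnC; have : 0 <= D * 2 / 2 ^+ (n + m) by rewrite divr_ge0 ?mulr_ge0// ltW.
  lra.
exists (sup (range lo)) => n.
have up : lo n <= sup (range lo).
  apply: ub_le_sup; last by exists n.
  by exists (hi 0%N) => _ [k _ <-].
have dn : sup (range lo) <= hi n.
  by apply: ge_sup; [exists (lo 0%N), 0%N|move=> _ [k _ <-]].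
by rewrite ler_norml; move: up dn; rewrite /lo /hi; lra.
Qed.

Section Picard.
Variables (F : R -> R -> R) (L : R).
Hypothesis L0 : 0 < L.
Hypothesis Fcont : forall y : R -> R, continuous y -> continuous (fun x => F x (y x)).
Hypothesis Flip : forall x a b, 0 <= x <= 1 -> `|F x a - F x b| <= L * `|a - b|.

Let step (y : R -> R) : R -> R := fun x => prim (fun t => F t (y t)) (clamp x).
Let z n := iter n step (fun=> 0).

Let step_continuous (y : R -> R) : continuous y -> continuous (step y).
Proof.
move=> cy x.
apply: (@continuous_comp _ _ _ clamp (prim (fun t => F t (y t)))); first exact: continuous_clamp.
have /andP[c0 _] := clamp01 x.
have c1 : -1 < clamp x by lra.
exact: derive_continuous (is_derive_prim (Fcont cy) c1).
Qed.

Let zc n : continuous (z n).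
Proof. by elim: n => [x|n IH]; [exact: cvg_cst|exact: step_continuous]. Qed.

Let step_lip (u v E E' : R -> R) : continuous u -> continuous v ->
  deriv_on 0 1 E E' -> 0 <= E 0 ->
  (forall x, 0 <= x <= 1 -> `|F x (u x) - F x (v x)| <= E' x) ->
  forall x, 0 <= x <= 1 -> `|step u x - step v x| <= E x.
Proof.
move=> cu cv dE E0 h x /andP[x0 x1].
have h2 : `|(prim (fun t => F t (u t)) x - prim (fun t => F t (v t)) x) -
   (prim (fun t => F t (u t)) 0 - prim (fun t => F t (v t)) 0)| <= E x - E 0.
  apply: (@deriv_on_norm_le R 0 x (fun x => prim (fun t => F t (u t)) x - prim (fun t => F t (v t)) x) (fun t => F t (u t) - F t (v t)) E E' x0).
  - move=> t /andP[t0 tx]; apply: derB.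
      by apply: (is_derive_prim (Fcont cu)); lra.
    by apply: (is_derive_prim (Fcont cv)); lra.
  - exact: deriv_onS dE.
  - by move=> t tx; apply: h; lra.
rewrite /step clampE ?x0//; move: h2; rewrite !prim0 !subr0; lra.
Qed.

Let deriv_expRZ (C k : R) : deriv_on 0 1 (fun x => C * expR (k * x)) (fun x => C * (k * expR (k * x))).
Proof.
move=> x _; have := derZ C (der_comp (derZX k x) (is_derive_expR _)).
by rewrite [_ * k]mulrC.
Qed.

(* The weight expR (2 L x) makes the Picard map a contraction by 1/2. *)
Let z_step : exists2 C : R, 0 <= C & forall n x, 0 <= x <= 1 ->
   `|z n.+1 x - z n x| <= C / 2 ^+ n * expR (2 * L * x).
Proof.
have [B B0 FB] := continuous_bounded01 (Fcont (fun x => @cvg_cst _ (0 : R) _ (nbhs x) _)).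
exists (B / (2 * L)); first by rewrite divr_ge0// mulr_ge0// ltW.
elim=> [|n IH].
  move=> x /andP[x0 x1]; rewrite /z /= expr0 divr1 subr0.
  have := @deriv_on_norm_le R 0 x (prim (fun t => F t 0)) (fun t => F t 0)
    (fun x => B / (2 * L) * expR (2 * L * x)) (fun x => B / (2 * L) * (2 * L * expR (2 * L * x))) x0.
  rewrite prim0 subr0 mulr0 expR0 mulr1 /step clampE ?x0// => h.
  have {}h : `|prim (fun t : R => F t 0) x| <= B / (2 * L) * expR (2 * L * x) - B / (2 * L).
    apply: h.
    - apply: deriv_onS x1 _ => //; apply: prim_deriv_on; apply: Fcont => ?; exact: cvg_cst.
    - by apply: deriv_onS x1 (deriv_expRZ _ _).
    - move=> t /andP[t0 tx]; apply: (le_trans (FB t _)); first lra.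
      rewrite mulrA divfK ?gt_eqF ?mulr_gt0//.
      by rewrite ler_peMr// -expR0 ler_expR !mulr_ge0// ltW.
  have : 0 <= B / (2 * L) by rewrite divr_ge0// mulr_ge0// ltW.
  lra.
move=> x x01.
apply: (@step_lip (z n.+1) (z n) (fun x => B / (2 * L) / 2 ^+ n.+1 * expR (2 * L * x))
  (fun x => B / (2 * L) / 2 ^+ n.+1 * (2 * L * expR (2 * L * x)))) => //.
- rewrite mulr_ge0 ?expR_ge0// !divr_ge0 ?mulr_ge0 ?exprn_ge0// ltW//.
- move=> t t01; apply: le_trans (Flip _ _ t01) _.
  have := IH t t01; rewrite -(ler_pM2l L0) => /le_trans; apply.
  rewrite le_eqVlt; apply/orP; left; apply/eqP.
  by rewrite exprS; field; rewrite !gt_eqF ?exprn_gt0.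
Qed.

(** Limit of the iterates z n of y |-> int_0^x F(t, y(t)) dt. *)
Lemma picard : exists2 th : R -> R, th 0 = 0 & deriv_on 0 1 th (fun x => F x (th x)).
Proof.
have [C C0 hC] := z_step.
have zclamp n x : z n x = z n (clamp x).
  by case: n => [//|n]; rewrite /z /= /step clampK.
pose D := C * expR (2 * L).
have D0 : 0 <= D by rewrite mulr_ge0 ?expR_ge0.
have zD x n : `|z n.+1 x - z n x| <= D / 2 ^+ n.
  rewrite (zclamp n.+1) (zclamp n); apply: (le_trans (hC n _ (clamp01 x))).
  rewrite /D mulrAC ler_pM2r ?invr_gt0 ?exprn_gt0// ler_wpM2l// ler_expR.
  by rewrite -[leRHS]mulr1 ler_wpM2l ?mulr_ge0 ?(ltW L0)//; have /andP[] := clamp01 x.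
have /choice[y hy] : forall x, exists l, forall n, `|l - z n x| <= D * 2 / 2 ^+ n.
  by move=> x; apply: sandwich_limit.
have yc : continuous y.
  move=> x; apply/cvgrPdist_lt => e e0.
  have [n hn] : exists n, D * 2 / 2 ^+ n < e / 3.
    apply: contrapT => /forallNP h.
    suff : e = 0 by lra.
    apply: (@archi_exp2_eq0 _ (D * 2 * 3)) => n; rewrite gtr0_norm//.
    by have := h n => /negP; rewrite -leNgt; lra.
  have := @zc n x; move=> /cvgrPdist_lt /(_ (e / 3)); rewrite divr_gt0// => /(_ isT).
  apply: filterS => t ht.
  have := hy x n; have := hy t n; move: ht; rewrite !ltr_norml !ler_norml.
  by move=> /andP[? ?] /andP[? ?] /andP[? ?]; apply/andP; split; lra.
have yE x : y x = prim (fun t => F t (y t)) (clamp x).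
  apply/eqP; rewrite -subr_eq0; apply/eqP.
  apply: (@archi_exp2_eq0 _ (D * 2 + L * (D * 2))) => n.
  have h1 := hy x n.+1.
  have h2 : `|step y (clamp x) - step (z n) (clamp x)| <= L * (D * 2 / 2 ^+ n) * clamp x.
    apply: (@step_lip _ _ (fun x => L * (D * 2 / 2 ^+ n) * x) (fun=> L * (D * 2 / 2 ^+ n))) => //.
    - by move=> t _; exact: derZX.
    - by rewrite mulr0.
    - by move=> t t01; apply: le_trans (Flip _ _ t01) _; rewrite ler_pM2l//.
    - exact: clamp01.
  have h3 : L * (D * 2 / 2 ^+ n) * clamp x <= L * (D * 2 / 2 ^+ n).
    rewrite ler_piMr ?mulr_ge0 ?invr_ge0 ?exprn_ge0 ?(ltW L0)//.
    by have /andP[] := clamp01 x.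
  have h4 : D * 2 / 2 ^+ n.+1 <= D * 2 / 2 ^+ n.
    rewrite ler_wpM2l ?mulr_ge0// lef_pV2 ?posrE ?exprn_gt0//.
    by rewrite ler_eXn2l ?ltr1n.
  have h5 : z n.+1 x = step (z n) (clamp x) by rewrite zclamp.
  have -> : (D * 2 + L * (D * 2)) / 2 ^+ n = D * 2 / 2 ^+ n + L * (D * 2 / 2 ^+ n).
    by rewrite mulrDl -!mulrA.
  move: h1 h2; rewrite h5 {2}/step clampK !ler_norml.
  by move=> /andP[? ?] /andP[? ?]; apply/andP; split; lra.
pose th := prim (fun t => F t (y t)).
have thE x : 0 <= x <= 1 -> th x = y x by move=> x01; rewrite yE clampE.
exists th; first exact: prim0.
apply: (deriv_on_ext (prim_deriv_on (Fcont yc))) => x x01.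
by rewrite thE.
Qed.

End Picard.

(** If g' >= L g wherever g is negative, then exp(-L x) g cannot decrease below
zero: apply the mean value theorem after the last time at which g is nonnegative. *)
Lemma comparison a b g g' (L : R) : deriv_on a b g g' -> 0 <= g a ->
  (forall x, a <= x <= b -> g x < 0 -> L * g x <= g' x) ->
  forall x, a <= x <= b -> 0 <= g x.
Proof.
move=> dg ga h x0 /andP[ax0 x0b]; rewrite leNgt; apply/negP => gx0.
pose S := [set t | a <= t <= x0 /\ 0 <= g t].
have Sa : S a by split => //; rewrite lexx.
have Sub : ubound S x0 by move=> t [/andP[]].
have hS : has_sup S by split; [exists a|exists x0].
pose c := sup S.
have ac : a <= c by apply: ub_le_sup => //; exists x0.
have cx0 : c <= x0 by apply: ge_sup => //; exists a.
have gcont t : a <= t <= b -> {for t, continuous g}.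
  by move=> tab; exact: derive_continuous (dg t tab).
have gc : 0 <= g c.
  rewrite leNgt; apply/negP => gc0.
  have /gcont /cvgrPdist_lt : a <= c <= b by lra.
  move=> /(_ (- g c)); rewrite oppr_gt0 => /(_ gc0).
  move=> /nbhs_ballP[d /= d0 hd].
  have [t [tS tl] ct] := sup_adherent d0 hS.
  have tc : t <= c by apply: ub_le_sup => //; exists x0.
  have : ball c d t by rewrite /ball/= ger0_norm; rewrite -/c in ct; lra.
  move=> /hd /=; rewrite ltr_norml => /andP[]; lra.
have cltx0 : c < x0.
  rewrite lt_neqAle cx0 andbT; apply/eqP => e; move: gc; rewrite e; lra.
pose E x := expR (- L * x).
have dE x : is_derive x 1 E (E x * - L).
  exact: der_comp (derZX (- L) x) (is_derive_expR _).
have dh : deriv_on c x0 (fun x => g x * E x) (fun x => g' x * E x + g x * (E x * - L)).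
  by move=> t /andP[ct tx]; apply: derM (dE t); apply: dg; lra.
have dh' : forall x, x \in `]c, x0[ ->
    is_derive x 1 (fun x => g x * E x) (g' x * E x + g x * (E x * - L)).
  by move=> x; rewrite in_itv/= => /andP[cx xx0]; apply: dh; rewrite !ltW.
have [t] := MVT cltx0 dh' (deriv_on_within dh).
rewrite in_itv/= => /andP[ct tx0] e.
have gt : g t < 0.
  rewrite ltNge; apply/negP => gt0.
  suff : t <= c by lra.
  by apply: ub_le_sup; [exists x0|split => //; lra].
have : 0 <= (g' t * E t + g t * (E t * - L)) * (x0 - c).
  rewrite mulr_ge0 ?subr_ge0 ?(ltW cltx0)//.
  have -> : g' t * E t + g t * (E t * - L) = E t * (g' t - L * g t) by ring.
  by rewrite mulr_ge0 ?expR_ge0// subr_ge0 h//; lra.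
rewrite -e.
have : 0 <= g c * E c by rewrite mulr_ge0 ?expR_ge0.
have : g x0 * E x0 < 0 by rewrite nmulr_rlt0 ?expR_gt0.
lra.
Qed.

Lemma deriv_expRM (L x a : R) g : is_derive x 1 g a ->
  is_derive x 1 (fun x => expR (L * x) * g x) (expR (L * x) * (a + L * g x)).
Proof.
move=> ga; apply: is_derive_eq (derM (der_comp (derZX L x) (is_derive_expR _)) ga) _.
by ring.
Qed.

Lemma weighted_nondecreasing a b g g' (L : R) : a <= b -> deriv_on a b g g' ->
  (forall x, a <= x <= b -> - L * g x <= g' x) ->
  expR (L * a) * g a <= expR (L * b) * g b.
Proof.
move=> ab dg h; apply: (@deriv_on_ge0 R a b (fun x => expR (L * x) * g x) (fun x => expR (L * x) * (g' x + L * g x)) ab).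
  by move=> x xab; apply: deriv_expRM; exact: dg.
by move=> x /h hx; rewrite mulr_ge0 ?expR_ge0//; lra.
Qed.

(** [comparison] applied to g + e x exp(L x), which is chosen so as to absorb the
error term e. *)
Lemma gronwall_ge g g' (L e : R) : 0 <= L -> 0 <= e -> deriv_on 0 1 g g' -> 0 <= g 0 ->
  (forall x, 0 <= x <= 1 -> - (L * `|g x| + e) <= g' x) ->
  forall x, 0 <= x <= 1 -> - (e * expR L) <= g x.
Proof.
move=> L0 e0 dg g0 h x x01.
have E1 (t : R) : 0 <= t -> 1 <= expR (L * t) by move=> t0; rewrite -expR0 ler_expR mulr_ge0.
pose G t := g t + e * (expR (L * t) * t).
suff /(_ x x01) : forall x, 0 <= x <= 1 -> 0 <= G x.
  move=> Gx.
  have : expR (L * x) * x <= expR L.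
    rewrite -[leRHS]mulr1 ler_pM ?expR_ge0//; [lra| |lra].
    by rewrite ler_expR -[leRHS]mulr1 ler_wpM2l//; lra.
  by move=> /(ler_wpM2l e0); rewrite /G in Gx; lra.
apply: (@comparison 0 1 G (fun t => g' t + e * (expR (L * t) * (1 + L * t))) L).
- move=> t t01; apply: derD; first exact: dg.
  apply: derZ; apply: (@deriv_expRM L t 1 (fun x => x)); exact: derX.
- by rewrite /G mulr0 mulr0 addr0.
- move=> t t01 Gt.
  have et : 0 <= e * (expR (L * t) * t) by rewrite !mulr_ge0 ?expR_ge0//; lra.
  have gt : g t <= 0 by rewrite /G in Gt; lra.
  have := h t t01; rewrite (ler0_norm gt) => ht.
  have := E1 t; have t0 : 0 <= t by lra.
  move=> /(_ t0) /(ler_wpM2l e0); rewrite /G; lra.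
Qed.

Lemma gronwall g g' (L e : R) : 0 <= L -> 0 <= e -> deriv_on 0 1 g g' -> g 0 = 0 ->
  (forall x, 0 <= x <= 1 -> `|g' x| <= L * `|g x| + e) ->
  forall x, 0 <= x <= 1 -> `|g x| <= e * expR L.
Proof.
move=> L0 e0 dg g0 h x x01; rewrite ler_norml; apply/andP; split.
  apply: (gronwall_ge L0 e0 dg) => //; first by rewrite g0.
  by move=> t t01; have := h t t01; rewrite ler_norml => /andP[].
have : - (e * expR L) <= - g x.
  apply: (@gronwall_ge (fun x => - g x) (fun x => - g' x) L e) => //.
  - by move=> t t01; apply: derN; exact: dg.
  - by rewrite g0 oppr0.
  - by move=> t t01; have := h t t01; rewrite ler_norml normrN => /andP[]; lra.
lra.
Qed.

End ODE.

(** * The angle of a solution *)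

Section Pruefer.
Context {R : realType}.
Implicit Types (Q th : R -> R) (a b x lam M : R).

Lemma sin_lip a b : `|sin a - sin b| <= `|a - b|.
Proof.
wlog ab : a b / b <= a => [h|].
  have [/h//|/ltW/h] := leP b a; by rewrite distrC [X in _ <= X]distrC.
rewrite (ger0_norm (_ : 0 <= a - b)); last by rewrite subr_ge0.
apply: (@deriv_on_norm_le R b a sin cos (fun x => x) (fun=> 1)) => //.
- by move=> x _; exact: is_derive_sin.
- by move=> x _; exact: derX.
- by move=> x _; exact: cos_max.
Qed.

Lemma cos_lip a b : `|cos a - cos b| <= `|a - b|.
Proof.
wlog ab : a b / b <= a => [h|].
  have [/h//|/ltW/h] := leP b a; by rewrite distrC [X in _ <= X]distrC.
rewrite (ger0_norm (_ : 0 <= a - b)); last by rewrite subr_ge0.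
apply: (@deriv_on_norm_le R b a cos (fun x => - sin x) (fun x => x) (fun=> 1)) => //.
- by move=> x _; exact: is_derive_cos.
- by move=> x _; exact: derX.
- by move=> x _; rewrite normrN; exact: sin_max.
Qed.

Lemma norm_mul_sub (a b c d e : R) : `|a| <= 1 -> `|d| <= 1 ->
  `|b - d| <= e -> `|a - c| <= e -> `|a * b - c * d| <= 2 * e.
Proof.
move=> a1 d1 bd ac; have -> : a * b - c * d = a * (b - d) + (a - c) * d by ring.
apply: (le_trans (ler_normD _ _)); rewrite !normrM.
have -> : 2 * e = 1 * e + e * 1 by ring.
by apply: lerD; apply: ler_pM.
Qed.

Lemma sinsin_lip a b : `|sin a ^+ 2 - sin b ^+ 2| <= 2 * `|a - b|.
Proof. by rewrite !expr2; apply: norm_mul_sub; rewrite ?sin_max ?sin_lip. Qed.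

Lemma coscos_lip a b : `|cos a ^+ 2 - cos b ^+ 2| <= 2 * `|a - b|.
Proof. by rewrite !expr2; apply: norm_mul_sub; rewrite ?cos_max ?cos_lip. Qed.

Lemma sincos_lip a b : `|sin a * cos a - sin b * cos b| <= 2 * `|a - b|.
Proof. by apply: norm_mul_sub; rewrite ?sin_max ?cos_max ?cos_lip ?sin_lip. Qed.

Lemma sqr_le1 (s : R) : `|s| <= 1 -> s ^+ 2 <= 1.
Proof. by move=> s1; rewrite -real_normK ?num_real// expr_le1. Qed.

Lemma norm_combination (A B C a b c e : R) : 0 <= e ->
  `|a| <= e -> `|b| <= e -> `|c| <= e ->
  `|A * a + B * b + C * c| <= (`|A| + `|B| + `|C|) * e.
Proof.
move=> e0 ae be ce; apply: (le_trans (ler_normD _ _)); rewrite mulrDl.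
apply: lerD; last by rewrite normrM ler_wpM2l.
apply: (le_trans (ler_normD _ _)); rewrite mulrDl.
by apply: lerD; rewrite normrM ler_wpM2l.
Qed.

(** Right-hand sides of the equations th' = pr_angle and (ln rad)' = pr_radius
obtained by writing psi = rad sin th, w = rad cos th in the system
psi' = Q psi + w, w' = - Q w - (Q^2 + lam) psi. *)
Definition pr_angle Q lam x (t : R) :=
  (cos t + Q x * sin t) ^+ 2 + lam * sin t ^+ 2.

Definition pr_radius Q lam x (t : R) :=
  Q x * sin t ^+ 2 - Q x * cos t ^+ 2 + (1 - (Q x ^+ 2 + lam)) * (sin t * cos t).

(** A Lipschitz constant of both functions in t wherever |Q x| <= M. *)
Definition pr_lip M lam : R := 2 * (1 + M + M) + 2 * (1 + M ^+ 2 + `|lam|).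

Lemma pr_lip_gt0 M lam : 0 <= M -> 0 < pr_lip M lam.
Proof. by move=> M0; rewrite /pr_lip; have := sqr_ge0 M; have := normr_ge0 lam; lra. Qed.

Lemma pr_angle_lip Q lam M x a b : `|Q x| <= M ->
  `|pr_angle Q lam x a - pr_angle Q lam x b| <= pr_lip M lam * `|a - b|.
Proof.
move=> QM.
have -> : pr_angle Q lam x a - pr_angle Q lam x b =
  1 * (cos a ^+ 2 - cos b ^+ 2) + (2 * Q x) * (sin a * cos a - sin b * cos b)
  + (Q x ^+ 2 + lam) * (sin a ^+ 2 - sin b ^+ 2) by rewrite /pr_angle; ring.
apply: le_trans (norm_combination _ _ _ _ (coscos_lip a b) (sincos_lip a b) (sinsin_lip a b)) _.
  by rewrite mulr_ge0.
rewrite mulrA ler_wpM2r// normr1 normrM ger0_norm//.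
have : `|Q x ^+ 2 + lam| <= M ^+ 2 + `|lam|.
  apply: (le_trans (ler_normD _ _)); rewrite lerD2r normrX.
  by rewrite ler_pXn2r// ?nnegrE// (le_trans _ QM).
by rewrite /pr_lip; lra.
Qed.

Lemma pr_radius_lip Q lam M x a b : `|Q x| <= M ->
  `|pr_radius Q lam x a - pr_radius Q lam x b| <= pr_lip M lam * `|a - b|.
Proof.
move=> QM.
have -> : pr_radius Q lam x a - pr_radius Q lam x b =
  Q x * (sin a ^+ 2 - sin b ^+ 2) + (- Q x) * (cos a ^+ 2 - cos b ^+ 2)
  + (1 - (Q x ^+ 2 + lam)) * (sin a * cos a - sin b * cos b).
  by rewrite /pr_radius; ring.
apply: le_trans (norm_combination _ _ _ _ (sinsin_lip a b) (coscos_lip a b) (sincos_lip a b)) _.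
  by rewrite mulr_ge0.
rewrite mulrA ler_wpM2r// normrN.
have : `|1 - (Q x ^+ 2 + lam)| <= 1 + (M ^+ 2 + `|lam|).
  apply: (le_trans (ler_normB _ _)); rewrite normr1 lerD2l.
  apply: (le_trans (ler_normD _ _)); rewrite lerD2r normrX.
  by rewrite ler_pXn2r// ?nnegrE// (le_trans _ QM).
by rewrite /pr_lip; lra.
Qed.

Lemma norm_sqr_sub M (a b e : R) : `|a| <= M -> `|b| <= M -> `|a - b| <= e ->
  `|a ^+ 2 - b ^+ 2| <= 2 * M * e.
Proof.
move=> aM bM ab; rewrite subr_sqr mulrC normrM ler_pM//.
by apply: (le_trans (ler_normD _ _)); lra.
Qed.

Lemma norm_sincos_le1 (t : R) : `|sin t * cos t| <= 1.
Proof. by rewrite normrM mulr_ile1// ?sin_max ?cos_max. Qed.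

Lemma pr_angle_dep Q1 Q2 l1 l2 M x e (t : R) : `|Q1 x| <= M -> `|Q2 x| <= M ->
  `|Q1 x - Q2 x| <= e ->
  `|pr_angle Q1 l1 x t - pr_angle Q2 l2 x t| <= 2 * (1 + M) * e + `|l1 - l2|.
Proof.
move=> Q1M Q2M Q12.
have -> : pr_angle Q1 l1 x t - pr_angle Q2 l2 x t =
  2 * (Q1 x - Q2 x) * (sin t * cos t) + (Q1 x ^+ 2 - Q2 x ^+ 2) * sin t ^+ 2
  + (l1 - l2) * sin t ^+ 2 by rewrite /pr_angle; ring.
have s1 : `|sin t ^+ 2| <= 1 by rewrite ger0_norm ?sqr_ge0// sqr_le1// sin_max.
apply: le_trans (norm_combination _ _ _ ler01 (norm_sincos_le1 t) s1 s1) _.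
have := norm_sqr_sub Q1M Q2M Q12.
by rewrite mulr1 normrM ger0_norm//; lra.
Qed.

Lemma pr_radius_dep Q1 Q2 l1 l2 M x e (t : R) : `|Q1 x| <= M -> `|Q2 x| <= M ->
  `|Q1 x - Q2 x| <= e ->
  `|pr_radius Q1 l1 x t - pr_radius Q2 l2 x t| <= 2 * (1 + M) * e + `|l1 - l2|.
Proof.
move=> Q1M Q2M Q12.
have -> : pr_radius Q1 l1 x t - pr_radius Q2 l2 x t =
  (Q1 x - Q2 x) * sin t ^+ 2 + (- (Q1 x - Q2 x)) * cos t ^+ 2
  + (- (Q1 x ^+ 2 - Q2 x ^+ 2) - (l1 - l2)) * (sin t * cos t).
  by rewrite /pr_radius; ring.
have s1 : `|sin t ^+ 2| <= 1 by rewrite ger0_norm ?sqr_ge0// sqr_le1// sin_max.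
have c1 : `|cos t ^+ 2| <= 1 by rewrite ger0_norm ?sqr_ge0// sqr_le1// cos_max.
apply: le_trans (norm_combination _ _ _ ler01 s1 c1 (norm_sincos_le1 t)) _.
have := norm_sqr_sub Q1M Q2M Q12.
have := ler_normB (- (Q1 x ^+ 2 - Q2 x ^+ 2)) (l1 - l2).
by rewrite mulr1 !normrN; lra.
Qed.

Lemma continuous_pr_angle Q lam : continuous Q ->
  forall y : R -> R, continuous y -> continuous (fun x => pr_angle Q lam x (y x)).
Proof.
move=> cQ y cy.
have cs : continuous (fun x => sin (y x)) by apply: cont_comp cy _; exact: continuous_sin.
have cc : continuous (fun x => cos (y x)) by apply: cont_comp cy _; exact: continuous_cos.
apply: contD; last by apply: contM; [exact: contC|exact: contXn].
by apply: contXn; apply: contD => //; exact: contM.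
Qed.

Lemma continuous_pr_radius Q lam : continuous Q ->
  forall y : R -> R, continuous y -> continuous (fun x => pr_radius Q lam x (y x)).
Proof.
move=> cQ y cy.
have cs : continuous (fun x => sin (y x)) by apply: cont_comp cy _; exact: continuous_sin.
have cc : continuous (fun x => cos (y x)) by apply: cont_comp cy _; exact: continuous_cos.
apply: contD.
  by apply: contB; apply: contM => //; exact: contXn.
apply: contM; last exact: contM.
apply: contB; first exact: contC.
by apply: contD; [exact: contXn|exact: contC].
Qed.

Definition is_angle Q lam th :=
  th 0 = 0 /\ deriv_on 0 1 th (fun x => pr_angle Q lam x (th x)).

Definition angle Q lam : R -> R := xget (fun=> 0) [set th | is_angle Q lam th].

Lemma angleP Q lam : continuous Q -> is_angle Q lam (angle Q lam).
Proof.
move=> cQ; apply: (@xgetPex _ (fun=> 0) [set th | is_angle Q lam th]).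
have [M M0 QM] := continuous_bounded01 cQ.
have [||th th0 dth] := @picard R (pr_angle Q lam) (pr_lip M lam) (pr_lip_gt0 lam M0).
- exact: continuous_pr_angle.
- by move=> x a b x01; apply: pr_angle_lip; exact: QM.
by exists th.
Qed.

Section fixed_potential.
Variables (Q : R -> R) (M : R).
Hypotheses (cQ : continuous Q) (QM : forall x, 0 <= x <= 1 -> `|Q x| <= M).

Local Notation th := (angle Q).

Let M0 : 0 <= M.
Proof. by apply: le_trans (QM (x := 0) _) => //; rewrite lexx ler01. Qed.

Lemma angle0 lam : th lam 0 = 0.
Proof. by have [] := angleP lam cQ. Qed.

Lemma deriv_angle lam : deriv_on 0 1 (th lam) (fun x => pr_angle Q lam x (th lam x)).
Proof. by have [] := angleP lam cQ. Qed.

(** At an angle a with sin a = 0 the angular velocity is cos^2 a = 1, so that the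
multiples of pi are only crossed upwards. *)
Lemma angle_crosses_upward lam a x0 x : sin a = 0 -> 0 <= x0 -> x0 < x -> x <= 1 ->
  a <= th lam x0 -> a < th lam x.
Proof.
move=> sa x00 x0x x1 ha.
set L := pr_lip M lam.
pose g t := th lam t - a.
pose g' t := pr_angle Q lam t (th lam t).
have dg : deriv_on x0 x g g'.
  move=> t /andP[t0 t1]; apply: derBC.
  by apply: deriv_angle; lra.
have gg t : x0 <= t <= x -> 1 - L * `|g t| <= g' t.
  move=> /andP[t0 t1]; have := @pr_angle_lip Q lam M t (th lam t) a (QM (x:=t) _).
  have -> : pr_angle Q lam t a = 1.
    by rewrite /pr_angle sa mulr0 addr0 expr0n mulr0 addr0 cos2sin2 sa expr0n subr0.
  rewrite -/L -/(g t) -/(g' t) ler_norml => H; have /H /andP[] : 0 <= t <= 1 by lra.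
  lra.
have g0 t : x0 <= t <= x -> 0 <= g t.
  apply: (@comparison R x0 x g g' L) => //; first by rewrite /g; lra.
  by move=> s s01 gs; have := gg s s01; rewrite ltr0_norm//; lra.
have dh : deriv_on x0 x (fun t => expR (L * t) * g t) (fun t => expR (L * t) * (g' t + L * g t)).
  by move=> t tx; apply: deriv_expRM; exact: dg.
have [c cx] := deriv_on_MVT (ltW x0x) dh.
have g'c := gg c cx; have gc := g0 c cx; rewrite ger0_norm// in g'c.
move=> e.
have h1 : 0 < expR (L * c) * (g' c + L * g c) * (x - x0).
  by rewrite !mulr_gt0 ?expR_gt0//; lra.
have h2 : 0 <= expR (L * x0) * g x0.
  by rewrite mulr_ge0 ?expR_ge0// g0// lexx ltW.
have : 0 < expR (L * x) * g x by lra.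
by rewrite pmulr_rgt0 ?expR_gt0// /g; lra.
Qed.

Lemma angle_gt0 lam x : 0 < x -> x <= 1 -> 0 < th lam x.
Proof.
move=> x0 x1; apply: (@angle_crosses_upward lam 0 0 x) => //; first exact: sin0.
by rewrite angle0.
Qed.

(** At the angle pi/2 the velocity is Q^2 + lam <= 0: the angle cannot cross
pi/2. *)
Lemma angle_le_pihalf lam : lam <= - M ^+ 2 -> th lam 1 <= pi / 2.
Proof.
move=> hl; set L := pr_lip M lam.
suff : forall x, 0 <= x <= 1 -> 0 <= pi / 2 - th lam x by move=> /(_ 1); rewrite ler01 lexx => /(_ isT); lra.
apply: (@comparison R 0 1 _ (fun x => - pr_angle Q lam x (th lam x)) L).
- move=> t t01; apply: derCB; exact: deriv_angle.
- by rewrite angle0 subr0 divr_ge0 ?pi_ge0.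
- move=> t t01 ht.
  have := @pr_angle_lip Q lam M t (th lam t) (pi / 2) (QM t01).
  rewrite -/L.
  have -> : pr_angle Q lam t (pi / 2) = Q t ^+ 2 + lam.
    by rewrite /pr_angle cos_pihalf sin_pihalf; ring.
  have : Q t ^+ 2 <= M ^+ 2.
    by rewrite -real_normK ?num_real// ler_pXn2r ?nnegrE// QM.
  rewrite (gtr0_norm (_ : 0 < th lam t - pi / 2)); last lra.
  by rewrite ler_norml => h1 /andP[]; lra.
Qed.

(** The velocity grows with lam, at the rate sin^2 th, which is positive just
after 0, when th has entered the interval (0, pi). *)
Lemma angle_increasing l1 l2 : l1 < l2 -> th l1 1 < th l2 1.
Proof.
move=> l12; set L := pr_lip M l2.
have L0 : 0 < L by exact: pr_lip_gt0.
pose g t := th l2 t - th l1 t.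
pose g' t := pr_angle Q l2 t (th l2 t) - pr_angle Q l1 t (th l1 t).
have dg : deriv_on 0 1 g g' by move=> t t01; apply: derB; exact: deriv_angle.
have gg t : 0 <= t <= 1 -> (l2 - l1) * sin (th l1 t) ^+ 2 - L * `|g t| <= g' t.
  move=> t01; have := @pr_angle_lip Q l2 M t (th l2 t) (th l1 t) (QM t01).
  rewrite -/L -/(g t) ler_norml => /andP[+ _].
  rewrite /g' {2 4}/pr_angle; lra.
have s2 t : 0 <= (l2 - l1) * sin (th l1 t) ^+ 2.
  by rewrite mulr_ge0 ?sqr_ge0// subr_ge0 ltW.
have g0 t : 0 <= t <= 1 -> 0 <= g t.
  apply: (@comparison R 0 1 g g' L) => //; first by rewrite /g !angle0 subrr.
  by move=> s s01 gs; have := gg s s01; have := s2 s; rewrite ltr0_norm//; lra.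
have mono a b : 0 <= a -> a <= b -> b <= 1 -> expR (L * a) * g a <= expR (L * b) * g b.
  move=> a0 ab b1; apply: (@weighted_nondecreasing R a b g g') => //.
    exact: deriv_onS dg.
  move=> t tab; have t01 : 0 <= t <= 1 by lra.
  by have := gg t t01; have := s2 t; rewrite ger0_norm ?g0//; lra.
rewrite -subr_gt0 lt_neqAle -/(g 1) g0 ?ler01 ?lexx// andbT; apply/eqP => g1.
(* Otherwise the two angles agree on [0,1], so that sin (th l1) vanishes at
   some small positive x. *)
have gz t : 0 <= t <= 1 -> g t = 0.
  move=> /andP[t0 t1]; have := mono t 1 t0 t1 (lexx _); rewrite -g1 mulr0.
  rewrite pmulr_rle0 ?expR_gt0// => gt; apply/eqP; rewrite eq_le gt g0//.
  by rewrite t0.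
have [b /andP[b0 b1] hb] : exists2 b, 0 < b <= 1 & forall t, 0 < t <= b -> th l1 t < pi.
  have /cvgrPdist_lt/(_ pi) : {for (0 : R), continuous (th l1)}.
    by apply: derive_continuous (deriv_angle l1 _); rewrite lexx ler01.
  rewrite pi_gt0 => /(_ isT) /nbhs_ballP[d /= d0 hd].
  exists (Num.min 1 (d / 2)).
    by rewrite lt_min ltr01 ge_min lexx !andbT divr_gt0.
  move=> t /andP[t0]; rewrite le_min => /andP[t1 td].
  have /hd/= : ball (0 : R) d t by rewrite /ball/= sub0r normrN gtr0_norm//; lra.
  by rewrite angle0 sub0r normrN ltr_norml => /andP[].
have b20 : 0 < b / 2 by rewrite divr_gt0.
have b2b : b / 2 <= b by lra.
have [c /andP[c1 c2]] := deriv_on_MVT b2b (deriv_onS (ltW b20) b1 dg).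
rewrite !gz; [|lra..].
rewrite subrr => /esym/eqP; rewrite mulf_eq0 => /orP[/eqP g'c|/eqP]; last lra.
have c01 : 0 <= c <= 1 by lra.
have := gg c c01; rewrite g'c gz// normr0 mulr0 subr0.
have : 0 < sin (th l1 c).
  by apply: sin_gt0_pi; rewrite angle_gt0 ?hb//; lra.
move=> sc; have : 0 < (l2 - l1) * sin (th l1 c) ^+ 2.
  by rewrite mulr_gt0 ?exprn_gt0// subr_gt0.
lra.
Qed.

(** Riccati comparison: where sin th does not vanish, v = cot th satisfies
v' = - (v + Q)^2 - lam <= - (v^2 + k^2) / 2, so that arctan (v / k) decreases
at speed at least k / 2; this can last for a time less than 2 pi / k. *)
Lemma angle_zero lam k a b : 0 < k -> M ^+ 2 + k ^+ 2 / 2 <= lam ->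
  0 <= a -> a <= b -> b <= 1 -> 2 * pi <= k * (b - a) ->
  exists2 x, a <= x <= b & sin (th lam x) = 0.
Proof.
move=> k0 hlam a0 ab b1 kab; apply: contrapT => /forall2NP nz.
have {}nz x : a <= x <= b -> sin (th lam x) != 0.
  by move=> xab; apply/eqP => s0; have [] := nz x.
pose s x := sin (th lam x); pose c x := cos (th lam x).
pose v x := c x / s x.
pose v' x := - pr_angle Q lam x (th lam x) / s x ^+ 2.
have dv : deriv_on a b v v'.
  move=> x xab; have x01 : 0 <= x <= 1 by lra.
  have dth := deriv_angle lam x01.
  have ds := der_comp dth (is_derive_sin _); have dc := der_comp dth (is_derive_cos _).
  have sx := nz x xab.
  have di := is_deriveV sx ds.
  apply: is_derive_eq (derM dc di) _.
  rewrite /v' /s /GRing.scale /=.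
  have h := cos2sin2 (th lam x).
  have -> : - sin (th lam x) * pr_angle Q lam x (th lam x) * (sin (th lam x))^-1 =
     - pr_angle Q lam x (th lam x) * (1 - cos (th lam x) ^+ 2) / sin (th lam x) ^+ 2.
    by rewrite h; field.
  by field.
pose f x := atan (k^-1 * v x).
pose f' x := (1 + (k^-1 * v x) ^+ 2)^-1 * (k^-1 * v' x).
have df : deriv_on a b f f'.
  by move=> x xab; apply: der_comp (derZ _ (dv x xab)) (is_derive1_atan _).
have f'le x : a <= x <= b -> f' x <= - (k / 2).
  move=> xab; have x01 : 0 <= x <= 1 by lra.
  have sx : s x != 0 by exact: nz.
  have v'E : v' x = - ((v x + Q x) ^+ 2 + lam).
    by rewrite /v' /v /pr_angle -/(s x) -/(c x); field.
  have v'le : v' x <= - (v x ^+ 2 + k ^+ 2) / 2.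
    have : Q x ^+ 2 <= M ^+ 2.
      by rewrite -real_normK ?num_real// ler_pXn2r ?nnegrE// QM.
    have : 0 <= (v x + 2 * Q x) ^+ 2 by exact: sqr_ge0.
    by rewrite v'E; nra.
  have p0 : 0 < 1 + (k^-1 * v x) ^+ 2 by rewrite ltr_wpDr ?sqr_ge0.
  rewrite /f' mulrC ler_pdivrMr//.
  have -> : - (k / 2) * (1 + (k^-1 * v x) ^+ 2) = k^-1 * (- (v x ^+ 2 + k ^+ 2) / 2).
    by field; rewrite gt_eqF.
  by rewrite ler_pM2l ?invr_gt0.
have := @deriv_on_le R a b f f' (fun x => - (k / 2) * x) (fun=> - (k / 2)) ab df.
have dl : deriv_on a b (fun x => - (k / 2) * x) (fun=> - (k / 2)).
  by move=> x _; exact: derZX.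
move=> /(_ dl f'le).
have := atan_gtNpi2 (k^-1 * v b); have := atan_ltpi2 (k^-1 * v a); rewrite -/(f a) -/(f b).
lra.
Qed.

End fixed_potential.

End Pruefer.

(** * Continuous dependence on the potential *)

Section UniformConvergence.
Context {R : realType}.
Implicit Types (f g : R -> R).

(** Uniform convergence on [0,1] along a filter. *)
Definition ucvg {T : Type} (F : set_system T) (f : T -> R -> R) g :=
  forall e : R, 0 < e -> \forall t \near F, forall x : R, 0 <= x <= 1 -> `|f t x - g x| <= e.

Definition bounded01 f := exists2 B : R, 0 <= B & forall x : R, 0 <= x <= 1 -> `|f x| <= B.

Lemma cont01_bounded f : cont01 f -> bounded01 f.
Proof.
move=> cf; have [B B0 h] := continuous_bounded01 cf.
by exists B; [exact: B0|move=> x x01; rewrite -(clampE x01); exact: h x x01].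
Qed.

Variables (T : Type) (F : set_system T).
Context {FF : Filter F}.
Implicit Types u v : T -> R -> R.

Lemma ucvg_cst g : ucvg F (fun=> g) g.
Proof. by move=> e e0; near=> t => x _; rewrite subrr normr0 ltW. Unshelve. all: by end_near. Qed.

Lemma ucvgD u v f g : ucvg F u f -> ucvg F v g ->
  ucvg F (fun t x => u t x + v t x) (fun x => f x + g x).
Proof.
move=> uf vg e e0; have e2 : 0 < e / 2 by rewrite divr_gt0.
have := uf _ e2; have := vg _ e2; apply: filterS2 => t h1 h2 x x01.
rewrite opprD addrACA (le_trans (ler_normD _ _))//.
by have := h1 x x01; have := h2 x x01; lra.
Qed.

Lemma ucvgM u v f g : bounded01 f -> bounded01 g -> ucvg F u f -> ucvg F v g ->
  ucvg F (fun t x => u t x * v t x) (fun x => f x * g x).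
Proof.
move=> [B B0 fB] [C C0 gC] uf vg e e0.
pose d := Num.min 1 (e / (B + C + 1)).
have d0 : 0 < d by rewrite lt_min ltr01 divr_gt0//; lra.
have := uf _ d0; have := vg _ d0; apply: filterS2 => t h1 h2 x x01.
have {h1} h1 := h1 x x01; have {h2} h2 := h2 x x01.
have -> : u t x * v t x - f x * g x =
  (u t x - f x) * (v t x - g x) + (u t x - f x) * g x + f x * (v t x - g x) by ring.
have d1 : d <= 1 by rewrite ge_min lexx.
have de : d * (B + C + 1) <= e by rewrite -ler_pdivlMr ?ge_min ?lexx ?orbT//; lra.
have k1 : `|(u t x - f x) * (v t x - g x)| <= d * 1.
  by rewrite normrM ler_pM// (le_trans h1).
have k2 : `|(u t x - f x) * g x| <= d * C by rewrite normrM ler_pM// gC.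
have k3 : `|f x * (v t x - g x)| <= B * d by rewrite normrM ler_pM// fB.
apply: (le_trans (ler_normD _ _)).
have := ler_normD ((u t x - f x) * (v t x - g x)) ((u t x - f x) * g x).
lra.
Qed.

Lemma ucvg_at u f x : 0 <= x <= 1 -> ucvg F u f -> u t x @[t --> F] --> f x.
Proof.
move=> x01 uf; apply/cvgrPdist_le => e e0.
by have := uf e e0; apply: filterS => t /(_ x x01); rewrite distrC.
Qed.

Lemma ucvg_prim u f : (\forall t \near F, continuous (u t)) -> continuous f ->
  ucvg F u f -> ucvg F (fun t => prim (u t)) (prim f).
Proof.
move=> cu cf uf e e0; have := uf e e0; apply: filterS2 cu => t cut h x /andP[x0 x1].
have := @deriv_on_norm_le R 0 x (fun x => prim (u t) x - prim f x) (fun x => u t x - f x)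
  (fun x => e * x) (fun=> e) x0.
rewrite !prim0 subrr subr0 mulr0 subr0 => H.
have exe : e * x <= e by rewrite ler_piMr// ltW.
apply: le_trans exe; apply: H.
- by move=> y /andP[y0 yx]; apply: derB; apply: prim_deriv_on; rewrite // y0 (le_trans yx).
- by move=> y _; exact: derZX.
- by move=> y /andP[y0 yx]; apply: h; rewrite y0 (le_trans yx).
Qed.

Lemma ucvg_int u f : (\forall t \near F, cont01 (u t)) -> cont01 f ->
  ucvg F u f -> int01 (u t) @[t --> F] --> int01 f.
Proof.
move=> cu cf uf.
have H : ucvg F (fun t x => u t (clamp x)) (fun x => f (clamp x)).
  by move=> e e0; have := uf e e0; apply: filterS => t h x _; exact/h/clamp01.
by apply: ucvg_at (ucvg_prim cu cf H); rewrite ler01 lexx.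
Qed.

(** The uniform continuity of h near the range of f comes from the compactness of
[0,1], through a covering by neighbourhoods of points x and of the filter. *)
Lemma ucvg_comp (h : R -> R) u f : continuous h -> cont01 f -> ucvg F u f ->
  ucvg F (fun t x => h (u t x)) (fun x => h (f x)).
Proof.
move=> ch cf uf e e0.
have : compact (`[0, 1]%classic : set R) by exact: segment_compact.
move=> /compact_near_coveringP/(_ T F (fun t x => `|h (u t (clamp x)) - h (f (clamp x))| <= e) FF) H.
have : \near F, `[0, 1]%classic `<=` (fun x => `|h (u F (clamp x)) - h (f (clamp x))| <= e).
  apply: H => x _.
  have e2 : 0 < e / 2 by rewrite divr_gt0.
  have /cvgrPdist_lt/(_ _ e2)/nbhs_ballP[d /= d0 hd] := ch (f (clamp x)).
  have d2 : 0 < d / 2 by rewrite divr_gt0.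
  have /cvgrPdist_lt/(_ _ d2) nf := cf x.
  exists ([set x' | `|f (clamp x) - f (clamp x')| < d / 2],
          [set t | forall x, 0 <= x <= 1 -> `|u t x - f x| <= d / 2]).
    by split; [exact: nf|exact: uf].
  move=> [x' t] /= [h1 h2].
  have {}h2 := h2 _ (clamp01 x').
  have k1 : `|h (f (clamp x)) - h (f (clamp x'))| < e / 2.
    by apply: hd; rewrite /ball/=; lra.
  have k2 : `|h (f (clamp x)) - h (u t (clamp x'))| < e / 2.
    apply: hd; rewrite /ball/=.
    have := ler_normB (f (clamp x) - f (clamp x')) (u t (clamp x') - f (clamp x')).
    rewrite opprB addrA subrK; lra.
  have := ler_normB (h (f (clamp x)) - h (f (clamp x'))) (h (f (clamp x)) - h (u t (clamp x'))).
  have -> : h (f (clamp x)) - h (f (clamp x')) - (h (f (clamp x)) - h (u t (clamp x'))) =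
    h (u t (clamp x')) - h (f (clamp x')) by ring.
  lra.
apply: filterS => t ht x x01; have := ht x; rewrite /= in_itv/= x01 clampE//.
exact.
Qed.

End UniformConvergence.

Lemma ucvg_line {R : realType} (f g : R -> R) : bounded01 g ->
  ucvg (0 : R)^'+ (fun t x => f x + t * g x) f.
Proof.
move=> [B B0 gB] e e0; have B1 : 0 < B + 1 by lra.
near=> t => x x01.
have t0 : 0 < t by near: t; exact: nbhs_right_gt.
have te : t <= e / (B + 1) by near: t; apply: nbhs_right_le; exact: divr_gt0.
rewrite addrC addKr normrM (gtr0_norm t0).
apply: (@le_trans _ _ (e / (B + 1) * (B + 1))); last by rewrite divfK// gt_eqF.
by apply: ler_pM => //; have := gB x x01; lra.
Unshelve. all: by end_near. Qed.

Section AngleConvergence.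
Context {R : realType}.

Lemma angle_dep (Q1 Q2 : R -> R) (l1 l2 M e : R) : continuous Q1 -> continuous Q2 ->
  0 <= e ->
  (forall x, 0 <= x <= 1 -> `|Q1 x| <= M) ->
  (forall x, 0 <= x <= 1 -> `|Q2 x| <= M) ->
  (forall x, 0 <= x <= 1 -> `|Q1 x - Q2 x| <= e) ->
  forall x, 0 <= x <= 1 -> `|angle Q1 l1 x - angle Q2 l2 x| <=
    (2 * (1 + M) * e + `|l1 - l2|) * expR (pr_lip M l1).
Proof.
move=> cQ1 cQ2 e0 Q1M Q2M Q12.
have M0 : 0 <= M by apply: le_trans (Q1M 0 _) => //; rewrite lexx ler01.
apply: (@gronwall R (fun x => angle Q1 l1 x - angle Q2 l2 x)
 (fun x => pr_angle Q1 l1 x (angle Q1 l1 x) - pr_angle Q2 l2 x (angle Q2 l2 x))).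
- exact/ltW/pr_lip_gt0.
- by rewrite addr_ge0// !mulr_ge0//; lra.
- by move=> x x01; apply: derB; exact: deriv_angle.
- by rewrite !angle0// subrr.
- move=> x x01.
  have := @pr_angle_lip R Q1 l1 M x (angle Q1 l1 x) (angle Q2 l2 x) (Q1M x x01).
  have := @pr_angle_dep R Q1 Q2 l1 l2 M x e (angle Q2 l2 x) (Q1M x x01) (Q2M x x01) (Q12 x x01).
  have := ler_normD (pr_angle Q1 l1 x (angle Q1 l1 x) - pr_angle Q1 l1 x (angle Q2 l2 x))
     (pr_angle Q1 l1 x (angle Q2 l2 x) - pr_angle Q2 l2 x (angle Q2 l2 x)).
  rewrite addrA subrK; lra.
Qed.

(** The radius of the solution with psi 0 = 0 and w 0 = 1. *)
Definition radius (Q : R -> R) lam : R -> R :=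
  fun x => expR (prim (fun t => pr_radius Q lam (clamp t) (angle Q lam (clamp t))) x).

Definition psol (Q : R -> R) lam x := radius Q lam x * sin (angle Q lam x).
Definition wsol (Q : R -> R) lam x := radius Q lam x * cos (angle Q lam x).

(** The equation - psi'' + Q' psi = lam psi in terms of a primitive Q of the
potential and of the quasi-derivative w = psi' - Q psi. *)
Definition quasi_system (Q : R -> R) lam psi w :=
  deriv_on 0 1 psi (fun x => Q x * psi x + w x) /\
  deriv_on 0 1 w (fun x => - Q x * w x - (Q x ^+ 2 + lam) * psi x).

Lemma continuous_log_radius (Q : R -> R) lam : continuous Q ->
  continuous (fun t => pr_radius Q lam (clamp t) (angle Q lam (clamp t))).
Proof.
move=> cQ; apply: (@continuous_pr_radius R (fun t => Q (clamp t)) lam _ (fun t => angle Q lam (clamp t))).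
  by apply: cont_comp => //; exact: continuous_clamp.
exact: deriv_on_clamp (deriv_angle cQ lam).
Qed.

Lemma deriv_radius (Q : R -> R) lam : continuous Q ->
  deriv_on 0 1 (radius Q lam) (fun x => radius Q lam x * pr_radius Q lam x (angle Q lam x)).
Proof.
move=> cQ x x01.
have := der_comp (prim_deriv_on (continuous_log_radius (lam:=lam) cQ) x01) (is_derive_expR _).
by rewrite /= clampE.
Qed.

Lemma radius_gt0 (Q : R -> R) lam x : 0 < radius Q lam x.
Proof. exact: expR_gt0. Qed.

Lemma quasi_system_sol (Q : R -> R) lam : continuous Q ->
  quasi_system Q lam (psol Q lam) (wsol Q lam).
Proof.
move=> cQ; split => x x01.
- apply: is_derive_eq (derM (deriv_radius lam cQ x01) (der_comp (deriv_angle cQ lam x01) (is_derive_sin _))) _.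
  rewrite /pr_radius /pr_angle /psol /wsol.
  have := cos2Dsin2 (angle Q lam x).
  move: (cos _) (sin _) => c s cs.
  transitivity (radius Q lam x * ((c ^+ 2 + s ^+ 2) * (Q x * s + c))); first by ring.
  by rewrite cs; ring.
- apply: is_derive_eq (derM (deriv_radius lam cQ x01) (der_comp (deriv_angle cQ lam x01) (is_derive_cos _))) _.
  rewrite /pr_radius /pr_angle /psol /wsol.
  have := cos2Dsin2 (angle Q lam x).
  move: (cos _) (sin _) => c s cs.
  transitivity (radius Q lam x * ((c ^+ 2 + s ^+ 2) * (- Q x * c - (Q x ^+ 2 + lam) * s))); first by ring.
  by rewrite cs; ring.
Qed.

Lemma psol0 (Q : R -> R) lam : continuous Q -> psol Q lam 0 = 0.
Proof. by move=> cQ; rewrite /psol angle0// sin0 mulr0. Qed.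

Section limits.
Variables (T : Type) (F : set_system T).
Context {FF : Filter F}.
Variables (Qt : T -> R -> R) (lt : T -> R) (Q : R -> R) (l : R).
Hypotheses (cQt : \forall t \near F, continuous (Qt t)) (cQ : continuous Q).
Hypotheses (QtQ : ucvg F Qt Q) (ltl : lt t @[t --> F] --> l).

Let bound : exists2 M : R, 0 <= M & (forall x : R, 0 <= x <= 1 -> `|Q x| <= M) /\
  \forall t \near F, forall x : R, 0 <= x <= 1 -> `|Qt t x| <= M.
Proof.
have [M M0 QM] := continuous_bounded01 cQ.
exists (M + 1); first lra.
split; first by move=> x x01; have := QM x x01; lra.
have := QtQ ltr01; apply: filterS => t h x x01.
have := h x x01; have := QM x x01; have := ler_normD (Qt t x - Q x) (Q x).
by rewrite subrK; lra.
Qed.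

Let dep_small (M c : R) : 0 < c -> 0 <= M -> forall e : R, 0 < e -> exists2 d : R, 0 < d &
  (2 * (1 + M) * d + d) * c <= e.
Proof.
move=> c0 M0 e e0; exists (e / (c * (2 * (1 + M) + 1))).
  by rewrite divr_gt0// mulr_gt0//; lra.
rewrite le_eqVlt; apply/orP; left; apply/eqP; field.
by rewrite !gt_eqF//; lra.
Qed.

Lemma ucvg_angle : ucvg F (fun t => angle (Qt t) (lt t)) (angle Q l).
Proof.
move=> e e0; have [M M0 [QM QtM]] := bound.
have [d d0 hd] := @dep_small M (expR (pr_lip M l)) (expR_gt0 _) M0 e e0.
near=> t => x x01.
have ct : continuous (Qt t) by near: t.
have tM : forall x : R, 0 <= x <= 1 -> `|Qt t x| <= M by near: t.
have h1 : forall x : R, 0 <= x <= 1 -> `|Qt t x - Q x| <= d by near: t; exact: QtQ.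
have h2 : `|l - lt t| <= d by near: t; move/cvgrPdist_le: ltl => /(_ d d0).
have := @angle_dep Q (Qt t) l (lt t) M d cQ ct (ltW d0) QM tM.
have h1' y : 0 <= y <= 1 -> `|Q y - Qt t y| <= d by rewrite distrC; exact: h1.
move=> /(_ h1' x x01); rewrite distrC => /le_trans; apply.
apply: le_trans hd; rewrite ler_wpM2r ?expR_ge0//; lra.
Unshelve. all: by end_near. Qed.

Lemma ucvg_radius : ucvg F (fun t => radius (Qt t) (lt t)) (radius Q l).
Proof.
apply: (ucvg_comp (@continuous_expR R)).
  exact: deriv_on_clamp (prim_deriv_on (continuous_log_radius (lam:=l) cQ)).
apply: ucvg_prim.
- by apply: filterS cQt => t ct; exact: continuous_log_radius.
- exact: continuous_log_radius.
move=> e e0; have [M M0 [QM QtM]] := bound.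
have e2 : 0 < e / 2 by rewrite divr_gt0.
have [d d0 hd] := @dep_small M 1 ltr01 M0 _ e2.
have p0 := pr_lip_gt0 l M0.
have ep : 0 < e / 2 / pr_lip M l by rewrite divr_gt0.
near=> t => x x01.
have tM : forall x : R, 0 <= x <= 1 -> `|Qt t x| <= M by near: t.
have hb : forall x : R, 0 <= x <= 1 -> `|Qt t x - Q x| <= d by near: t; exact: QtQ.
have hc : `|l - lt t| <= d by near: t; move/cvgrPdist_le: ltl => /(_ d d0).
have ha : forall x : R, 0 <= x <= 1 ->
    `|angle (Qt t) (lt t) x - angle Q l x| <= e / 2 / pr_lip M l.
  by near: t; exact: ucvg_angle.
rewrite (clampE x01).
have h1 := @pr_radius_lip R Q l M x (angle (Qt t) (lt t) x) (angle Q l x) (QM x x01).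
have hb' : `|Q x - Qt t x| <= d by rewrite distrC hb.
have h2 := @pr_radius_dep R Q (Qt t) l (lt t) M x d (angle (Qt t) (lt t) x) (QM x x01) (tM x x01) hb'.
have h3 : pr_lip M l * `|angle (Qt t) (lt t) x - angle Q l x| <= e / 2.
  by rewrite mulrC -ler_pdivlMr// ha.
have := ler_normB (pr_radius Q l x (angle (Qt t) (lt t) x) - pr_radius Q l x (angle Q l x))
  (pr_radius Q l x (angle (Qt t) (lt t) x) - pr_radius (Qt t) (lt t) x (angle (Qt t) (lt t) x)).
rewrite opprB addrC addrA subrK.
lra.
Unshelve. all: by end_near. Qed.

Let bounded_radius : bounded01 (radius Q l).
Proof. exact: cont01_bounded (deriv_on_clamp (deriv_radius l cQ)). Qed.

Lemma ucvg_psol : ucvg F (fun t => psol (Qt t) (lt t)) (psol Q l).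
Proof.
apply: ucvgM => //; last 2 first.
- exact: ucvg_radius.
- exact: ucvg_comp (@continuous_sin R) (deriv_on_clamp (deriv_angle cQ l)) ucvg_angle.
by exists 1 => // x _; exact: sin_max.
Qed.

Lemma ucvg_wsol : ucvg F (fun t => wsol (Qt t) (lt t)) (wsol Q l).
Proof.
apply: ucvgM => //; last 2 first.
- exact: ucvg_radius.
- exact: ucvg_comp (@continuous_cos R) (deriv_on_clamp (deriv_angle cQ l)) ucvg_angle.
by exists 1 => // x _; exact: cos_max.
Qed.

End limits.

End AngleConvergence.

(** * Eigenvalues *)

Section Eigenvalues.
Context {R : realType}.
Implicit Types (Q psi w : R -> R) (lam : R) (i n : nat).

Lemma sinDnpi n (t : R) : sin (n%:R * pi + t) = (-1) ^+ n * sin t.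
Proof.
elim: n => [|n IH]; first by rewrite mul0r add0r expr0 mul1r.
by rewrite -natr1 mulrDl mul1r addrAC sinDpi IH exprS mulN1r mulNr.
Qed.

Lemma sin_npi n : sin (n%:R * pi : R) = 0.
Proof. by rewrite -[_ * _]addr0 sinDnpi sin0 mulr0. Qed.

Lemma sin_eq0_ge n (t : R) : sin t = 0 -> n%:R * pi < t -> n.+1%:R * pi <= t.
Proof.
move=> st nt; rewrite leNgt; apply/negP => tn.
have h : 0 < t - n%:R * pi < pi by move: tn; rewrite -natr1 mulrDl mul1r => tn; lra.
have := sin_gt0_pi h => s0.
have : sin (n%:R * pi + (t - n%:R * pi)) = 0 by rewrite addrC subrK.
by rewrite sinDnpi => /eqP; rewrite mulf_eq0 signr_eq0 gt_eqF.
Qed.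

Lemma sin_eq0_gt0 (t : R) : sin t = 0 -> 0 < t -> exists i, t = i.+1%:R * pi.
Proof.
move=> st t0; have pi0 := pi_gt0 R.
have tp : 0 <= t / pi by rewrite divr_ge0 ?ltW.
have /andP[h1 h2] := truncn_itv tp.
move: h1 h2; rewrite ler_pdivlMr// ltr_pdivrMr//.
set n := Num.truncn _; move=> h1 h2.
have e : t = n%:R * pi.
  apply/eqP; rewrite eq_le h1 andbT leNgt; apply/negP => h3.
  by have := sin_eq0_ge st h3; lra.
case: n e {h1 h2} => [|n] e; last by exists n.
by move: t0; rewrite e mul0r ltxx.
Qed.

Section potential.
Variable Q : R -> R.
Hypothesis cQ : continuous Q.
Local Notation th := (angle Q).

Lemma angle_mono : {mono (fun lam => th lam 1) : l1 l2 / l1 <= l2}.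
Proof.
have [M _ QM] := continuous_bounded01 cQ.
by apply: le_mono => l1 l2 /= l12; exact: (angle_increasing cQ QM).
Qed.

Lemma angle_inj : injective (fun lam => th lam 1).
Proof. exact: inc_inj angle_mono. Qed.

Lemma continuous_angle_lam : continuous (fun lam => th lam 1).
Proof.
move=> l.
have H : ucvg (nbhs l) (fun t => angle Q t) (angle Q l).
  apply: (@ucvg_angle R R (nbhs l) _ (fun=> Q) (fun t => t)) => //.
  - by near=> t.
  - exact: ucvg_cst.
by apply: (ucvg_at _ H); rewrite ler01 lexx.
Unshelve. all: by end_near. Qed.

(** [angle_zero] produces a multiple of pi in each interval [j/N, (j+1)/N] when k
is large. It is sought in the right half of the interval: there the angle has
already left the value j pi, so that the multiple reached is a later one. *)
Lemma angle_unbounded n : exists lam, n.+1%:R * pi <= th lam 1.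
Proof.
have [M M0 QM] := continuous_bounded01 cQ.
have [N N0 NE] : exists2 N : R, 0 < N & N = n.+1%:R by exists n.+1%:R => //; rewrite ltr0n.
pose k := 4 * pi * N.
have pi0 := pi_gt0 R.
have k0 : 0 < k by rewrite !mulr_gt0.
exists (M ^+ 2 + k ^+ 2 / 2); set lam := _ + _.
have step (j : nat) : j%:R <= N -> j%:R * pi <= th lam (j%:R / N).
  elim: j => [|j IH] jN; first by rewrite !mul0r angle0.
  have jN' : j%:R + 1 <= N by rewrite natr1.
  have {}IH : j%:R * pi <= th lam (j%:R / N) by apply: IH; lra.
  have j0 : 0 <= j%:R / N by rewrite divr_ge0// ltW.
  have jN1 : j%:R / N + N^-1 <= 1.
    have : (j%:R + 1) / N <= 1 by rewrite ler_pdivrMr// mul1r.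
    by rewrite mulrDl div1r.
  have iN : 0 < N^-1 by rewrite invr_gt0.
  have je : j.+1%:R / N = j%:R / N + N^-1 by rewrite -natr1 mulrDl div1r.
  have [||||x /andP[x1 x2] sx] := @angle_zero R Q M cQ QM lam k (j%:R / N + N^-1 / 2) (j%:R / N + N^-1) k0 (lexx _).
  - lra.
  - lra.
  - lra.
  - have -> : k * (j%:R / N + N^-1 - (j%:R / N + N^-1 / 2)) = k * N^-1 / 2 by field; rewrite gt_eqF.
    by rewrite /k mulfK ?gt_eqF//; lra.
  have jx : j%:R * pi < th lam x.
    by apply: (angle_crosses_upward cQ QM (sin_npi j) j0 _ _ IH); lra.
  have jx1 := sin_eq0_ge sx jx.
  rewrite je; move: x2; rewrite le_eqVlt => /orP[/eqP <-//|x2].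
  apply/ltW/(angle_crosses_upward cQ QM (sin_npi j.+1) _ x2 _ jx1); lra.
by have := step n.+1; rewrite -NE divff ?gt_eqF// => ->.
Qed.

Lemma exists_eigenvalue i : exists lam, th lam 1 = i.+1%:R * pi.
Proof.
have [M M0 QM] := continuous_bounded01 cQ.
have [l2 h2] := angle_unbounded i.
have h1 := angle_le_pihalf cQ QM (lexx (- M ^+ 2)).
have pi0 := pi_gt0 R.
have h3 : pi / 2 <= i.+1%:R * pi :> R.
  rewrite mulrC ler_pM2r//; apply: (@le_trans _ _ 1); first lra.
  by rewrite ler1n.
have l12 : - M ^+ 2 <= l2 by rewrite -angle_mono; lra.
have [||c _ e] := @IVT R (fun l => th l 1) _ _ (i.+1%:R * pi) l12.
- exact/continuous_within/continuous_angle_lam.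
- by rewrite ge_min le_max h2 orbT andbT (le_trans h1).
by exists c.
Qed.

(** The eigenvalues of the quasi-derivative system, in increasing order. *)
Definition ev i : R := xget 0 [set lam | th lam 1 = i.+1%:R * pi].

Lemma evP i : th (ev i) 1 = i.+1%:R * pi.
Proof.
by apply: (@xgetPex _ 0 [set lam | th lam 1 = i.+1%:R * pi]); exact: exists_eigenvalue.
Qed.

Lemma ev_uniq i lam : th lam 1 = i.+1%:R * pi -> lam = ev i.
Proof. by move=> h; apply: angle_inj; rewrite /= h evP. Qed.

Lemma ev_increasing i j : (i < j)%N -> ev i < ev j.
Proof.
move=> ij; rewrite -(leW_mono angle_mono) !evP ltr_pM2r ?pi_gt0//.
by rewrite ltr_nat.
Qed.

Lemma ev_dvg : ev @ \oo --> +oo.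
Proof.
apply/cvgryPge => A; have pi0 := pi_gt0 R.
exists (Num.truncn (th A 1 / pi)) => // n /= hn.
rewrite -angle_mono evP -ler_pdivrMr//.
apply/ltW/(lt_le_trans (truncnS_gt _)).
by rewrite ler_nat.
Qed.

Lemma wronskian_cst l psi1 w1 psi2 w2 : quasi_system Q l psi1 w1 -> quasi_system Q l psi2 w2 ->
  forall x, 0 <= x <= 1 ->
  psi1 x * w2 x - w1 x * psi2 x = psi1 0 * w2 0 - w1 0 * psi2 0.
Proof.
move=> [dp1 dw1] [dp2 dw2] x x01.
have dW : deriv_on 0 1 (fun x => psi1 x * w2 x - w1 x * psi2 x) (fun=> 0).
  move=> t t01; apply: is_derive_eq (derB (derM (dp1 t t01) (dw2 t t01)) (derM (dw1 t t01) (dp2 t t01))) _.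
  by ring.
have := @deriv_on_eq R 0 1 _ (fun=> psi1 0 * w2 0 - w1 0 * psi2 0) _ dW.
by move=> -> // t _; exact: derC.
Qed.

(** Gronwall's inequality for psi^2 + w^2, run backwards from 1. *)
Lemma quasi_system_uniq l psi w : quasi_system Q l psi w -> psi 1 = 0 -> w 1 = 0 ->
  forall x, 0 <= x <= 1 -> psi x = 0.
Proof.
move=> [dp dw] p1 w1 x /andP[x0 x1].
have [M M0 QM] := continuous_bounded01 cQ.
pose N x := psi x ^+ 2 + w x ^+ 2.
pose N' x := 2 * (Q x * psi x ^+ 2 - Q x * w x ^+ 2 + (1 - (Q x ^+ 2 + l)) * (psi x * w x)).
have dN : deriv_on 0 1 N N'.
  move=> t t01; have dpt := dp t t01; have dwt := dw t t01.
  apply: is_derive_eq (derD (derM dpt dpt) (derM dwt dwt)) _.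
  by rewrite /N'; ring.
pose L := pr_lip M l.
have h t : 0 <= t <= 1 -> - L * N t <= N' t.
  move=> t01.
  have N0 : 0 <= N t by rewrite addr_ge0 ?sqr_ge0.
  have a1 : `|psi t ^+ 2| <= N t by rewrite ger0_norm ?sqr_ge0// lerDl sqr_ge0.
  have a2 : `|w t ^+ 2| <= N t by rewrite ger0_norm ?sqr_ge0// lerDr sqr_ge0.
  have a3 : `|psi t * w t| <= N t.
    rewrite ler_norml /N.
    have := sqr_ge0 (psi t + w t); have := sqr_ge0 (psi t - w t).
    have := sqr_ge0 (psi t); have := sqr_ge0 (w t).
    by move=> *; apply/andP; split; nra.
  have := norm_combination (Q t) (- Q t) (1 - (Q t ^+ 2 + l)) N0 a1 a2 a3.
  rewrite normrN.
  have -> : Q t * psi t ^+ 2 + - Q t * w t ^+ 2 + (1 - (Q t ^+ 2 + l)) * (psi t * w t) = N' t / 2.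
    by rewrite /N'; field.
  have k1 : `|1 - (Q t ^+ 2 + l)| <= 1 + (M ^+ 2 + `|l|).
    apply: (le_trans (ler_normB _ _)); rewrite normr1 lerD2l.
    apply: (le_trans (ler_normD _ _)); rewrite lerD2r normrX.
    by rewrite ler_pXn2r// ?nnegrE// QM.
  have k2 : (`|Q t| + `|Q t| + `|1 - (Q t ^+ 2 + l)|) * N t <= L / 2 * N t.
    by rewrite ler_wpM2r// /L /pr_lip; have := QM t t01; lra.
  by move=> /le_trans/(_ k2); rewrite ler_norml => /andP[+ _]; lra.
have hx t : x <= t <= 1 -> - L * N t <= N' t by move=> tx; apply: h; lra.
have := weighted_nondecreasing x1 (deriv_onS x0 (lexx _) dN) hx.
rewrite {2}/N p1 w1 expr0n/= addr0 mulr0.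
rewrite pmulr_rle0 ?expR_gt0// /N => N0.
have := sqr_ge0 (psi x); have := sqr_ge0 (w x) => ? ?.
have : psi x ^+ 2 = 0 by lra.
by move/eqP; rewrite sqrf_eq0 => /eqP.
Qed.

Lemma psol_ev_boundary i : psol Q (ev i) 0 = 0 /\ psol Q (ev i) 1 = 0.
Proof. by split; [exact: psol0|rewrite /psol evP sin_npi mulr0]. Qed.

Lemma psol_ev_neq0 i : exists2 x, 0 <= x <= 1 & psol Q (ev i) x != 0.
Proof.
have pi0 := pi_gt0 R.
have [||c] := @IVT R (th (ev i)) 0 1 (pi / 2) ler01.
- exact: deriv_on_within (deriv_angle cQ (ev i)).
- rewrite angle0// evP.
  have h : pi / 2 <= i.+1%:R * pi :> R.
    rewrite mulrC ler_pM2r//; apply: (@le_trans _ _ 1); first lra.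
    by rewrite ler1n.
  by rewrite ge_min le_max h orbT andbT divr_ge0// ltW.
rewrite in_itv/= => c01 e; exists c => //.
by rewrite /psol e sin_pihalf mulr1 gt_eqF// radius_gt0.
Qed.

Definition quasi_eigenvalue lam := exists psi w, [/\ quasi_system Q lam psi w,
  psi 0 = 0, psi 1 = 0 & exists2 x, 0 <= x <= 1 & psi x != 0].

(** The Wronskian of an eigenfunction psi and of psol vanishes at 0. At 1 it is
- w(1) psol(1), where w(1) cannot vanish; so psol vanishes at 1 and its angle
there is a multiple of pi. *)
Lemma quasi_eigenvalueP lam : quasi_eigenvalue lam <-> exists i, lam = ev i.
Proof.
split.
- move=> [psi [w [s p0 p1 [x x01 px]]]].
  have W := wronskian_cst s (quasi_system_sol lam cQ).
  have := W 1; rewrite ler01 lexx => /(_ isT); rewrite p0 p1 psol0// !mul0r mulr0 subr0 sub0r.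
  move=> /eqP; rewrite oppr_eq0 mulf_eq0 => /orP[/eqP w1|].
    by move: px; rewrite (quasi_system_uniq s p1 w1 x01) eqxx.
  rewrite mulf_eq0 gt_eqF ?radius_gt0//= => /eqP s1.
  have [M M0 QM] := continuous_bounded01 cQ.
  have := angle_gt0 cQ QM lam ltr01 (lexx _) => th0.
  by have [i /ev_uniq] := sin_eq0_gt0 s1 th0; exists i.
- move=> [i ->]; exists (psol Q (ev i)), (wsol Q (ev i)); split.
  + exact: quasi_system_sol.
  + by have [] := psol_ev_boundary i.
  + by have [] := psol_ev_boundary i.
  + by have [x x01 px] := psol_ev_neq0 i; exists x.
Qed.

End potential.

Section limits.
Variables (T : Type) (F : set_system T).
Context {FF : Filter F}.
Variables (Qt : T -> R -> R) (Q : R -> R).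
Hypotheses (cQt : \forall t \near F, continuous (Qt t)) (cQ : continuous Q).
Hypotheses (QtQ : ucvg F Qt Q).

(** The angles at 1 for ev Q i - e and ev Q i + e lie strictly on either side of
the value that defines the eigenvalue, and this persists for Qt near Q. *)
Lemma cvg_ev i : ev (Qt t) i @[t --> F] --> ev Q i.
Proof.
apply/cvgrPdist_lt => e e0.
have cang l : angle (Qt t) l 1 @[t --> F] --> angle Q l 1.
  have H : ucvg F (fun t => angle (Qt t) l) (angle Q l).
    by apply: ucvg_angle => //; exact: cvg_cst.
  by apply: (ucvg_at _ H); rewrite ler01 lexx.
have lo : angle Q (ev Q i - e) 1 < i.+1%:R * pi.
  by rewrite -(evP cQ) (leW_mono (angle_mono cQ)); lra.
have hi : i.+1%:R * pi < angle Q (ev Q i + e) 1.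
  by rewrite -(evP cQ) (leW_mono (angle_mono cQ)); lra.
near=> t.
have ct : continuous (Qt t) by near: t.
have h1 : angle (Qt t) (ev Q i - e) 1 < i.+1%:R * pi.
  by near: t; exact: (cvgr_lt _ (cang _)).
have h2 : i.+1%:R * pi < angle (Qt t) (ev Q i + e) 1.
  by near: t; exact: (cvgr_gt _ (cang _)).
move: h1 h2; rewrite -(evP ct) !(leW_mono (angle_mono ct)).
by rewrite ltr_norml => *; apply/andP; split; lra.
Unshelve. all: by end_near. Qed.

End limits.

End Eigenvalues.

(** * Absolutely continuous functions *)

Section AbsolutelyContinuous.
Context {R : realType}.
Implicit Types (f g h : R -> R) (x y : R).
Notation mu := (@lebesgue_measure R).

(** The closure properties below are all instances. *)
Lemma ac_dom f g h (K : R) : absolutely_continuous f -> absolutely_continuous g ->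
  (forall x y, 0 <= x <= 1 -> 0 <= y <= 1 ->
    `|h y - h x| <= K * (`|f y - f x| + `|g y - g x|)) -> absolutely_continuous h.
Proof.
move=> acf acg hfg e e0.
pose K1 := `|K| + 1.
have K10 : 0 < K1 by rewrite /K1; have := normr_ge0 K; lra.
have e2 : 0 < e / (2 * K1) by rewrite divr_gt0// mulr_gt0.
have [d1 d10 h1] := acf _ e2; have [d2 d20 h2] := acg _ e2.
exists (Num.min d1 d2); first by rewrite lt_min d10 d20.
move=> n a b ab tr; rewrite lt_min => /andP[s1 s2].
have {}h1 := h1 n a b ab tr s1; have {}h2 := h2 n a b ab tr s2.
apply: (@le_lt_trans _ _ (\sum_(i < n) K1 * (`|f (b i) - f (a i)| + `|g (b i) - g (a i)|))).
  apply: ler_sum => i _; have [a0 [abi b1]] := ab i.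
  apply: (le_trans (hfg (a i) (b i) _ _)); [lra..|].
  rewrite ler_wpM2r ?addr_ge0// /K1; have := ler_norm K; lra.
rewrite -mulr_sumr big_split/= mulrC -ltr_pdivlMr//.
have -> : e / K1 = e / (2 * K1) + e / (2 * K1) by field; rewrite gt_eqF.
exact: ltrD.
Qed.

Lemma ac_id : absolutely_continuous (fun x : R => x).
Proof.
move=> e e0; exists e => // n a b ab _ /le_lt_trans; apply.
by apply: ler_sum => i _; have [_ [abi _]] := ab i; rewrite ger0_norm// subr_ge0.
Qed.

Lemma ac_lipschitz f (K : R) :
  (forall x y, 0 <= x <= 1 -> 0 <= y <= 1 -> x <= y -> `|f y - f x| <= K * (y - x)) ->
  absolutely_continuous f.
Proof.
move=> fK; apply: (@ac_dom _ _ f K ac_id ac_id) => x y x01 y01.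
have h : forall x y : R, 0 <= x <= 1 -> 0 <= y <= 1 -> `|f y - f x| <= `|K| * `|y - x|.
  move=> {x y x01 y01} x y x01 y01.
  wlog xy : x y x01 y01 / x <= y => [H|].
    by have [/H|/ltW /H] := leP x y; [exact|rewrite distrC [X in _ * X]distrC; exact].
  apply: (le_trans (fK _ _ x01 y01 xy)).
  rewrite (ger0_norm (_ : 0 <= y - x)) ?subr_ge0// ler_wpM2r ?subr_ge0//.
  exact: ler_norm.
have K0 : 0 <= K.
  by have := fK 0 1; rewrite !lexx ler01 subr0 mulr1 => /(_ isT isT isT); exact: le_trans.
apply: (le_trans (h x y x01 y01)); rewrite ger0_norm//.
by rewrite ler_wpM2l// lerDl.
Qed.

Lemma ac_deriv f f' : deriv_on 0 1 f f' -> bounded01 f' -> absolutely_continuous f.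
Proof.
move=> df [B B0 hB]; apply: (@ac_lipschitz f B) => x y x01 y01 xy.
have := @deriv_on_norm_le R x y f f' (fun x => B * x) (fun=> B) xy.
rewrite -mulrBr; apply.
- by apply: deriv_onS df; lra.
- by move=> t _; exact: derZX.
- by move=> t txy; apply: hB; lra.
Qed.

Lemma acB f g : absolutely_continuous f -> absolutely_continuous g ->
  absolutely_continuous (fun x => f x - g x).
Proof.
move=> acf acg; apply: (@ac_dom f g _ 1) => // x y _ _; rewrite mul1r.
have -> : f y - g y - (f x - g x) = (f y - f x) - (g y - g x) by ring.
exact: ler_normB.
Qed.

Lemma acD f g : absolutely_continuous f -> absolutely_continuous g ->
  absolutely_continuous (fun x => f x + g x).
Proof.
move=> acf acg; apply: (@ac_dom f g _ 1) => // x y _ _; rewrite mul1r.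
have -> : f y + g y - (f x + g x) = (f y - f x) + (g y - g x) by ring.
exact: ler_normD.
Qed.

Lemma acM f g : bounded01 f -> bounded01 g ->
  absolutely_continuous f -> absolutely_continuous g ->
  absolutely_continuous (fun x => f x * g x).
Proof.
move=> [B B0 fB] [C C0 gC] acf acg; apply: (@ac_dom f g _ (B + C)) => // x y x01 y01.
have -> : f y * g y - f x * g x = (f y - f x) * g y + f x * (g y - g x) by ring.
apply: (le_trans (ler_normD _ _)); rewrite !normrM.
have h1 : `|f y - f x| * `|g y| <= `|f y - f x| * C by rewrite ler_wpM2l// gC.
have h2 : `|f x| * `|g y - g x| <= B * `|g y - g x| by rewrite ler_wpM2r// fB.
have h3 : 0 <= `|f y - f x| * B by rewrite mulr_ge0.
have h4 : 0 <= `|g y - g x| * C by rewrite mulr_ge0.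
lra.
Qed.

(** Finitely many intervals [a, b] below x, listed from right to left, whose
interiors are disjoint and contained in U. *)
Fixpoint chain (U : set R) x (s : seq (R * R)) : Prop :=
  match s with
  | [::] => 0 <= x
  | ab :: s' => [/\ ab.1 <= ab.2, ab.2 <= x, `]ab.1, ab.2[%classic `<=` U & chain U ab.1 s']
  end.

Lemma chain_le U x y s : x <= y -> chain U x s -> chain U y s.
Proof.
by case: s => [|[a b] s]/= xy; [move=> x0; lra|move=> [? ? ? ?]; split => //; lra].
Qed.

Lemma chain_ge0 U x s : chain U x s -> 0 <= x.
Proof. by elim: s x => [//|[a b] s IH] x /= [ab bx _ /IH]; lra. Qed.

Lemma chain_nth U x s i : chain U x s -> (i < size s)%N ->
  [/\ 0 <= (nth (0, 0) s i).1, (nth (0, 0) s i).1 <= (nth (0, 0) s i).2 &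
      (nth (0, 0) s i).2 <= x].
Proof.
elim: s x i => [//|[a b] s IH] x [|i]/= [ab bx _ c] si.
  by split => //; exact: chain_ge0 c.
by have [? ? ?] := IH _ i c si; split => //; lra.
Qed.

Lemma chain_disjoint U x s i j : chain U x s -> (i < j)%N -> (j < size s)%N ->
  (nth (0, 0) s j).2 <= (nth (0, 0) s i).1.
Proof.
elim: s x i j => [//|[a b] s IH] x [|i] [|j]//= [ab bx _ c] ij sj.
  by have [] := chain_nth c sj.
exact: (IH a i j c).
Qed.

(** Induction along the chain: each interval adds its length to the measure of the
part of U on its left. *)
Lemma chain_length U x s : open U -> chain U x s ->
  ((\sum_(p <- s) (p.2 - p.1))%:E <= mu (U `&` `]-oo, x[))%E.
Proof.
move=> oU; elim: s x => [|[a b] s IH] x /=.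
  by rewrite big_nil measure_ge0.
move=> [ab bx abU c]; rewrite big_cons/= EFinD.
have mU : measurable U by exact: measurable_realfun.open_measurable.
apply: (@le_trans _ _ (mu (`]a, b[%classic `|` (U `&` `]-oo, a[)))); last first.
  apply: le_measure; rewrite ?inE.
  - by apply: measurableU => //; exact: measurableI.
  - exact: measurableI.
  - move=> t [/= tab|[Ut /=]].
      split; first exact: abU.
      by move: tab; rewrite /= !in_itv/= => /andP[_ tb]; lra.
    by rewrite !in_itv/= => ta; split => //; lra.
have -> : mu (`]a, b[%classic `|` (U `&` `]-oo, a[)) =
    (mu `]a, b[%classic + mu (U `&` `]-oo, a[))%E.
  apply: measureU => //; first exact: measurableI.
  by apply/seteqP; split => // t [/=]; rewrite !in_itv/= => /andP[? _] [_]; lra.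
apply: leeD; last exact: IH.
rewrite lebesgue_measure_itv/= lte_fin.
by case: ifP => // /negbT; rewrite -leNgt => ba; rewrite lee_fin; lra.
Qed.

(** Cover the exceptional null set by an open set U so small
that the oscillation of f over finitely many disjoint intervals inside U is
below e. Elsewhere f moves at speed at most e. Creeping from 0 to x, each step
is of one of these two kinds. *)
Lemma ac_deriv0_cst f : absolutely_continuous f ->
  {ae mu, forall x, 0 <= x <= 1 -> is_derive x 1 f 0} ->
  forall x, 0 <= x <= 1 -> f x = f 0.
Proof.
move=> acf [N [mN N0 hN]] x0 /andP[x00 x01].
apply/eqP; rewrite -subr_eq0 -normr_eq0 eq_le normr_ge0 andbT.
apply/ler_addgt0Pr => e' e'0; rewrite add0r.
pose e := e' / 2; have e0 : 0 < e by rewrite divr_gt0.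
have [d d0 hd] := acf e e0.
have Nfin : (mu N < +oo)%E by have -> : mu N = 0%E by exact: N0.
have [U [oU NU mU]] := lebesgue_regularity_outer mN Nfin d0.
have {}mU : (mu U < d%:E)%E.
  apply: le_lt_trans mU.
  have mUm : measurable U by exact: measurable_realfun.open_measurable.
  have mUN : measurable (U `\` N) by exact: measurableD.
  apply: (@le_trans _ _ (mu ((U `\` N) `|` N))).
    apply: le_measure; rewrite ?inE//; first exact: measurableU.
    by move=> t Ut; have [Nt|nNt] := pselect (N t); [right|left].
  have h : (mu ((U `\` N) `|` N) <= mu (U `\` N) + mu N)%E by exact: measureU2.
  have muN : mu N = 0%E by exact: N0.
  by move: h; rewrite muN adde0.
have local c : 0 <= c <= 1 -> exists2 r, 0 < r &
    (forall y, `|c - y| < r -> U y) \/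
    (forall y, `|c - y| < r -> `|f y - f c| <= e * `|y - c|).
  move=> c01; have [Uc|nUc] := pselect (U c).
    have /nbhs_ballP[r /= r0 hr] : nbhs c U by exact: open_nbhs_nbhs.
    by exists r => //; left => y yr; apply: hr.
  have dc : is_derive c 1 f 0.
    by apply: contrapT => ndc; apply: nUc; apply: NU; apply: hN => /= /(_ c01).
  have : h^-1 *: ((f \o shift c) (h *: (1 : R)) - f c) @[h --> (0 : R)^'] --> (0 : R).
    have [dd dv] := dc.
    have : h^-1 *: ((f \o shift c) (h *: (1 : R)) - f c) @[h --> (0 : R)^'] --> 'D_1 f c by exact: dd.
    by rewrite dv.
  move=> /cvgrPdist_le/(_ e e0) /nbhs_ballP[r /= r0 hr].
  exists r => //; right => y yr; have [->|yc] := eqVneq y c.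
    by rewrite !subrr normr0 mulr0.
  have := hr (y - c); rewrite /ball/= sub0r normrN distrC => /(_ yr).
  rewrite subr_eq0 => /(_ yc); rewrite /shift/= sub0r normrN /GRing.scale/= mulr1 subrK.
  by rewrite normrM normfV mulrC (distrC y c) ler_pdivrMr// normr_gt0 subr_eq0 eq_sym.
pose var (s : seq (R * R)) := \sum_(p <- s) `|f p.2 - f p.1|.
pose S := [set y | 0 <= y <= x0 /\ exists2 s, chain U y s & `|f y - f 0| <= e * y + var s].
have S0 : S 0.
  split; first by rewrite lexx.
  by exists [::] => //=; rewrite subrr normr0 mulr0 /var big_nil addr0.
have Sle y : S y -> y <= x0 by move=> [/andP[]].
pose c := sup S.
have c0 : 0 <= c by apply: ub_le_sup => //; exists x0 => y /Sle.
have cx0 : c <= x0 by apply: ge_sup; [exists 0|move=> y /Sle].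
have hS : has_sup S by split; [exists 0|exists x0 => y /Sle].
have c01 : 0 <= c <= 1 by lra.
have [r r0 hr] := local c c01.
have [y Sy cy] := sup_adherent r0 hS.
have yc : y <= c by apply: ub_le_sup => //; exists x0 => z /Sle.
rewrite -/c in cy.
have step z : c <= z -> z < c + r -> z <= x0 -> S z.
  move=> cz zr zx; split; first lra.
  have [/andP[y0 yx] [s cs fs]] := Sy.
  have tri : `|f z - f 0| <= `|f z - f y| + `|f y - f 0|.
    by have := ler_normD (f z - f y) (f y - f 0); rewrite addrA subrK.
  case: hr => hr.
    exists ((y, z) :: s).
      split => //=; first lra.
      move=> t /=; rewrite in_itv/= => /andP[t1 t2]; apply: hr.
      by rewrite ltr_norml; lra.
    have : e * y <= e * z by rewrite ler_wpM2l ?(ltW e0)//; lra.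
    by rewrite /var big_cons/= -/(var s); lra.
  exists s; first by apply: chain_le cs; lra.
  have h1 := hr z; have h2 := hr y.
  have {}h1 : `|f z - f c| <= e * (z - c).
    by have := h1 _; rewrite (ger0_norm (_ : 0 <= z - c)) ?subr_ge0//; apply; rewrite ltr_norml; lra.
  have {}h2 : `|f y - f c| <= e * (c - y).
    by have := h2 _; rewrite (distrC y) (ger0_norm (_ : 0 <= c - y)) ?subr_ge0//; apply; lra.
  have := ler_normB (f z - f c) (f y - f c).
  have -> : f z - f c - (f y - f c) = f z - f y by ring.
  lra.
have Sc : S c by apply: step; lra.
have ce : c = x0.
  apply/eqP; rewrite eq_le cx0 leNgt; apply/negP => clt.
  pose z := Num.min x0 (c + r / 2).
  have cz : c < z by rewrite lt_min clt ltrDl divr_gt0.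
  have zx : z <= x0 by rewrite ge_min lexx.
  have zr : z <= c + r / 2 by rewrite ge_min lexx orbT.
  have : S z by apply: step => //; lra.
  by move=> Sz; have : z <= c by [apply: ub_le_sup => //; exists x0 => t /Sle]; lra.
have [_ [s cs fs]] := Sc; rewrite ce in cs fs.
suff vs : var s < e.
  have : e * x0 <= e * 1 by rewrite ler_wpM2l ?(ltW e0).
  by rewrite /e in vs fs *; lra.
rewrite /var (big_nth (0, 0)) big_mkord.
apply: (hd (size s) (fun i => (nth (0, 0) s i).1) (fun i => (nth (0, 0) s i).2)).
- by move=> i; have [? ? ?] := chain_nth cs (ltn_ord i); do 2 split => //; lra.
- apply/trivIsetP => i j _ _ ij.
  have H (k l : 'I_(size s)) : (k < l)%N ->
     `](nth (0, 0) s k).1, (nth (0, 0) s k).2[%classic `&` `](nth (0, 0) s l).1, (nth (0, 0) s l).2[ = set0.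
    move=> kl; apply/seteqP; split => // t [/=]; rewrite !in_itv/= => /andP[? _] /andP[_ ?].
    by have := chain_disjoint cs kl (ltn_ord l); lra.
  have := ij; rewrite -val_eqE neq_ltn => /orP[/H//|/H]; by rewrite setIC.
- have := chain_length oU cs; rewrite (big_nth (0, 0)) big_mkord => h.
  rewrite -lte_fin; apply: (le_lt_trans h); apply: le_lt_trans mU.
  by apply: le_measure; rewrite ?inE//; [apply: measurableI => //|]; exact: measurable_realfun.open_measurable.
Qed.

End AbsolutelyContinuous.

(** * Primitives of integrable potentials *)

Section Primitive.
Context {R : realType}.
Notation mu := (@lebesgue_measure R).
Variable f : R -> R.
Hypothesis intf : mu.-integrable setT (EFin \o f).

(** The Lebesgue primitive on [0,1], continued by constants. *)
Definition lprim (x : R) : R := \int[mu]_(t in `[0, clamp x]) f t.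

Let intfS (A : set R) : measurable A -> mu.-integrable A (EFin \o f).
Proof. by move=> mA; apply: integrableS intf. Qed.

Lemma lprim0 : lprim 0 = 0.
Proof. by rewrite /lprim clampE ?lexx ?ler01// set_itv1 Rintegral_set1. Qed.

Lemma lprim_clamp x : lprim (clamp x) = lprim x.
Proof. by rewrite /lprim clampK. Qed.

Lemma lprimB x y : 0 <= x -> x <= y -> y <= 1 ->
  lprim y - lprim x = \int[mu]_(t in `]x, y[) f t.
Proof.
move=> x0 xy y1; rewrite /lprim !clampE ?x0 ?(le_trans xy)// ?y1 ?(le_trans x0)//.
rewrite Rintegral_itvB//; first last.
- exact: intfS.
- by rewrite Rintegral_itv_bndo_bndc//; exact: intfS.
Qed.

Lemma lprim_norm_le x y : 0 <= x -> x <= y -> y <= 1 ->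
  `|lprim y - lprim x| <= \int[mu]_(t in `]x, y[) `|f t|.
Proof.
move=> x0 xy y1; rewrite lprimB//; apply: le_normr_Rintegral => //.
exact: intfS.
Qed.

Lemma ac_lprim : absolutely_continuous lprim.
Proof.
move=> e e0; have [d [d0 hd]] := integral_normr_continuous intf e0.
exists d => // n a b ab tr sd.
pose I i := `]a i, b i[%classic.
pose D := \big[setU/set0]_(i < n) I i.
have mI i : measurable (I i) by exact: measurable_itv.
have mD : measurable D by exact: bigsetU_measurable.
have intI i : mu.-integrable (I i) (EFin \o (fun t => `|f t|)).
  by apply: integrable_norm; exact: intfS.
apply: (@le_lt_trans _ _ (\int[mu]_(t in D) `|f t|)); last first.
  have muD : mu D = (\sum_(i < n) mu (I i))%E by exact: measure_semi_additive_ord.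
  apply: hd => //; rewrite [X in (X < _)%E](_ : _ = (\sum_(i < n) mu (I i))%E) ?muD//.
  rewrite (eq_bigr (fun i => (b i - a i)%:E)); last first.
    move=> i _; have [a0 [aib b1]] := ab i; rewrite lebesgue_measure_itv/= lte_fin.
    by rewrite lt_neqAle aib andbT; case: (eqVneq (a i) (b i)) => [->|_]/=; rewrite ?subrr.
  by rewrite sumEFin lte_fin.
rewrite (_ : \int[mu]_(t in D) `|f t| = \sum_(i < n) \int[mu]_(t in I i) `|f t|).
  by apply: ler_sum => i _; have [a0 [aib b1]] := ab i; exact: lprim_norm_le.
rewrite /Rintegral ge0_integral_bigsetU//=.
- rewrite sum_fine// => i _.
  apply: integrable_fin_num; [exact: mI|exact: intI].
- exact: index_enum_uniq.
- by apply: sub_trivIset tr.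
- have : mu.-integrable D (EFin \o (fun t => `|f t|)) by apply: integrable_norm; exact: intfS.
  by move=> /integrableP[].
Qed.

Lemma ac_within_continuous (g : R -> R) : absolutely_continuous g ->
  continuous (fun x => g (clamp x)).
Proof.
move=> acg x; apply/cvgrPdist_lt => e e0.
have [d d0 hd] := acg e e0.
have /cvgrPdist_lt/(_ d d0) := @continuous_clamp R x.
apply: filterS => y.
have /andP[x0 x1] := clamp01 x; have /andP[y0 y1] := clamp01 y.
move: (clamp x) (clamp y) x0 x1 y0 y1 => {x y} x y x0 x1 y0 y1.
wlog xy : x y x0 x1 y0 y1 / x <= y => [H h|h].
  have [xy|/ltW yx] := leP x y; first exact: H.
  by rewrite distrC; apply: H => //; rewrite distrC.
have := hd 1%N (fun=> x) (fun=> y); rewrite !big_ord1 distrC; apply.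
- by move=> _.
- by move=> i j _ _ _; rewrite !ord1.
- by apply: le_lt_trans h; rewrite distrC ler_norm.
Qed.

Lemma continuous_lprim : continuous lprim.
Proof.
have -> : lprim = (fun x => lprim (clamp x)) by apply/funext => x; rewrite lprim_clamp.
exact: ac_within_continuous ac_lprim.
Qed.

Lemma ae_derive_lprim : {ae mu, forall x : R, 0 <= x <= 1 ->
  0 < x < 1 /\ is_derive x 1 lprim (f x)}.
Proof.
have fl : locally_integrable [set: R] f.
  have fE : f \_ setT = f by apply/funext => x; rewrite patchE in_setT.
  by rewrite -fE; exact: integrable_locally measurableT intf.
have ftc := FTC1 (a := BLeft 0) (fun y => intfS (measurable_itv _)) fl.
cbv zeta in ftc.
have n0 : {ae mu, forall x, x != 0 :> R}.
  exists [set 0]; split => //; first exact: lebesgue_measure_set1.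
  by move=> x /=; move/negP; rewrite negbK => /eqP.
have n1 : {ae mu, forall x, x != 1 :> R}.
  exists [set 1]; split => //; first exact: lebesgue_measure_set1.
  by move=> x /=; move/negP; rewrite negbK => /eqP.
move: n0 n1 ftc.
apply: (@filterS3 _ (almost_everywhere mu) (ae_filter_ringOfSetsType mu)) => x x0 x1 h /andP[x00 x11].
have x01 : 0 < x < 1 by rewrite !lt_neqAle x00 x11 x1 eq_sym x0.
split => //.
have [|hd he] := h _; first by rewrite /= lte_fin; case/andP: x01.
have D : is_derive x 1 (fun x => \int[mu]_(t in `[0, x]) f t) (f x).
  by apply: DeriveDef; [exact: hd|rewrite -derive1E; exact: he].
apply: near_eq_is_derive D.
have : \forall y \near x, y \in `]0, 1[.
  by apply: near_in_itvoo; rewrite in_itv/=.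
apply: filterS => y; rewrite in_itv/= => /andP[y0 y1].
by rewrite /lprim clampE// !ltW.
Qed.

End Primitive.

Section SturmLiouville.
Context {R : realType}.
Notation mu := (@lebesgue_measure R).
Variable q : R -> R.
Hypothesis intq : mu.-integrable setT (EFin \o (q \_ Omega)).
Notation Q := (lprim (q \_ Omega)).

Lemma OmegaP (x : R) : Omega x <-> 0 <= x <= 1.
Proof. by rewrite /Omega/= in_itv/=. Qed.

Lemma continuous_within_clamp (g : R -> R) : {within Omega, continuous g} ->
  continuous (fun x => g (clamp x)).
Proof.
move=> cg x; apply/cvgrPdist_lt => e e0.
have H : within Omega (nbhs (clamp x)) (fun t => `|g (clamp x) - g t| < e).
  have := cg (clamp x) => /cvgrPdist_lt/(_ e e0).
  rewrite /nbhs/= /nbhs_subspace; case: ifPn => [_ //|].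
  by move=> /negP[]; apply/mem_set/OmegaP/clamp01.
have h := @continuous_clamp R x (fun t => Omega t -> `|g (clamp x) - g t| < e) H.
near=> y.
have hy : Omega (clamp y) -> `|g (clamp x) - g (clamp y)| < e by near: y; exact: h.
by apply: hy; apply/OmegaP/clamp01.
Unshelve. all: by end_near. Qed.

(** Replaces a function that has one-sided derivatives at 0 and 1 by one with
two-sided derivatives. *)
Lemma C1_derivative_extend (g g' : R -> R) : C1_derivative g g' ->
  deriv_on 0 1 (fun x => g 0 + prim (fun t => g' (clamp t)) x) g' /\
  (forall x, 0 <= x <= 1 -> g x = g 0 + prim (fun t => g' (clamp t)) x).
Proof.
move=> [cg cg' dg]; have cc := continuous_within_clamp cg'.
have d1 : deriv_on 0 1 (fun x => g 0 + prim (fun t => g' (clamp t)) x) g'.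
  move=> x x01; have := derD (derC (g 0) x) (prim_deriv_on cc x01).
  by rewrite add0r clampE.
split => // x /andP[x0 x1].
have [||c _] := @MVT_segment R (fun x => g x - (g 0 + prim (fun t => g' (clamp t)) x)) (fun=> 0) 0 x x0.
- move=> y; rewrite in_itv/= => /andP[y0 yx].
  have y1 : 0 < y < 1 by rewrite y0 (lt_le_trans yx).
  have := derB (dg y y1) (d1 y _); rewrite subrr; apply.
  by rewrite !ltW// (lt_le_trans yx).
- have h : {within `[0, x], continuous g} by apply: continuous_subspaceW cg; apply: subset_itvl; rewrite bnd_simp.
  have h2 : {within `[0, x], continuous (fun x => g 0 + prim (fun t => g' (clamp t)) x)}.
    exact: deriv_on_within (deriv_onS (lexx _) x1 d1).
  by move=> y; apply: cvgB; [exact: h|exact: h2].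
by rewrite mul0r prim0 addr0 subrr subr0 => /eqP; rewrite subr_eq0 => /eqP.
Qed.

(** The function psi' - Q psi is absolutely continuous and has almost everywhere
the derivative that the system prescribes, which is continuous. It differs by a
constant from a primitive w of this derivative. *)
Lemma dirichlet_eigenvalue_quasi lam : dirichlet_eigenvalue q lam -> quasi_eigenvalue Q lam.
Proof.
move=> [psi [[psi' [C1 acp' aep]] [p0 p1] [x0 /OmegaP x0O px0]]].
have [dp pE] := C1_derivative_extend C1.
have [cp cp' _] := C1.
set psit := fun x => _ in dp.
have {}pE x : 0 <= x <= 1 -> psi x = psit x by exact: pE.
have cpc := continuous_within_clamp cp; have cpc' := continuous_within_clamp cp'.
have cQ : continuous Q := continuous_lprim intq.
pose k t := - Q t * psi' (clamp t) - lam * psi (clamp t).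
have ck : continuous k.
  apply: contB; apply: contM => //; first exact: contN.
  exact: contC.
pose w x := psi' 0 - Q 0 * psi 0 + prim k x.
have dw : deriv_on 0 1 w k.
  by move=> x x01; have := derD (derC (psi' 0 - Q 0 * psi 0) x) (prim_deriv_on ck x01); rewrite add0r.
have bQ : bounded01 Q by exact: continuous_bounded01.
have bp : bounded01 psit.
  by have [B B0 h] := continuous_bounded01 cpc; exists B => // x x01; rewrite -pE// -(clampE x01) h.
have ach : absolutely_continuous (fun x => psi' x - Q x * psit x - w x).
  apply: acB; last by apply: ac_deriv dw _; exact: continuous_bounded01.
  apply: acB => //; apply: acM => //; first exact: ac_lprim.
  apply: ac_deriv dp _.
  by have [B B0 h] := continuous_bounded01 cpc'; exists B => // x x01; rewrite -(clampE x01) h.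
have wE x : 0 <= x <= 1 -> psi' x - Q x * psi x = w x.
  move=> x01; rewrite pE//.
  have := ac_deriv0_cst ach _ x01.
  have w0 : w 0 = psi' 0 - Q 0 * psi 0 by rewrite /w prim0 addr0.
  have p00 : psit 0 = psi 0 by rewrite -pE ?lexx ?ler01.
  rewrite p00 w0 subrr => h.
  apply/eqP; rewrite -subr_eq0; apply/eqP; apply: h.
  have := ae_derive_lprim intq; move: aep.
  apply: (@filterS2 _ (almost_everywhere mu) (ae_filter_ringOfSetsType mu)) => y hy1 hy2 y01.
  have [dp' e] := hy1 (iffRL (OmegaP y) y01).
  have [_ dQ] := hy2 y01.
  have dp'' : is_derive y 1 psi' (psi'^`()%classic y).
    by apply: DeriveDef => //; rewrite derive1E.
  apply: is_derive_eq (derB (derB dp'' (derM dQ (dp y y01))) (dw y y01)) _.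
  rewrite patchE mem_set; last exact/OmegaP.
  rewrite -pE// /k clampE//.
  have alg (a b c d g : R) : - a + b * c = lam * c ->
      a - (b * c + d * g) - (- d * g - lam * c) = 0.
    move=> abc; have -> : a = b * c - lam * c by lra.
    by ring.
  exact: alg e.
exists psit, w; split.
- split.
    by apply: deriv_on_ext dp _ => x x01; rewrite -pE// -wE//; ring.
  apply: deriv_on_ext dw _ => x x01; rewrite /k clampE//.
  by rewrite -pE// -wE//; ring.
- by rewrite -pE ?lexx ?ler01.
- by rewrite -pE ?lexx ?ler01.
- by exists x0; rewrite // -pE.
Qed.

Lemma quasi_dirichlet_eigenvalue lam : quasi_eigenvalue Q lam -> dirichlet_eigenvalue q lam.
Proof.
move=> [psi [w [[dp dw] p0 p1 [x0 x0O px0]]]].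
exists psi; split => //; last by exists x0 => //; exact/OmegaP.
have cQ : continuous Q := continuous_lprim intq.
have cpc := deriv_on_clamp dp; have cwc := deriv_on_clamp dw.
have bp : bounded01 psi.
  by have [B B0 h] := continuous_bounded01 cpc; exists B => // x x01; rewrite -(clampE x01) h.
have cp' : continuous (fun x => Q (clamp x) * psi (clamp x) + w (clamp x)).
  by apply: contD => //; apply: contM => //; exact: cont_comp (@continuous_clamp R) cQ.
have cw' : continuous (fun x => - Q (clamp x) * w (clamp x) - (Q (clamp x) ^+ 2 + lam) * psi (clamp x)).
  have cQc := cont_comp (@continuous_clamp R) cQ.
  apply: contB; apply: contM => //; first exact: contN.
  by apply: contD; [exact: contXn|exact: contC].
have acp : absolutely_continuous psi.
  apply: ac_deriv dp _; have [B B0 h] := continuous_bounded01 cp'.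
  by exists B => // x x01; rewrite -{1}(clampE x01) -{2 3}(clampE x01) h.
have acw : absolutely_continuous w.
  apply: ac_deriv dw _; have [B B0 h] := continuous_bounded01 cw'.
  by exists B => // x x01; have := h x x01; rewrite clampE.
exists (fun x => Q x * psi x + w x); split.
- split.
  + exact: deriv_on_within dp.
  + have h1 := deriv_on_within dp; have h2 := deriv_on_within dw.
    have h3 : {within Omega, continuous Q} by exact: continuous_within.
    by move=> x; apply: cvgD; [apply: cvgM; [exact: h3|exact: h1]|exact: h2].
  + by move=> x /andP[x00 x1]; apply: dp; rewrite !ltW.
- apply: acD => //; apply: acM => //; first exact: continuous_bounded01.
  exact: ac_lprim.
- have := ae_derive_lprim intq.
  apply: (@filterS _ (almost_everywhere mu) (ae_filter_ringOfSetsType mu)) => x hx /OmegaP x01.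
  have [_ dQ] := hx x01.
  have d2 := derD (derM dQ (dp x x01)) (dw x x01).
  have [h1 h2] := d2; split; first exact: h1.
  rewrite derive1E h2 patchE mem_set; last exact/OmegaP.
  ring.
Qed.

(** By induction on the index, each value is the least one in the range beyond the
previous values. *)
Lemma increasing_range_inj (l1 l2 : nat -> R) :
  (forall i j, (i < j)%N -> l1 i < l1 j) -> (forall i j, (i < j)%N -> l2 i < l2 j) ->
  range l1 = range l2 -> l1 = l2.
Proof.
move=> m1 m2 e; apply/funext.
have le (a b : nat -> R) : (forall i j, (i < j)%N -> a i < a j) ->
    (forall i j, (i < j)%N -> b i < b j) -> range a = range b -> forall i,
    (forall j, (j < i)%N -> a j = b j) -> b i <= a i.
  move=> ma mb eab i IH.
  have : range b (a i) by rewrite -eab; exists i.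
  move=> [k _ bk]; rewrite -bk; have [ik|ki] := leqP i k.
    by move: ik; rewrite leq_eqVlt => /orP[/eqP->//|/mb/ltW].
  by have := ma _ _ ki; rewrite IH// bk ltxx.
move=> i; elim/ltn_ind: i => i IH; apply/eqP; rewrite eq_le.
by rewrite (le l2 l1)// ?(le l1 l2)// => j ji; rewrite IH.
Qed.

Lemma nth_eigenvalueE : nth_eigenvalue q = ev Q.
Proof.
have cQ : continuous Q := continuous_lprim intq.
have H : eigenvalue_sequence q (ev Q).
  split.
  - exact: ev_increasing.
  - apply/seteqP; split => [_ [i _ <-]|lam /=].
      by apply: quasi_dirichlet_eigenvalue; apply/(quasi_eigenvalueP cQ); exists i.
    move=> /dirichlet_eigenvalue_quasi /(quasi_eigenvalueP cQ)[i ->].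
    by exists i.
  - exact: ev_dvg.
have [m r _] : eigenvalue_sequence q (nth_eigenvalue q).
  by apply: (@xgetPex _ (fun=> 0) [set l | eigenvalue_sequence q l]); exists (ev Q).
have [m' r' _] := H.
by apply: (increasing_range_inj m m'); rewrite r r'.
Qed.

End SturmLiouville.

(** * First variation of an eigenvalue *)

Section Variation.
Context {R : realType}.
Implicit Types (Q P psi w : R -> R).

(** Lagrange's identity: (psi1 w2 - w1 psi2)' = (Q1 - Q2) (psi1 psi2)' +
(l1 - l2) psi1 psi2, where only first derivatives of psi1, psi2 appear. *)
Lemma lagrange_identity Q1 Q2 l1 l2 psi1 w1 psi2 w2 : continuous Q1 -> continuous Q2 ->
  quasi_system Q1 l1 psi1 w1 -> quasi_system Q2 l2 psi2 w2 ->
  psi1 0 = 0 -> psi1 1 = 0 -> psi2 0 = 0 -> psi2 1 = 0 ->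
  (l1 - l2) * int01 (fun x => psi1 x * psi2 x) =
  - int01 (fun x => (Q1 x - Q2 x) *
      ((Q1 x * psi1 x + w1 x) * psi2 x + psi1 x * (Q2 x * psi2 x + w2 x))).
Proof.
move=> cQ1 cQ2 [dp1 dw1] [dp2 dw2] p10 p11 p20 p21.
have cp1 := deriv_on_clamp dp1; have cp2 := deriv_on_clamp dp2.
have cw1 := deriv_on_clamp dw1; have cw2 := deriv_on_clamp dw2.
have c1 := continuous_cont01 cQ1; have c2 := continuous_cont01 cQ2.
rewrite -int01Z; last exact: contM.
set f1 := fun x => _; set f2 := fun x => (Q1 x - Q2 x) * _.
have cf1 : cont01 f1 by apply: contM; [exact: contC|exact: contM].
have cf2 : cont01 f2.
  apply: contM; first exact: contB.
  by apply: contD; apply: contM => //; apply: contD => //; apply: contM.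
suff : int01 f1 + int01 f2 = 0 by lra.
rewrite -int01D//.
rewrite (@int01E _ _ (fun x => psi1 x * w2 x - w1 x * psi2 x)).
- by rewrite p10 p11 p20 p21 !mul0r !mulr0 !subrr.
- exact: contD.
- move=> x x01.
  apply: is_derive_eq (derB (derM (dp1 x x01) (dw2 x x01)) (derM (dw1 x x01) (dp2 x x01))) _.
  by rewrite /f1 /f2; ring.
Qed.

Variables (Q P : R -> R) (i : nat).
Hypotheses (cQ : continuous Q) (cP : continuous P).

Local Notation phi := (psol Q (ev Q i)).
Local Notation w := (wsol Q (ev Q i)).

Lemma cont01_psol Q1 l : continuous Q1 -> cont01 (psol Q1 l).
Proof. by move=> c1; have [dp _] := quasi_system_sol l c1; exact: deriv_on_clamp dp. Qed.

Lemma cont01_wsol Q1 l : continuous Q1 -> cont01 (wsol Q1 l).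
Proof. by move=> c1; have [_ dw] := quasi_system_sol l c1; exact: deriv_on_clamp dw. Qed.

Lemma int01_psol2_gt0 : 0 < int01 (fun x => phi x * phi x).
Proof.
have cp := cont01_psol (l:=ev Q i) cQ.
have c2 : cont01 (fun x => phi x * phi x) by exact: contM.
have p0 x : 0 <= x <= 1 -> 0 <= phi x * phi x by rewrite -expr2 sqr_ge0.
rewrite lt_neqAle int01_ge0// andbT; apply/eqP => N0.
have [x x01] := psol_ev_neq0 cQ i.
have := @int01_eq0 R _ c2 p0 _ x x01; rewrite -N0 lexx => /(_ isT) /eqP.
by rewrite mulf_eq0 orbb => ->.
Qed.

(** Quotient of the two sides of Lagrange's identity for Q + t P and Q. An
integration by parts would give the familiar form (int P' phi^2) / int phi^2. *)
Lemma ev_variation :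
  (ev (fun x => Q x + t * P x) i - ev Q i) / t @[t --> 0^'+] -->
  - int01 (fun x => P x * (2 * (Q x * phi x + w x) * phi x))
    / int01 (fun x => phi x * phi x).
Proof.
pose Qt t x := Q x + t * P x.
have cQt t : continuous (Qt t) by apply: contD => //; apply: contM => //; exact: contC.
have ncQt : \forall t \near (0 : R)^'+, continuous (Qt t) by near=> t.
have uQ : ucvg (0 : R)^'+ Qt Q by apply: ucvg_line; exact: continuous_bounded01.
have ul : ev (Qt t) i @[t --> (0 : R)^'+] --> ev Q i by exact: cvg_ev.
have up : ucvg (0 : R)^'+ (fun t => psol (Qt t) (ev (Qt t) i)) phi by exact: ucvg_psol.
have uw : ucvg (0 : R)^'+ (fun t => wsol (Qt t) (ev (Qt t) i)) w by exact: ucvg_wsol.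
have cp l := cont01_psol (l:=l) cQ; have cw l := cont01_wsol (l:=l) cQ.
have cpt t := cont01_psol (l:=ev (Qt t) i) (cQt t); have cwt t := cont01_wsol (l:=ev (Qt t) i) (cQt t).
have c1 := continuous_cont01 cQ; have c2 := continuous_cont01 cP.
have c1t t := continuous_cont01 (cQt t).
pose N t := int01 (fun x => psol (Qt t) (ev (Qt t) i) x * phi x).
pose D t := int01 (fun x => P x *
  ((Qt t x * psol (Qt t) (ev (Qt t) i) x + wsol (Qt t) (ev (Qt t) i) x) * phi x +
   psol (Qt t) (ev (Qt t) i) x * (Q x * phi x + w x))).
have cD t : cont01 (fun x => P x *
  ((Qt t x * psol (Qt t) (ev (Qt t) i) x + wsol (Qt t) (ev (Qt t) i) x) * phi x +
   psol (Qt t) (ev (Qt t) i) x * (Q x * phi x + w x))).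
  apply: contM; first exact: c2.
  apply: contD; apply: contM.
  - by apply: contD; [apply: contM; [exact: c1t|exact: cpt]|exact: cwt].
  - exact: cp.
  - exact: cpt.
  - by apply: contD; [apply: contM; [exact: c1|exact: cp]|exact: cw].
have cQp : cont01 (fun x => Q x * phi x + w x).
  by apply: contD; [apply: contM; [exact: c1|exact: cp]|exact: cw].
have gr t : (ev (Qt t) i - ev Q i) * N t = - (t * D t).
  have [pt0 pt1] := psol_ev_boundary (cQt t) i; have [p0 p1] := psol_ev_boundary cQ i.
  rewrite /N (lagrange_identity (cQt t) cQ (quasi_system_sol _ (cQt t)) (quasi_system_sol _ cQ))//.
  rewrite /D -int01Z.
    by congr (- _); apply: eq_int01 => x _; rewrite {1}/Qt; ring.
  exact: cD.
have N0 := int01_psol2_gt0.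
have Ncvg : N t @[t --> (0 : R)^'+] --> int01 (fun x => phi x * phi x).
  apply: (@ucvg_int R R (0 : R)^'+ _ (fun t x => psol (Qt t) (ev (Qt t) i) x * phi x)).
  - by near=> t; apply: contM; [exact: cpt|exact: cp].
  - by apply: contM; exact: cp.
  - apply: ucvgM; [exact: cont01_bounded|exact: cont01_bounded|exact: up|exact: ucvg_cst].
have Dcvg : D t @[t --> (0 : R)^'+] --> int01 (fun x => P x * (2 * (Q x * phi x + w x) * phi x)).
  rewrite (_ : int01 _ = int01 (fun x => P x * ((Q x * phi x + w x) * phi x + phi x * (Q x * phi x + w x)))); last first.
    by apply: eq_int01 => x _; ring.
  apply: (@ucvg_int R R (0 : R)^'+ _ (fun t x => P x *
    ((Qt t x * psol (Qt t) (ev (Qt t) i) x + wsol (Qt t) (ev (Qt t) i) x) * phi x +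
     psol (Qt t) (ev (Qt t) i) x * (Q x * phi x + w x)))).
  - by near=> t; exact: cD.
  - by apply: contM; [exact: c2|apply: contD; apply: contM; [exact: cQp|exact: cp|exact: cp|exact: cQp]].
  have bp := cont01_bounded (cp (ev Q i)); have bq := cont01_bounded cQp.
  have bP := cont01_bounded c2.
  apply: ucvgM.
  + exact: bP.
  + apply: cont01_bounded; apply: contD; apply: contM; [exact: cQp|exact: cp|exact: cp|exact: cQp].
  + exact: ucvg_cst.
  + apply: ucvgD.
      apply: ucvgM; [exact: bq|exact: bp| |exact: ucvg_cst].
      apply: ucvgD; last exact: uw.
      by apply: ucvgM; [exact: cont01_bounded|exact: bp|exact: uQ|exact: up].
    by apply: ucvgM; [exact: bp|exact: bq|exact: up|exact: ucvg_cst].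
have H : - D t / N t @[t --> (0 : R)^'+] -->
  - int01 (fun x => P x * (2 * (Q x * phi x + w x) * phi x)) / int01 (fun x => phi x * phi x).
  apply: cvgM; first exact: cvgN.
  by apply: cvgV => //; rewrite gt_eqF.
apply: cvg_trans H; apply: near_eq_cvg; near=> t.
have Nt : 0 < N t by near: t; exact: (cvgr_gt _ Ncvg).
have tt : 0 < t by near: t; exact: nbhs_right_gt.
have Nn : N t != 0 by rewrite gt_eqF.
have tn : t != 0 by rewrite gt_eqF.
apply/eqP; rewrite eqr_div//.
have -> : (ev (fun x => Q x + t * P x) i - ev Q i) * N t = - (t * D t) by exact: gr.
by rewrite mulNr mulrC.
Unshelve. all: by end_near. Qed.

End Variation.

(** * The ball of potentials *)

Section Lp.
Context {R : realType}.
Notation mu := (@lebesgue_measure R).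
Implicit Types (q Q b : R -> R).

Lemma continuous_norm_powR (a : R) : 0 < a -> continuous (fun y : R => `|y| `^ a).
Proof.
move=> a0 y; have [->|y0] := eqVneq y 0; last first.
  apply: (@continuous_comp _ _ _ (fun y : R => `|y|) (fun z => z `^ a)); first exact: norm_continuous.
  apply: derive_continuous (is_derive1_powR a _).
  by rewrite normr_gt0.
apply/cvgrPdist_lt => e e0; rewrite normr0 powR0 ?gt_eqF//.
apply/nbhs_ballP; exists (e `^ a^-1); first by rewrite /= powR_gt0.
move=> z; rewrite /ball/= !sub0r !normrN => ze.
rewrite ger0_norm ?powR_ge0//.
have -> : e = (e `^ a^-1) `^ a by rewrite -powRrM mulVf ?gt_eqF// powRr1// ltW.
by apply: gt0_ltr_powR; rewrite // ?nnegrE ?powR_ge0.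
Qed.

Lemma cont01_powR (a : R) (f : R -> R) : 0 < a -> (forall x, 0 <= f x) -> cont01 f ->
  cont01 (fun x => f x `^ a).
Proof.
move=> a0 f0 cf; have -> : (fun x => f x `^ a) = (fun x => `|f x| `^ a).
  by apply/funext => x; rewrite ger0_norm.
exact: cont_comp cf (continuous_norm_powR a0).
Qed.

Lemma mOmega : measurable (Omega : set (measurableTypeR R)). Proof. exact: measurable_itv. Qed.

Lemma le_integrable_real (A : set (measurableTypeR R)) (f g : R -> R) :
  measurable A -> measurable_fun A f -> (forall x, A x -> `|f x| <= g x) ->
  mu.-integrable A (EFin \o g) -> mu.-integrable A (EFin \o f).
Proof.
move=> mA mf fg; apply: le_integrable => //; first exact/measurable_EFinP.
by move=> x Ax /=; rewrite lee_fin (le_trans (fg x Ax))// ler_norm.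
Qed.

Lemma Lp_ballP p r q : 1 < p -> 0 < r -> Lp_ball p r q <->
  measurable_fun (Omega : set (measurableTypeR R)) q /\ (\int[mu]_(x in Omega) (`|q x| `^ p)%:E <= (r `^ p)%:E)%E.
Proof.
move=> p1 r0; have p0 : 0 < p by lra.
set f := q \_ Omega.
have If : ('N[mu]_p%:E[EFin \o f] `^ p)%E = (\int[mu]_(x in Omega) (`|q x| `^ p)%:E)%E.
  have pn0 : p != 0 by rewrite gt_eqF.
  rewrite (poweR_Lnorm _ _ pn0) [RHS]integral_mkcond.
  apply: eq_integral => x _; rewrite /= /f !patchE; case: ifPn => _ //.
  by rewrite normr0 powR0// gt_eqF.
have N0 : (0 <= 'N[mu]_p%:E[EFin \o f])%E by exact: Lnorm_ge0.
split.
- move=> [/= fL Nr]; split.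
    apply/(measurable_restrictT _ mOmega).
    by move: fL; rewrite /Lfun inE/= => /andP[+ _]; rewrite inE.
  rewrite -If; apply: (le_trans (gt0_ler_poweR (ltW p0) _ _ Nr)).
  + by rewrite in_itv/= N0 leey.
  + by rewrite in_itv/= lee_fin (ltW r0) leey.
  + by rewrite poweR_EFin.
- move=> [mq Iq].
  have Nr : ('N[mu]_p%:E[EFin \o f] <= r%:E)%E.
    have e (x : \bar R) : (0 <= x)%E -> x = ((x `^ p) `^ p^-1)%E.
      by move=> x0; rewrite -poweRrM mulfV ?gt_eqF// poweRe1.
    rewrite (e _ N0) (e r%:E) ?lee_fin ?(ltW r0)//.
    apply: gt0_ler_poweR.
    + by rewrite invr_ge0 ltW.
    + by rewrite in_itv/= poweR_ge0 leey.
    + by rewrite poweR_EFin in_itv/= lee_fin powR_ge0 leey.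
    + by rewrite If poweR_EFin.
  split; last exact: Nr.
  rewrite /Lfun inE/=; apply/andP; split; rewrite inE/=.
    exact/(measurable_restrictT _ mOmega).
  by rewrite /finite_norm (le_lt_trans Nr)// ltry.
Qed.

Variables (p r : R).
Hypotheses (hp : 1 < p) (hr : 0 < r).
Local Notation p' := (p / (p - 1)).

Let p0 : 0 < p. Proof. by have := hp; lra. Qed.

Let p10 : 0 < p - 1. Proof. by have := hp; lra. Qed.

Lemma conj_gt1 : 1 < p'.
Proof. by rewrite ltr_pdivlMr//; lra. Qed.

Lemma conj_gt0 : 0 < p'. Proof. by have := conj_gt1; lra. Qed.

Lemma conj_sum : p^-1 + p'^-1 = 1.
Proof. by rewrite invf_div; field; rewrite gt_eqF. Qed.

Lemma conj_sub1 : (p' - 1) * p = p'.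
Proof. by field; rewrite gt_eqF. Qed.

Lemma conj_sub1_gt0 : 0 < p' - 1. Proof. by have := conj_gt1; lra. Qed.

Lemma young (a b : R) : a * b <= `|a| `^ p / p + `|b| `^ p' / p'.
Proof.
apply: (le_trans (ler_norm _)); rewrite normrM.
by apply: conjugate_powR => //; [exact: conj_gt0|exact: conj_sum].
Qed.

Section ball.
Variable q : R -> R.
Hypothesis qB : Lp_ball p r q.

Let mq : measurable_fun (Omega : set (measurableTypeR R)) q. Proof. by have [] := (Lp_ballP q hp hr).1 qB. Qed.

Let Iq : (\int[mu]_(x in Omega) (`|q x| `^ p)%:E <= (r `^ p)%:E)%E.
Proof. by have [] := (Lp_ballP q hp hr).1 qB. Qed.

Let mqp : measurable_fun (Omega : set (measurableTypeR R)) (fun x => (`|q x| `^ p)%:E).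
Proof.
apply/measurable_EFinP.
apply: (@measurableT_comp _ _ _ _ _ _ (fun y : R => y `^ p)).
  exact: measurable_realfun.measurable_powR.
exact: measurableT_comp.
Qed.

Let intqp : mu.-integrable Omega (EFin \o (fun x => `|q x| `^ p)).
Proof.
apply/integrableP; split; first exact: mqp.
apply: (@le_lt_trans _ _ (\int[mu]_(x in Omega) (`|q x| `^ p)%:E)%E).
  rewrite le_eqVlt; apply/orP; left; apply/eqP; apply: eq_integral => x _.
  by rewrite /= ger0_norm// powR_ge0.
by apply: (le_lt_trans Iq); rewrite ltry.
Qed.

Let int1 : mu.-integrable Omega (EFin \o (fun=> 1 : R)).
Proof. by apply: continuous_itv_integrable => x; exact: cvg_cst. Qed.

Lemma Lp_ball_integrable_Omega : mu.-integrable Omega (EFin \o q).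
Proof.
apply: (@le_integrable_real _ q (fun x => `|q x| `^ p + 1) mOmega mq).
- move=> x _.
  have := young `|q x| 1; rewrite mulr1 normr_id normr1 powR1 => /le_trans; apply.
  apply: lerD.
    by rewrite ler_pdivrMr// ler_peMr ?powR_ge0// ltW.
  by rewrite ler_pdivrMr ?conj_gt0// mul1r ltW// conj_gt1.
- exact: (integrableD mOmega intqp int1).
Qed.

Lemma Lp_ball_integrable : mu.-integrable setT (EFin \o (q \_ Omega)).
Proof.
rewrite -restrict_EFin; apply/(integrable_mkcond _ mOmega).
exact: Lp_ball_integrable_Omega.
Qed.

Notation qq := (q \_ Omega).

Let qqE x : Omega x -> qq x = q x.
Proof. by move=> Ox; rewrite patchE mem_set. Qed.

Let RintM (A : set (measurableTypeR R)) (b : R -> R) : measurable A -> A `<=` Omega ->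
  mu.-integrable A (EFin \o b) ->
  (forall x, A x -> 0 <= b x) ->
  forall c1, 0 <= c1 ->
  \int[mu]_(t in A) (c1 * `|q t| `^ p + b t) <= c1 * r `^ p + \int[mu]_(t in A) b t.
Proof.
move=> mA AO ib b0 c1 c10.
have iqA : mu.-integrable A (EFin \o (fun x => `|q x| `^ p)).
  by apply: (integrableS mOmega mA AO); exact: intqp.
have iq1 : mu.-integrable A (EFin \o (fun t => c1 * `|q t| `^ p)) by exact: (integrableZl mA c1 iqA).
rewrite RintegralD// lerD2r RintegralZl//; rewrite ler_wpM2l//.
have h0 : (0 <= \int[mu]_(x in A) (`|q x| `^ p)%:E)%E.
  by apply: integral_ge0 => x _; rewrite lee_fin powR_ge0.
have h1 : (\int[mu]_(x in A) (`|q x| `^ p)%:E <= (r `^ p)%:E)%E.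
  apply: le_trans Iq; apply: ge0_subset_integral => //; first exact: mOmega.
by rewrite /Rintegral; move: h0 h1; case: (\int[mu]_(x in A) _)%E => // s; rewrite !lee_fin.
Qed.

(** Young's inequality for |q| = (eta |q|) eta^-1 over an interval of length d.
The minimum over eta is the Holder modulus r d^(1/p'). *)
Definition modulus (eta d : R) := eta `^ p * (r `^ p) / p + d * (eta^-1 `^ p' / p').

Lemma lprim_modulus eta x y : 0 < eta -> 0 <= x -> x <= y -> y <= 1 ->
  `|lprim qq y - lprim qq x| <= modulus eta (y - x).
Proof.
move=> eta0 x0 xy y1.
apply: (le_trans (lprim_norm_le Lp_ball_integrable x0 xy y1)).
pose A : set (measurableTypeR R) := `]x, y[%classic.
have mA : measurable A by exact: measurable_itv.
have AO : A `<=` Omega.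
  by move=> t; rewrite /A/= in_itv/= => /andP[xt ty]; apply/OmegaP; lra.
pose c2 := eta^-1 `^ p' / p'.
have c20 : 0 <= c2 by rewrite divr_ge0 ?powR_ge0// ltW// conj_gt0.
have ic2 : mu.-integrable A (EFin \o (fun=> c2)).
  apply: integrableS (continuous_itv_integrable x y (fun t => cvg_cst c2)) => //.
  exact: subset_itv_oo_cc.
have iqA : mu.-integrable A (EFin \o (fun x => `|q x| `^ p)).
  by apply: (integrableS mOmega mA AO); exact: intqp.
pose c1 := eta `^ p / p.
have iq1 : mu.-integrable A (EFin \o (fun t => c1 * `|q t| `^ p)) by exact: (integrableZl mA c1 iqA).
apply: (@le_trans _ _ (\int[mu]_(t in A) (c1 * `|q t| `^ p + c2))).
  apply: le_Rintegral => //.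
  - apply: integrable_norm; apply: integrableS Lp_ball_integrable => //.
  - exact: (integrableD mA iq1 ic2).
  move=> t /AO At; rewrite qqE//.
  have := young (eta * `|q t|) eta^-1.
  rewrite mulrAC divff ?gt_eqF// mul1r => /le_trans; apply.
  rewrite normrM normr_id (gtr0_norm eta0) (powRM _ (ltW eta0) (normr_ge0 _)) (gtr0_norm (_ : 0 < eta^-1)) ?invr_gt0//.
  by rewrite mulrAC.
apply: (le_trans (RintM mA AO ic2 _ _)) => //.
  by rewrite divr_ge0 ?powR_ge0// ltW.
rewrite /modulus /c1 mulrAC lerD2l Rintegral_cst//.
have -> : fine (mu A) = y - x.
  have -> : mu A = lebesgue_measure (`]x, y[%classic : set R) by [].
  rewrite lebesgue_measure_itv/= lte_fin lt_neqAle xy andbT.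
  by case: (eqVneq x y) => [->|_]/=; rewrite ?subrr.
by rewrite mulrC.
Qed.

(** Both sides, as functions of the upper bound, are absolutely continuous and have
the same derivative almost everywhere. *)
Lemma lprim_by_parts b b' : deriv_on 0 1 b b' -> cont01 b' -> b 0 = 0 -> b 1 = 0 ->
  - int01 (fun x => lprim qq x * b' x) = \int[mu]_(t in Omega) (q t * b (clamp t)).
Proof.
move=> db cb' b0 b1.
have intq := Lp_ball_integrable.
have cb : continuous (fun x => b (clamp x)) by exact: deriv_on_clamp db.
have cQ := continuous_lprim intq; have cQ1 := continuous_cont01 cQ.
pose h t := qq t * b (clamp t).
have ih : mu.-integrable setT (EFin \o h).
  have [B B0 hB] := cont01_bounded cb.
  apply: (@le_integrable_real setT h (fun x => B * `|qq x|) measurableT).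
  - apply: measurable_funM; first by have /integrableP[/measurable_EFinP] := intq.
    exact: continuous_measurable_fun.
  - move=> x _; rewrite /h normrM mulrC ler_wpM2r//.
    by apply: hB; exact: clamp01.
  - exact: (integrableZl measurableT B (integrable_norm intq)).
pose Z x := lprim qq x * b x - lprim h x - prim (fun t => lprim qq (clamp t) * b' (clamp t)) x.
have cQb : cont01 (fun x => lprim qq x * b' x) by exact: contM.
have dP := prim_cont01 cQb.
have acb : absolutely_continuous b by apply: ac_deriv db _; exact: cont01_bounded.
have acZ : absolutely_continuous Z.
  apply: acB; last by apply: ac_deriv dP _; exact: cont01_bounded.
  apply: acB; last exact: ac_lprim.
  apply: acM; [exact: cont01_bounded|exact: cont01_bounded|exact: ac_lprim|exact: acb].
have Z1 : Z 1 = Z 0.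
  apply: ac_deriv0_cst acZ _ 1 _; last by rewrite ler01 lexx.
  move: (ae_derive_lprim intq) (ae_derive_lprim ih).
  apply: (@filterS2 _ (almost_everywhere mu) (ae_filter_ringOfSetsType mu)) => x h1 h2 x01.
  have [_ d1] := h1 x01; have [_ d2] := h2 x01.
  apply: is_derive_eq (derB (derB (derM d1 (db x x01)) d2) (dP x x01)) _.
  by rewrite /h clampE//; ring.
have : lprim h 1 = - int01 (fun x => lprim qq x * b' x).
  move: Z1; rewrite /Z b0 b1 !lprim0 prim0 !mulr0 !subr0 sub0r.
  by rewrite -/(int01 (fun x => lprim qq x * b' x)); lra.
move=> <-; rewrite /lprim clampE ?ler01 ?lexx//.
by apply: eq_Rintegral => x xO; rewrite /h patchE xO.
Qed.

(** Young's inequality for q b, after an integration by parts. *)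
Lemma lprim_dual b b' : deriv_on 0 1 b b' -> cont01 b' -> b 0 = 0 -> b 1 = 0 ->
  - int01 (fun x => lprim qq x * b' x) <=
    r `^ p / p + int01 (fun x => `|b x| `^ p') / p'.
Proof.
move=> db cb' b0 b1; rewrite (lprim_by_parts db cb' b0 b1).
have cb : continuous (fun x => b (clamp x)) by exact: deriv_on_clamp db.
have cbp : continuous (fun x => `|b (clamp x)| `^ p').
  exact: cont_comp cb (continuous_norm_powR conj_gt0).
pose c t := p'^-1 * `|b (clamp t)| `^ p'.
have cc : continuous c by apply: contM => //; exact: contC.
have ic : mu.-integrable Omega (EFin \o c) by exact: continuous_itv_integrable.
have iq1 : mu.-integrable Omega (EFin \o (fun t => p^-1 * `|q t| `^ p)) by exact: (integrableZl mOmega p^-1 intqp).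
apply: (@le_trans _ _ (\int[mu]_(t in Omega) (p^-1 * `|q t| `^ p + c t))).
  apply: le_Rintegral; first exact: mOmega.
  - apply: (@integrableMl _ _ _ _ _ mOmega _ (fun t => b (clamp t)) Lp_ball_integrable_Omega).
      apply: measurable_funTS; exact: continuous_measurable_fun.
    have [B B0 hB] := cont01_bounded cb.
    exists B; split; first exact: num_real.
    by move=> M BM x /OmegaP x01; apply: le_trans (ltW BM); have := hB x x01; rewrite clampE.
  - exact: (integrableD mOmega iq1 ic).
  - by move=> t _; rewrite /c ![_^-1 * _]mulrC; exact: young.
apply: (le_trans (RintM mOmega (fun=> id) ic _ _)).
- by move=> x _; rewrite /c mulr_ge0 ?invr_ge0 ?powR_ge0// ltW// conj_gt0.
- by rewrite invr_ge0 ltW.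
- rewrite mulrC lerD2l.
  have -> : \int[mu]_(t in Omega) c t = p'^-1 * \int[mu]_(t in Omega) `|b (clamp t)| `^ p'.
    by apply: RintegralZl; [exact: mOmega|exact: continuous_itv_integrable].
  rewrite mulrC ler_wpM2r ?invr_ge0 ?(ltW conj_gt0)// int01_Rintegral; last exact: cbp.
  by rewrite le_eqVlt; apply/orP; left; apply/eqP; apply: eq_Rintegral => x /set_mem/OmegaP x01; rewrite clampE.
Qed.

End ball.

End Lp.

(** * Compactness *)

Section Compactness.
Context {R : realType}.
Variables (p r : R).
Hypotheses (hp : 1 < p) (hr : 0 < r).
Local Notation p' := (p / (p - 1)).
Local Notation T := {ptws R -> R}.
Implicit Types (Q b : R -> R).

Let p0 : 0 < p. Proof. by have := hp; lra. Qed.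

Definition equicont : set (R -> R) := [set Q | [/\ forall x, Q x = Q (clamp x), Q 0 = 0 &
  forall eta x y, 0 < eta -> 0 <= x -> x <= y -> y <= 1 ->
    `|Q y - Q x| <= modulus p r eta (y - x)]].

Definition dual_bound Q := forall b b', deriv_on 0 1 b b' -> cont01 b' ->
  b 0 = 0 -> b 1 = 0 ->
  - int01 (fun x => Q x * b' x) <= r `^ p / p + int01 (fun x => `|b x| `^ p') / p'.

(** A compact convex set of functions containing the primitives of the
potentials in the ball. The second condition is the bound on the norm of Q' in
dual form, which makes sense although Q' need not be a function. *)
Definition admissible : set (R -> R) := [set Q | equicont Q /\ dual_bound Q].

Lemma lprim_admissible q : Lp_ball p r q -> admissible (lprim (q \_ Omega)).
Proof.
move=> qB; split; last by move=> b b'; exact: lprim_dual.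
split.
- by move=> x; rewrite lprim_clamp.
- exact: lprim0.
- by move=> eta x y; exact: lprim_modulus.
Qed.

Lemma modulus_small e : 0 < e -> exists eta d, [/\ 0 < eta, 0 < d &
  forall t, t <= d -> modulus p r eta t <= e].
Proof.
move=> e0; have rp : 0 < r `^ p by rewrite powR_gt0.
pose a := e / 2 * p / r `^ p.
have a0 : 0 < a by rewrite !mulr_gt0// invr_gt0.
pose eta := a `^ p^-1.
have eta0 : 0 < eta by rewrite powR_gt0.
have etap : eta `^ p = a by rewrite /eta -powRrM mulVf ?gt_eqF// powRr1// ltW.
pose c := eta^-1 `^ p' / p'.
have c0 : 0 < c by rewrite divr_gt0 ?powR_gt0 ?invr_gt0// conj_gt0.
exists eta, (e / 2 / c); split; [exact: eta0|by apply: divr_gt0 c0; apply: divr_gt0|].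
move=> t td; rewrite /modulus etap -/c.
have -> : a * r `^ p / p = e / 2 by rewrite /a; field; rewrite !gt_eqF.
have : t * c <= e / 2 by rewrite -ler_pdivlMr.
lra.
Qed.

Lemma equicont_dist Q : equicont Q -> forall eta x y, 0 < eta ->
  0 <= x <= 1 -> 0 <= y <= 1 -> `|Q y - Q x| <= modulus p r eta `|y - x|.
Proof.
move=> [_ _ h] eta x y eta0 x01 y01; have [xy|/ltW yx] := leP x y.
  have yx : 0 <= y - x by rewrite subr_ge0.
  by rewrite (ger0_norm yx); apply: h; [exact: eta0|move: x01; lra|exact: xy|move: y01; lra].
have xy : 0 <= x - y by rewrite subr_ge0.
by rewrite distrC (distrC y) (ger0_norm xy); apply: h; [exact: eta0|move: y01; lra|exact: yx|move: x01; lra].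
Qed.

Lemma equicont_continuous Q : equicont Q -> continuous Q.
Proof.
move=> eQ; have [hc _ _] := eQ; move=> x; apply/cvgrPdist_le => e e0.
have [eta [d [eta0 d0 hd]]] := modulus_small e0.
have /cvgrPdist_le/(_ _ d0) := @continuous_clamp R x.
apply: filterS => y yd; rewrite (hc x) (hc y).
apply: le_trans (equicont_dist eQ eta0 (clamp01 y) (clamp01 x)) _.
exact: hd.
Qed.

Let ptws_filter (Q : T) : Filter (nbhs Q) := nbhs_filter Q.

Let admissible_filter (Q : T) : Filter (within admissible (nbhs Q)).
Proof. exact: (@within_filter T admissible (nbhs Q) (ptws_filter Q)). Qed.

Lemma near_ptws (Q : T) x e : 0 < e -> \forall f \near Q, `|Q x - (f : R -> R) x| < e.
Proof.
move=> e0; have H2 : nbhs (Q x : R) [set y | `|Q x - y| < e].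
  by apply/nbhs_ballP; exists e.
exact: (@proj_continuous R (fun=> R) x Q _ H2).
Qed.

(** Closeness on a finite grid controls the uniform distance of functions with a
common modulus of continuity. *)
Lemma ucvg_ptws Q : equicont Q ->
  ucvg (within equicont (nbhs (Q : T))) (fun f : T => (f : R -> R)) Q.
Proof.
move=> eQ e e0.
have e3 : 0 < e / 3 by rewrite divr_gt0.
have [eta [d [eta0 d0 hd]]] := modulus_small e3.
have [n hn] : exists n : nat, d^-1 < n.+1%:R.
  by exists (Num.truncn d^-1); exact: truncnS_gt.
have n0 : (0 : R) < n.+1%:R by rewrite ltr0n.
have nd : (n.+1%:R : R)^-1 <= d by rewrite -[d]invrK lef_pV2 ?posrE ?invr_gt0// ltW.
have : \forall f \near (Q : T), forall j : 'I_n.+2,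
    `|Q (j%:R / n.+1%:R) - (f : R -> R) (j%:R / n.+1%:R)| < e / 3.
  by apply: (@filter_forall T _ _ (nbhs (Q : T)) (ptws_filter Q)) => j; exact: near_ptws.
apply: (@filterS T (nbhs (Q : T)) (ptws_filter Q)) => f hf ef x x01.
have [x0 x1] := andP x01.
have xn : 0 <= x * n.+1%:R by rewrite mulr_ge0// ltW.
have /andP[k1 k2] := truncn_itv xn; set k := Num.truncn _ in k1 k2.
have kn : (k < n.+2)%N.
  rewrite -(ltr_nat R); apply: (le_lt_trans k1).
  apply: (@le_lt_trans _ _ n.+1%:R); last by rewrite ltr_nat.
  by rewrite ler_piMl// ltW.
have := hf (Ordinal kn) => /= h.
pose g : R := k%:R / n.+1%:R.
have g0 : 0 <= g by rewrite divr_ge0// ltW.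
have gx : g <= x by rewrite ler_pdivrMr.
have xg : `|x - g| <= d.
  rewrite ger0_norm ?subr_ge0//; apply: le_trans nd.
  have : x < (k.+1%:R) / n.+1%:R by rewrite ltr_pdivlMr.
  have -> : k.+1%:R / n.+1%:R = g + n.+1%:R^-1 by rewrite -[k.+1%:R]natr1 mulrDl div1r.
  by move=> /ltW; rewrite addrC -lerBlDr.
have g01 : 0 <= g <= 1 by lra.
have h1 := le_trans (equicont_dist ef eta0 g01 x01) (hd _ xg).
have h2 := le_trans (equicont_dist eQ eta0 g01 x01) (hd _ xg).
rewrite -/g in h.
have := ler_normB (f x - f g) (Q x - Q g).
have := ler_normB (f x - f g - (Q x - Q g)) (Q g - f g).
have -> : f x - f g - (Q x - Q g) - (Q g - f g) = f x - Q x by ring.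
lra.
Qed.

Lemma closed_equicont : closed (equicont : set T).
Proof.
move=> Q cl.
have H x y z e : 0 < e -> exists2 f, equicont f &
    [/\ `|Q x - f x| < e, `|Q y - f y| < e & `|Q z - f z| < e].
  move=> e0.
  have : \forall f \near (Q : T), [/\ `|Q x - (f : R -> R) x| < e,
      `|Q y - (f : R -> R) y| < e & `|Q z - (f : R -> R) z| < e].
    by apply: (@filterS3 T (nbhs (Q : T)) (ptws_filter Q) _ _ _ _ _ (near_ptws Q x e0) (near_ptws Q y e0) (near_ptws Q z e0)) => f.
  by move=> /cl[f [ef hf]]; exists f.
have eq_of (a c : R) : (forall e, 0 < e -> `|a - c| <= e) -> a = c.
  move=> h; apply/eqP; rewrite -subr_eq0 -normr_eq0 eq_le normr_ge0 andbT.
  by apply/ler_addgt0Pr => e e0; rewrite add0r; exact: h.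
split.
- move=> x; apply: eq_of => e e0; have e2 : 0 < e / 2 by rewrite divr_gt0.
  have [f [fc _ _] [h1 h2 _]] := H x (clamp x) 0 _ e2.
  have := ler_normB (Q x - f x) (Q (clamp x) - f (clamp x)).
  have -> : Q x - f x - (Q (clamp x) - f (clamp x)) = Q x - Q (clamp x) by rewrite -fc; ring.
  lra.
- apply: eq_of => e e0; have [f [_ f0 _] [h1 _ _]] := H 0 0 0 _ e0.
  by rewrite -[X in _ - X]f0 ltW.
- move=> eta x y eta0 x0 xy y1; apply/ler_addgt0Pr => e e0.
  have e2 : 0 < e / 2 by rewrite divr_gt0.
  have [f [_ _ fm] [h1 h2 _]] := H x y 0 _ e2.
  have := fm eta x y eta0 x0 xy y1.
  have := ler_normD (f y - f x) ((Q y - f y) - (Q x - f x)).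
  have := ler_normB (Q y - f y) (Q x - f x).
  have -> : f y - f x + (Q y - f y - (Q x - f x)) = Q y - Q x by ring.
  lra.
Qed.

Lemma ucvg_admissible Q : equicont Q ->
  ucvg (within admissible (nbhs (Q : T))) (fun f : T => (f : R -> R)) Q.
Proof.
move=> eQ e e0; have := ucvg_ptws eQ e0.
by apply: (@filterS T (nbhs (Q : T)) (ptws_filter Q)) => f hf [ef _]; exact: hf.
Qed.

Lemma near_admissible_continuous Q :
  \forall f \near within admissible (nbhs (Q : T)), continuous (f : R -> R).
Proof.
by apply: (@nearW T (nbhs (Q : T)) _ (ptws_filter Q)) => f [ef _]; exact: equicont_continuous.
Qed.

(** A limit point of admissible functions is a uniform limit of them, and the
integral in the dual bound is continuous for uniform convergence. *)
Lemma closed_admissible : closed (admissible : set T).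
Proof.
move=> Q cl.
have eQ : equicont Q.
  by apply: closed_equicont => B /cl[f [[ef _] Bf]]; exists f.
split => // b b' db cb' b0 b1.
have PF : ProperFilter (within admissible (nbhs (Q : T))) by exact: (@within_nbhs_proper T admissible Q).
have cQ := equicont_continuous eQ.
have cv : int01 (fun x => (f : R -> R) x * b' x) @[f --> within admissible (nbhs (Q : T))] -->
    int01 (fun x => Q x * b' x).
  apply: (@ucvg_int R T _ _ (fun f x => (f : R -> R) x * b' x)).
  - have := near_admissible_continuous Q; apply: filterS => f cf.
    by apply: contM => //; exact: continuous_cont01.
  - by apply: contM => //; exact: continuous_cont01.
  - apply: ucvgM.
    + exact: cont01_bounded (continuous_cont01 cQ).
    + exact: cont01_bounded.
    + exact: ucvg_admissible.
    + exact: ucvg_cst.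
apply: (@ler_cvg_to T (within admissible (nbhs (Q : T))) PF R _ _ _ _ (cvgN cv) (cvg_cst _)).
by apply: (@nearW T (nbhs (Q : T)) _ (ptws_filter Q)) => f [_ df]; exact: df.
Qed.

(** A closed subset of a product of segments. *)
Lemma compact_admissible : compact (admissible : set T).
Proof.
have [M hM] : exists M, forall Q x, admissible Q -> `|Q x| <= M.
  exists (modulus p r 1 1) => Q x [eQ _]; have [hc h0 _] := eQ.
  have z01 : (0 : R) <= (0 : R) <= (1 : R).
    by rewrite lexx ler01.
  have := equicont_dist eQ ltr01 z01 (clamp01 x).
  rewrite h0 subr0 -hc => /le_trans; apply; rewrite /modulus lerD2l subr0.
  have /andP[c0 c1] := clamp01 x.
  rewrite (ger0_norm c0); apply: ler_wpM2r => //.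
  by rewrite divr_ge0 ?powR_ge0// ltW// conj_gt0.
apply: (@subclosed_compact T _ [set f : T | forall x, (`[- M, M]%classic : set R) ((f : R -> R) x)]).
- exact: closed_admissible.
- by apply: (@tychonoff R (fun=> R) (fun=> `[- M, M]%classic)) => _; exact: segment_compact.
- by move=> Q aQ x /=; rewrite in_itv/= -ler_norml; exact: hM.
Qed.

Lemma admissible0 : admissible (fun=> 0).
Proof.
split.
  split => // eta x y eta0 x0 xy y1; rewrite subrr normr0 /modulus.
  rewrite addr_ge0// ?mulr_ge0 ?divr_ge0 ?mulr_ge0 ?powR_ge0 ?subr_ge0// ?invr_ge0 ltW// conj_gt0//.
move=> b b' db cb' b0 b1.
rewrite (_ : int01 _ = 0); last by rewrite -[RHS](@int01_cst R); apply: eq_int01 => x _; rewrite mul0r.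
have pp := conj_gt0 hp.
rewrite oppr0 addr_ge0// divr_ge0 ?powR_ge0// ?(ltW p0) ?(ltW pp)//.
apply: int01_ge0.
  exact: cont_comp (deriv_on_clamp db) (continuous_norm_powR pp).
by move=> x _; exact: powR_ge0.
Qed.

Lemma convex_bound (a c t M : R) : 0 <= t <= 1 -> `|a| <= M -> `|c| <= M ->
  `|a + t * (c - a)| <= M.
Proof.
move=> t01 aM cM; have -> : a + t * (c - a) = (1 - t) * a + t * c by ring.
apply: (le_trans (ler_normD _ _)); rewrite !normrM.
rewrite (ger0_norm (_ : 0 <= 1 - t)) ?(ger0_norm (_ : 0 <= t)); [|lra..].
have : (1 - t) * `|a| <= (1 - t) * M by rewrite ler_wpM2l//; lra.
have : t * `|c| <= t * M by rewrite ler_wpM2l//; lra.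
lra.
Qed.

Lemma admissible_convex Q1 Q2 t : admissible Q1 -> admissible Q2 -> 0 <= t <= 1 ->
  admissible (fun x => Q1 x + t * (Q2 x - Q1 x)).
Proof.
move=> [e1 d1] [e2 d2] t01.
have c1 := continuous_cont01 (equicont_continuous e1).
have c2 := continuous_cont01 (equicont_continuous e2).
have [h1 z1 m1] := e1; have [h2 z2 m2] := e2; split.
  split.
  - by move=> x; rewrite -h1 -h2.
  - by rewrite z1 z2 subrr mulr0 addr0.
  - move=> eta x y eta0 x0 xy y1.
    have -> : Q1 y + t * (Q2 y - Q1 y) - (Q1 x + t * (Q2 x - Q1 x)) =
      (Q1 y - Q1 x) + t * ((Q2 y - Q2 x) - (Q1 y - Q1 x)) by ring.
    by apply: convex_bound => //; [exact: m1|exact: m2].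
move=> b b' db cb' b0 b1; have k1 := d1 b b' db cb' b0 b1; have k2 := d2 b b' db cb' b0 b1.
have -> : int01 (fun x => (Q1 x + t * (Q2 x - Q1 x)) * b' x) =
    (1 - t) * int01 (fun x => Q1 x * b' x) + t * int01 (fun x => Q2 x * b' x).
  rewrite -!int01Z; [|by apply: contM..].
  rewrite -int01D; [|by apply: contM; [exact: contC|apply: contM]..].
  by apply: eq_int01 => x _; ring.
move: k1 k2; set B := r `^ p / p + _ => k1 k2.
have l1 : (1 - t) * (- int01 (fun x => Q1 x * b' x)) <= (1 - t) * B by rewrite ler_wpM2l//; lra.
have l2 : t * (- int01 (fun x => Q2 x * b' x)) <= t * B by rewrite ler_wpM2l//; lra.
lra.
Qed.

Lemma ev_sum_max (m : nat) (e : R) : exists2 Q, admissible Q &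
  forall Q', admissible Q' -> e * (\sum_(i < m) ev Q' i) <= e * (\sum_(i < m) ev Q i).
Proof.
have [||Q /set_mem aQ hQ] := @compact_EVT_max T R (fun f => e * (\sum_(i < m) ev (f : R -> R) i)) admissible _ compact_admissible.
- by exists (fun=> 0); exact: admissible0.
- apply/subspace_continuousP => Q aQ; apply: cvgM; first exact: cvg_cst.
  have [eQ _] := aQ.
  have cev i : ev (f : R -> R) i @[f --> within admissible (nbhs (Q : T))] --> ev Q i.
    apply: (@cvg_ev R T (within admissible (nbhs (Q : T))) (admissible_filter Q) (fun f : T => (f : R -> R))).
    + exact: near_admissible_continuous.
    + exact: equicont_continuous.
    + exact: ucvg_admissible.
  elim: m => [|m IH].
    have -> : (fun f : T => \sum_(i < 0) ev (f : R -> R) i) = (fun=> 0).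
      by apply/funext => f; rewrite big_ord0.
    by rewrite big_ord0; exact: cvg_cst.
  have -> : (fun f : T => \sum_(i < m.+1) ev (f : R -> R) i) =
      (fun f : T => \sum_(i < m) ev (f : R -> R) i + ev (f : R -> R) m).
    by apply/funext => f; rewrite big_ord_recr.
  rewrite big_ord_recr.
  exact: (@cvgD _ _ _ _ (admissible_filter Q) _ _ _ _ IH (cev m)).
- by exists Q => // Q' aQ'; apply: hQ; exact: mem_set.
Qed.

End Compactness.

(** * The equality case of the dual bound *)

Section Power.
Context {R : realType}.

(** The function sign(y) |y|^s, written with the positive and negative parts
of y so that its continuity at 0 is visible. *)
Definition spow (s y : R) : R :=
  `|(y + `|y|) / 2| `^ s - `|(y - `|y|) / 2| `^ s.

Lemma spow_ge0 s y : 0 < s -> 0 <= y -> spow s y = y `^ s.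
Proof.
move=> s0 y0; rewrite /spow (ger0_norm y0) subrr mul0r normr0 powR0 ?gt_eqF// subr0.
have -> : (y + y) / 2 = y by field.
by rewrite ger0_norm.
Qed.

Lemma spow_le0 s y : 0 < s -> y <= 0 -> spow s y = - (`|y| `^ s).
Proof.
move=> s0 y0; rewrite /spow (ler0_norm y0) subrr mul0r normr0 powR0 ?gt_eqF// sub0r.
have -> : (y - - y) / 2 = y by field.
by rewrite ler0_norm.
Qed.

Lemma norm_spow s y : 0 < s -> `|spow s y| = `|y| `^ s.
Proof.
move=> s0; have [y0|/ltW y0] := leP 0 y.
  by rewrite spow_ge0// ger0_norm ?powR_ge0// ger0_norm.
by rewrite spow_le0// normrN ger0_norm ?powR_ge0.
Qed.

Lemma spowM s y : 0 < s -> spow s y * y = `|y| `^ (s + 1).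
Proof.
move=> s0.
have E (z : R) : 0 <= z -> z `^ s * z = z `^ (s + 1).
  move=> z0; rewrite powRD; first by rewrite powRr1.
  by rewrite (_ : (s + 1 == 0) = false)// gt_eqF// addr_gt0.
have [y0|/ltW y0] := leP 0 y.
  by rewrite spow_ge0// E// ger0_norm.
by rewrite spow_le0// mulNr -mulrN -(ler0_norm y0) E.
Qed.

Lemma continuous_spow s : 0 < s -> continuous (spow s).
Proof.
move=> s0; have cp := continuous_norm_powR s0.
have ca : continuous (fun y : R => `|y|) by exact: norm_continuous.
apply: contB; apply: (cont_comp _ cp).
  by apply: contM; [apply: contD => //; exact: contX|exact: contC].
by apply: contM; [apply: contB => //; exact: contX|exact: contC].
Qed.

(** The graph of |y|^p' lies above its tangents; read from the point y, this is
Young's inequality for a and sign(y)|y|^(p'-1). *)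
Lemma powR_tangent (p a y : R) (p' := p / (p - 1)) : 1 < p ->
  `|y| `^ p' <= `|a| `^ p' + p' * (spow (p' - 1) y * (y - a)).
Proof.
move=> p1; have s0 : 0 < p' - 1 by exact: conj_sub1_gt0.
have pp : 0 < p' by exact: conj_gt0.
have := young p1 (spow (p' - 1) y) a.
rewrite norm_spow// -powRrM conj_sub1// -/p' => h.
have -> : p' * (spow (p' - 1) y * (y - a)) = p' * (`|y| `^ p') - p' * (spow (p' - 1) y * a).
  by rewrite mulrBr spowM// subrK mulrBr.
have : p' * (spow (p' - 1) y * a) <= p' * (`|y| `^ p' / p + `|a| `^ p' / p').
  by rewrite ler_wpM2l// ltW.
have -> : p' * (`|y| `^ p' / p + `|a| `^ p' / p') = (p' - 1) * (`|y| `^ p') + `|a| `^ p'.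
  move: (`|y| `^ p') (`|a| `^ p') => A B; rewrite /p'.
  by field; rewrite !gt_eqF//; lra.
lra.
Qed.

End Power.

Section Duality.
Context {R : realType}.
Variables (p r e : R).
Hypotheses (hp : 1 < p) (hr : 0 < r) (he : `|e| = 1).
Local Notation p' := (p / (p - 1)).
Local Notation s := (p / (p - 1) - 1).

Let ee : e * e = 1.
Proof. by rewrite -expr2 -real_normK ?num_real// he expr1n. Qed.

Let s0 : 0 < s. Proof. exact: conj_sub1_gt0. Qed.

Let pp : 0 < p'. Proof. exact: conj_gt0. Qed.

Variables rho rho' : R -> R.
Hypotheses (drho : deriv_on 0 1 rho rho') (crho' : cont01 rho').
Hypotheses (rho_ge0 : forall x, 0 <= rho x) (rho0 : rho 0 = 0) (rho1 : rho 1 = 0).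
Hypothesis norm_rho : int01 (fun x => rho x `^ p') = r `^ p.

Let crho : cont01 rho. Proof. exact: deriv_on_clamp drho. Qed.

Let cs : cont01 (fun x => rho x `^ s). Proof. exact: cont01_powR. Qed.

Definition potential x := e * rho x `^ s.

Definition potential_prim := prim (fun x => e * rho (clamp x) `^ s).

Lemma cont01_potential : cont01 potential.
Proof. by apply: contM; [exact: contC|exact: cs]. Qed.

Lemma deriv_potential_prim : deriv_on 0 1 potential_prim potential.
Proof. exact: (prim_cont01 cont01_potential). Qed.

Let cont01_pow : cont01 (fun x => rho x `^ p'). Proof. exact: cont01_powR. Qed.

Lemma integral_pow :
  (\int[@lebesgue_measure R]_(x in Omega) (rho x `^ p')%:E = (r `^ p)%:E)%E.
Proof.
rewrite -norm_rho (int01_Rintegral cont01_pow) /Rintegral fineK.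
  by [].
have h := continuous_itv_integrable 0 1 cont01_pow.
have := integrable_fin_num (@mOmega R) h; congr (_ \is a fin_num).
by apply: eq_integral => x; rewrite inE => /OmegaP/clampE /= ->.
Qed.

Lemma potential_ball : Lp_ball p r potential.
Proof.
apply/(Lp_ballP _ hp hr); split.
  apply: (eq_measurable_fun (fun x => potential (clamp x))).
    by move=> x; rewrite inE => /OmegaP/clampE ->.
  apply: measurable_funTS; exact: continuous_measurable_fun cont01_potential.
rewrite -integral_pow le_eqVlt; apply/orP; left; apply/eqP.
apply: eq_integral => x _; rewrite /potential normrM he mul1r ger0_norm ?powR_ge0//.
by rewrite -powRrM conj_sub1.
Qed.

Lemma lprim_potential x : lprim (potential \_ Omega) x = potential_prim (clamp x).
Proof.
have /andP[c0 c1] := clamp01 x.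
rewrite /lprim /potential_prim prim_Rintegral//; last exact: cont01_potential.
apply: eq_Rintegral => t; rewrite inE/= in_itv/= => /andP[t0 t1].
have t01 : 0 <= t <= 1 by lra.
by rewrite patchE mem_set ?clampE//; exact/OmegaP.
Qed.

Let W := potential_prim.

Let cW : cont01 W. Proof. exact: deriv_on_clamp deriv_potential_prim. Qed.

Lemma potential_by_parts g g' : deriv_on 0 1 g g' -> cont01 g' -> g 0 = 0 -> g 1 = 0 ->
  e * int01 (fun x => W x * g' x) = - int01 (fun x => rho x `^ s * g x).
Proof.
move=> dg cg' g0 g1; have cg := deriv_on_clamp dg.
have : int01 (fun x => potential x * g x + W x * g' x) = 0.
  rewrite (@int01E _ _ (fun x => W x * g x)).
  - by rewrite g0 g1 !mulr0 subrr.
  - by apply: contD; apply: contM => //; exact: cont01_potential.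
  - by move=> x x01; apply: derM; [exact: deriv_potential_prim|exact: dg].
rewrite int01D; [|by apply: contM => //; exact: cont01_potential|by apply: contM].
rewrite (_ : int01 (fun x => potential x * g x) = e * int01 (fun x => rho x `^ s * g x)).
  move=> /(congr1 (fun z => e * z)); rewrite mulrDr mulrA ee mul1r mulr0; lra.
rewrite -int01Z; last exact: contM.
by apply: eq_int01 => x _; rewrite /potential mulrA.
Qed.

Lemma potential_pairing : - (e * int01 (fun x => W x * rho' x)) = r `^ p.
Proof.
rewrite (potential_by_parts drho)// opprK -norm_rho.
apply: eq_int01 => x _.
by have := spowM (rho x) s0; rewrite spow_ge0// subrK ger0_norm.
Qed.

Variable Q : R -> R.
Hypotheses (aQ : admissible p r Q).
Hypothesis Qopt : r `^ p <= - (e * int01 (fun x => Q x * rho' x)).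

Let cQ : cont01 Q.
Proof. by have [eQ _] := aQ; exact: continuous_cont01 (equicont_continuous hp hr eQ). Qed.

(* The dual bound at rho + t g, minus its equality case at t = 0. *)
Let perturbed_bound g g' t : deriv_on 0 1 g g' -> cont01 g' -> g 0 = 0 -> g 1 = 0 -> 0 < t ->
  - (e * int01 (fun x => Q x * g' x)) <= int01 (fun x => spow s (rho x + t * g x) * g x).
Proof.
move=> dg cg' g0 g1 t0; have cg := deriv_on_clamp dg; have [_ dbQ] := aQ.
have crt : cont01 (fun x => rho x + t * g x) by apply: contD => //; apply: contM => //; exact: contC.
have csp : cont01 (fun x => spow s (rho x + t * g x)) by exact: cont_comp crt (continuous_spow s0).
have := dbQ (fun x => e * (rho x + t * g x)) (fun x => e * (rho' x + t * g' x)).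
rewrite g0 g1 rho0 rho1 !mulr0 addr0 mulr0 => bound.
have d1 : deriv_on 0 1 (fun x => e * (rho x + t * g x)) (fun x => e * (rho' x + t * g' x)).
  by move=> x x01; apply: derZ; apply: derD; [exact: drho|apply: derZ; exact: dg].
have c1 : cont01 (fun x => e * (rho' x + t * g' x)).
  by apply: contM; [exact: contC|apply: contD => //; apply: contM => //; exact: contC].
have {bound} := bound d1 c1 erefl erefl.
have -> : int01 (fun x => Q x * (e * (rho' x + t * g' x))) =
    e * int01 (fun x => Q x * rho' x) + t * (e * int01 (fun x => Q x * g' x)).
  have k1 : cont01 (fun x => Q x * rho' x) by exact: contM.
  have k2 : cont01 (fun x => Q x * g' x) by exact: contM.
  have k3 : cont01 (fun x => e * (Q x * g' x)) by apply: contM => //; exact: contC.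
  rewrite -!int01Z// -int01D; last 2 first.
  - by apply: contM => //; exact: contC.
  - by apply: contM => //; exact: contC.
  by apply: eq_int01 => x _; ring.
have le : int01 (fun x => `|e * (rho x + t * g x)| `^ p') <=
    r `^ p + p' * (t * int01 (fun x => spow s (rho x + t * g x) * g x)).
  have csg : cont01 (fun x => spow s (rho x + t * g x) * g x) by exact: contM.
  rewrite -norm_rho mulrA -int01Z// -int01D//; last by apply: contM => //; exact: contC.
  apply: int01_le.
  - apply: cont_comp (continuous_norm_powR pp); by apply: contM => //; exact: contC.
  - by apply: contD => //; apply: contM => //; exact: contC.
  - move=> x _; rewrite normrM he mul1r.
    have := powR_tangent (rho x) (rho x + t * g x) hp.
    rewrite (ger0_norm (rho_ge0 x)) => /le_trans; apply.
    rewrite le_eqVlt; apply/orP; left; apply/eqP; ring.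
have sum1 : r `^ p / p + r `^ p / p' = r `^ p by rewrite -mulrDr conj_sum ?mulr1.
have {}le : int01 (fun x => `|e * (rho x + t * g x)| `^ p') / p' <=
    r `^ p / p' + t * int01 (fun x => spow s (rho x + t * g x) * g x).
  by rewrite ler_pdivrMr// mulrDl divfK ?gt_eqF// [t * _ * _]mulrC.
move=> h; rewrite -(ler_pM2l t0) mulrN; move: Qopt; lra.
Qed.

Let variation_bound g g' : deriv_on 0 1 g g' -> cont01 g' -> g 0 = 0 -> g 1 = 0 ->
  - (e * int01 (fun x => Q x * g' x)) <= int01 (fun x => rho x `^ s * g x).
Proof.
move=> dg cg' g0 g1; have cg := deriv_on_clamp dg.
have crt t : cont01 (fun x => rho x + t * g x).
  by apply: contD => //; apply: contM => //; exact: contC.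
have csp t : cont01 (fun x => spow s (rho x + t * g x)).
  exact: cont_comp (crt t) (continuous_spow s0).
have u : ucvg (0 : R)^'+ (fun t x => rho x + t * g x) rho.
  by apply: ucvg_line; exact: cont01_bounded.
have lim : int01 (fun x => spow s (rho x + t * g x) * g x) @[t --> (0 : R)^'+] -->
    int01 (fun x => rho x `^ s * g x).
  rewrite (_ : int01 (fun x => rho x `^ s * g x) = int01 (fun x => spow s (rho x) * g x)); last first.
    by apply: eq_int01 => x _; rewrite spow_ge0.
  have csr : cont01 (fun x => spow s (rho x)) by exact: cont_comp crho (continuous_spow s0).
  apply: (@ucvg_int R R (0 : R)^'+ _ (fun t x => spow s (rho x + t * g x) * g x)).
  - by near=> t; apply: contM; [exact: csp|exact: cg].
  - exact: contM.
  - apply: ucvgM; [exact: cont01_bounded|exact: cont01_bounded| |exact: ucvg_cst].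
    exact: ucvg_comp (continuous_spow s0) crho u.
apply: ler_cvg_to (cvg_cst _) lim _.
near=> t; apply: perturbed_bound dg cg' g0 g1 _.
by near: t; exact: nbhs_right_gt.
Unshelve. all: by end_near. Qed.

(** [variation_bound] says that e int (Q - W) g' >= 0 for all g. The choice of g
with g' = - e (D - I), where I is the mean value of D = Q - W, gives
int (D - I)^2 <= 0, so that D is constant; and D(0) = 0. *)
Lemma dual_bound_equality x : Q x = W (clamp x).
Proof.
have [[hcl Q0 _] _] := aQ; rewrite hcl.
pose D x := Q x - W x.
have cD : cont01 D by exact: contB.
pose I := int01 D.
have cDI : cont01 (fun x => D x - I) by apply: contB => //; exact: contC.
have c2 : cont01 (fun x => (D x - I) * (D x - I)) by exact: contM.
pose g (x : R) : R := - e * (prim (fun x => D (clamp x) - I) x).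
have dg : deriv_on 0 1 g (fun x => - e * (D x - I)).
  by move=> t t01; apply: derZ; exact: (prim_cont01 cDI).
have cg' : cont01 (fun x => - e * (D x - I)) by apply: contM => //; exact: contC.
have ID : int01 (fun x => D x - I) = 0.
  by rewrite int01B//; [rewrite int01_cst subrr|exact: contC].
have g0 : g 0 = 0 by rewrite /g prim0 mulr0.
have g1 : g 1 = 0.
  by transitivity (- e * int01 (fun x => D x - I)); [by []|rewrite ID mulr0].
have := variation_bound dg cg' g0 g1; have := potential_by_parts dg cg' g0 g1.
move=> h1; rewrite -[leRHS]opprK -h1 lerN2 => h2.
have cQg : cont01 (fun x => Q x * (- e * (D x - I))) by exact: contM.
have cWg : cont01 (fun x => W x * (- e * (D x - I))) by exact: contM.
have h3 : e * int01 (fun x => D x * (- e * (D x - I))) = - int01 (fun x => D x * (D x - I)).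
  rewrite -int01Z; last exact: contM.
  rewrite -[RHS]mulN1r -int01Z; last exact: contM.
  apply: eq_int01 => t _; transitivity (- (e * e) * (D t * (D t - I))); first by ring.
  by rewrite ee.
have h4 : int01 (fun x => D x * (D x - I)) <= 0.
  rewrite -oppr_ge0 -h3.
  have -> : int01 (fun x => D x * (- e * (D x - I))) =
      int01 (fun x => Q x * (- e * (D x - I))) - int01 (fun x => W x * (- e * (D x - I))).
    by rewrite -int01B//; apply: eq_int01 => t _; rewrite /D; ring.
  by rewrite mulrBr subr_ge0.
have h5 : int01 (fun x => (D x - I) * (D x - I)) = int01 (fun x => D x * (D x - I)).
  have -> : int01 (fun x => (D x - I) * (D x - I)) =
      int01 (fun x => D x * (D x - I)) - I * int01 (fun x => D x - I).
    rewrite -int01Z// -int01B; [|exact: contM|by apply: contM => //; exact: contC].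
    by apply: eq_int01 => t _; ring.
  by rewrite ID mulr0 subr0.
have DI t : 0 <= t <= 1 -> D t = I.
  move=> t01; apply/eqP; rewrite -subr_eq0 -sqrf_eq0 expr2; apply/eqP.
  apply: (int01_eq0 c2 _ _ t01); last by rewrite h5.
  by move=> y _; rewrite -expr2 sqr_ge0.
have D0 : D 0 = 0 by rewrite /D Q0 /W /potential_prim prim0 subrr.
have z01 : (0 : R) <= (0 : R) <= (1 : R) by rewrite lexx ler01.
by apply/eqP; rewrite -subr_eq0 -/(D _) (DI _ (clamp01 x)) -(DI _ z01) D0.
Qed.

End Duality.

(** * Optimal potentials *)

Section C1.
Context {R : realType}.
Implicit Types (f g : R -> R).

Lemma der_sum n (f f' : 'I_n -> R -> R) (x : R) :
  (forall i, is_derive x 1 (f i) (f' i x)) ->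
  is_derive x 1 (fun y => \sum_(i < n) f i y) (\sum_(i < n) f' i x).
Proof.
move=> d; have := is_derive_sum d.
by rewrite (_ : \sum_(i < n) f i = (fun y => \sum_(i < n) f i y))//; apply/funext => y; rewrite fct_sumE.
Qed.

Lemma cont01_within f : cont01 f -> {within Omega, continuous f}.
Proof.
move=> cf; apply: (@subspace_eq_continuous _ _ _ (fun x => f (clamp x)) f).
  by move=> x; rewrite inE => /OmegaP/clampE ->.
exact: continuous_subspaceT.
Qed.

Lemma deriv_on_C1 f g : deriv_on 0 1 f g -> cont01 g -> C1_derivative f g.
Proof.
move=> d cg; split; [exact: deriv_on_within d|exact: cont01_within|].
by move=> x /andP[x0 x1]; apply: d; rewrite !ltW.
Qed.

End C1.

Section Optimum.
Context {R : realType}.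
Variables (p r e : R) (m : nat).
Hypotheses (hp : 1 < p) (hr : 0 < r) (he : `|e| = 1) (m0 : (0 < m)%N).
Local Notation p' := (p / (p - 1)).
Local Notation s := (p / (p - 1) - 1).

Let pp : 0 < p'. Proof. exact: conj_gt0. Qed.

Variable Q : R -> R.
Hypothesis aQ : admissible p r Q.
Hypothesis Qmax : forall Q', admissible p r Q' ->
  e * (\sum_(i < m) ev Q' i) <= e * (\sum_(i < m) ev Q i).

Let cQ : continuous Q.
Proof. by have [eQ _] := aQ; exact (equicont_continuous hp hr eQ). Qed.

Let phi (i : nat) := psol Q (ev Q i).
Let w (i : nat) := wsol Q (ev Q i).
Let phi' (i : nat) x := Q x * phi i x + w i x.
Let N (i : nat) := int01 (fun x => phi i x * phi i x).

Let N_gt0 i : 0 < N i. Proof. exact: int01_psol2_gt0. Qed.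

Let cphi i : cont01 (phi i). Proof. exact: cont01_psol. Qed.

Let cw i : cont01 (w i). Proof. exact: cont01_wsol. Qed.

Let cphi' i : cont01 (phi' i).
Proof. exact: cont01D (cont01M (continuous_cont01 cQ) (@cphi i)) (@cw i). Qed.

Let dphi i : deriv_on 0 1 (phi i) (phi' i).
Proof. by have [] := quasi_system_sol (ev Q i) cQ. Qed.

Let dw i : deriv_on 0 1 (w i) (fun x => - Q x * w i x - (Q x ^+ 2 + ev Q i) * phi i x).
Proof. by have [] := quasi_system_sol (ev Q i) cQ. Qed.

(** At a maximum over a convex set the one-sided derivative of the objective along
each segment that starts there is nonpositive. *)
Lemma first_order_condition Q' : admissible p r Q' ->
  e * \sum_(i < m) (- int01 (fun x => (Q' x - Q x) * (2 * phi' i x * phi i x)) / N i) <= 0.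
Proof.
move=> aQ'; have cQ' : continuous Q' by have [eQ' _] := aQ'; exact (equicont_continuous hp hr eQ').
have cP : continuous (fun x => Q' x - Q x) by exact: contB.
pose Qt (t : R) x := Q x + t * (Q' x - Q x).
have lim : e * \sum_(i < m) ((ev (Qt t) i - ev Q i) / t) @[t --> (0 : R)^'+] -->
    e * \sum_(i < m) (- int01 (fun x => (Q' x - Q x) * (2 * phi' i x * phi i x)) / N i).
  apply: cvgM; first exact: cvg_cst.
  move: (m) => n; elim: n => [|n IH].
    rewrite big_ord0 (_ : (fun t => _) = (fun=> 0)); first exact: cvg_cst.
    by apply/funext => t; rewrite big_ord0.
  rewrite big_ord_recr /= (_ : (fun t => _) = (fun t => \sum_(i < n) ((ev (Qt t) i - ev Q i) / t) + (ev (Qt t) n - ev Q n) / t)).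
    by apply: cvgD IH _; exact: ev_variation.
  by apply/funext => t; rewrite big_ord_recr.
apply: ler_cvg_to lim (cvg_cst _) _; near=> t.
have t0 : 0 < t by near: t; exact: nbhs_right_gt.
have t1 : t <= 1 by near: t; apply: nbhs_right_le.
have := Qmax (admissible_convex hp hr aQ aQ' (_ : 0 <= t <= 1)); rewrite (ltW t0) t1 => /(_ isT) h.
rewrite -mulr_suml mulrA sumrB mulrBr pmulr_lle0 ?invr_gt0// subr_le0.
exact: h.
Unshelve. all: by end_near. Qed.

Let rho_ x := \sum_(i < m) (N i)^-1 * phi i x ^+ 2.

Let rho__ge0 x : 0 <= rho_ x.
Proof. by apply: sumr_ge0 => i _; rewrite mulr_ge0 ?sqr_ge0// invr_ge0 ltW. Qed.

Let crho_ : cont01 rho_.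
Proof.
apply: (@cont01_sum R m (fun i x => (N i)^-1 * phi i x ^+ 2)) => i.
exact: cont01Z (cont01M (@cphi i) (@cphi i)).
Qed.

Let crho_pow : cont01 (fun x => rho_ x `^ p'). Proof. exact: cont01_powR. Qed.

Let J := int01 (fun x => rho_ x `^ p').

Let J_gt0 : 0 < J.
Proof.
rewrite ltNge; apply/negP => J0.
have [x x01 /negP] := psol_ev_neq0 cQ 0; apply.
have /eqP := int01_eq0 crho_pow (fun y _ => powR_ge0 _ _) J0 x01.
rewrite powR_eq0 => /andP[/eqP r0 _].
have := r0; rewrite /rho_ => /eqP; rewrite psumr_eq0; last first.
  by move=> i _; rewrite mulr_ge0 ?sqr_ge0// invr_ge0 ltW.
move=> /allP/(_ (Ordinal m0) (mem_index_enum _)) /=.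
by rewrite mulf_eq0 invr_eq0 gt_eqF//= sqrf_eq0.
Qed.

(* The factor that gives the density its prescribed norm. *)
Let S := (r `^ p / J) `^ p'^-1.

Let S_gt0 : 0 < S.
Proof. by rewrite powR_gt0// divr_gt0// powR_gt0. Qed.

Let c (i : nat) := Num.sqrt (S / N i).

Let c2 i : c i ^+ 2 = S / N i.
Proof. by rewrite sqr_sqrtr// divr_ge0 ?ltW. Qed.

(** Eigenfunctions of the common norm sqrt S. *)
Definition eigenfunction (i : nat) x := c i * phi i x.
Local Notation u := eigenfunction.

Definition density x := \sum_(i < m) u i x ^+ 2.
Local Notation rho := density.

Let rho' x := \sum_(i < m) (S / N i) * (2 * phi' i x * phi i x).

Let rhoE x : rho x = S * rho_ x.
Proof.
rewrite /density /rho_ mulr_sumr; apply: eq_bigr => i _.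
by rewrite /eigenfunction exprMn c2 -mulrA.
Qed.

Lemma density_ge0 x : 0 <= rho x.
Proof. by apply: sumr_ge0 => i _; exact: sqr_ge0. Qed.

Lemma norm_density : int01 (fun x => rho x `^ p') = r `^ p.
Proof.
have E x : rho x `^ p' = r `^ p / J * rho_ x `^ p'.
  rewrite rhoE powRM ?(ltW S_gt0)// /S -powRrM mulVf ?gt_eqF// powRr1//.
  by rewrite divr_ge0 ?powR_ge0// ltW.
under [X in int01 X]eq_fun do rewrite E.
by rewrite int01Z// -/J divfK// gt_eqF.
Qed.

Lemma eigenfunction_boundary i : dirichlet (u i).
Proof.
by have [h0 h1] := psol_ev_boundary cQ i; split; rewrite /u /phi ?h0 ?h1 mulr0.
Qed.

Lemma density0 : rho 0 = 0.
Proof. by apply: big1 => i _; have [-> _] := eigenfunction_boundary i; rewrite expr0n. Qed.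

Lemma density1 : rho 1 = 0.
Proof. by apply: big1 => i _; have [_ ->] := eigenfunction_boundary i; rewrite expr0n. Qed.

Let drho : deriv_on 0 1 rho rho'.
Proof.
move=> x x01; apply: (@der_sum R m (fun i x => u i x ^+ 2) (fun i x => S / N i * (2 * phi' i x * phi i x))) => i.
rewrite -c2.
have d : is_derive x 1 (u i) (c i * phi' i x) by apply: derZ; exact: dphi.
apply: is_derive_eq (derM d d) _.
by rewrite /u; ring.
Qed.

Let crho' : cont01 rho'.
Proof.
apply: (@cont01_sum R m (fun i x => (S / N i) * (2 * phi' i x * phi i x))) => i.
exact: cont01Z (cont01M (cont01Z (@cphi' i)) (@cphi i)).
Qed.

Local Notation q := (potential p e rho).
Local Notation W := (potential_prim p e rho).

Lemma optimal_potential_ball : Lp_ball p r q.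
Proof. exact: (potential_ball hp hr he drho density_ge0 norm_density). Qed.

(* The first-order condition in the direction of the primitive of the potential
   e rho^(p'-1). *)
Let Qopt : r `^ p <= - (e * int01 (fun x => Q x * rho' x)).
Proof.
have := first_order_condition (lprim_admissible hp hr optimal_potential_ball).
set Q' := lprim _.
have cQ' : continuous Q' by exact (continuous_lprim (Lp_ball_integrable hp hr optimal_potential_ball)).
have cP : cont01 (fun x => Q' x - Q x) by apply: continuous_cont01; exact: contB.
have -> : \sum_(i < m) (- int01 (fun x => (Q' x - Q x) * (2 * phi' i x * phi i x)) / N i) =
    - S^-1 * (int01 (fun x => Q' x * rho' x) - int01 (fun x => Q x * rho' x)).
  rewrite -int01B; [|exact: cont01M (continuous_cont01 cQ') crho'|exact: cont01M (continuous_cont01 cQ) crho'].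
  have cpp i : cont01 (fun x => 2 * phi' i x * phi i x).
    exact: cont01M (cont01Z (@cphi' i)) (@cphi i).
  rewrite (_ : int01 (fun x => Q' x * rho' x - Q x * rho' x) =
    \sum_(i < m) int01 (fun x => S / N i * ((Q' x - Q x) * (2 * phi' i x * phi i x)))); last first.
    rewrite -int01_sum; last first.
      by move=> i; exact: cont01Z (cont01M cP (@cpp i)).
    apply: eq_int01 => x _; rewrite -mulrBl /rho' mulr_sumr.
    by apply: eq_bigr => i _; rewrite mulrCA.
  rewrite mulr_sumr; apply: eq_bigr => i _; rewrite int01Z; last exact: cont01M cP (@cpp i).
  move: (int01 _) => X; field.
  by rewrite !gt_eqF.
rewrite mulrA mulrN mulNr oppr_le0 mulrAC pmulr_lge0 ?invr_gt0// mulrBr subr_ge0 => h.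
rewrite -(potential_pairing hp he drho crho' density_ge0 density0 density1 norm_density).
rewrite lerN2; apply: le_trans h _.
rewrite le_eqVlt; apply/orP; left; apply/eqP; congr (_ * _).
apply: eq_int01 => x x01; congr (_ * _).
by rewrite /Q' (lprim_potential e hp drho density_ge0) clampE.
Qed.

Lemma optimal_primitive : Q = lprim (q \_ Omega).
Proof.
apply/funext => x; rewrite (lprim_potential e hp drho density_ge0).
exact: (dual_bound_equality hp hr he drho crho' density_ge0 density0 density1 norm_density aQ Qopt).
Qed.

Lemma density_integral :
  (\int[@lebesgue_measure R]_(x in Omega) (rho x `^ p')%:E = (r `^ p)%:E)%E.
Proof. exact: (integral_pow hp drho density_ge0 norm_density). Qed.

Lemma eigenfunction_neq0 i : exists2 x, Omega x & u i x != 0.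
Proof.
have [x x01 px] := psol_ev_neq0 cQ i; exists x; first exact/OmegaP.
by rewrite mulf_neq0// gt_eqF// sqrtr_gt0 divr_gt0.
Qed.

Lemma eigenfunction_C2 i :
  C2_derivative2 (u i) (fun x => (q x - ev Q i) * u i x).
Proof.
have cW : cont01 W by exact: (deriv_on_clamp (deriv_potential_prim e hp drho density_ge0)).
have QW x : 0 <= x <= 1 -> Q x = W x.
  move=> x01; rewrite optimal_primitive (lprim_potential e hp drho density_ge0).
  by rewrite clampE.
pose f' x := c i * (W x * phi i x + w i x).
have dW : deriv_on 0 1 W q := deriv_potential_prim e hp drho density_ge0.
have du : deriv_on 0 1 (u i) f'.
  by move=> x x01; rewrite /f' -QW//; apply: derZ; exact: dphi.
have cq : cont01 q := cont01_potential hp drho density_ge0.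
exists f'; split; apply: deriv_on_C1.
- exact: du.
- exact: cont01Z (cont01D (cont01M cW (@cphi i)) (@cw i)).
- move=> x x01.
  apply: is_derive_eq (derZ (c i) (derD (derM (dW x x01) (dphi i x01)) (dw i x01))) _.
  by rewrite /phi' QW// /u; ring.
- apply: contM; first by apply: contB => //; exact: contC.
  exact: cont01Z (@cphi i).
Qed.

End Optimum.

Section Sums.
Context {R : realType}.
Variables (p r : R).
Hypotheses (hp : 1 < p) (hr : 0 < r).

Lemma eigenvalue_sumE q m : Lp_ball p r q ->
  eigenvalue_sum m q = \sum_(i < m) ev (lprim (q \_ Omega)) i.
Proof.
by move=> qB; rewrite /eigenvalue_sum (nth_eigenvalueE (Lp_ball_integrable hp hr qB)).
Qed.

Lemma optimal_valueE eps m q : Lp_ball p r q ->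
  (forall Q', admissible p r Q' ->
    sgn eps * (\sum_(i < m) ev Q' i) <= sgn eps * (\sum_(i < m) ev (lprim (q \_ Omega)) i)) ->
  optimal_value eps p r m (eigenvalue_sum m q).
Proof.
move=> qB qmax; split; first by exists q.
have h q' : Lp_ball p r q' -> sgn eps * eigenvalue_sum m q' <= sgn eps * eigenvalue_sum m q.
  move=> q'B; rewrite (eigenvalue_sumE m q'B) (eigenvalue_sumE m qB).
  by apply: qmax; exact: lprim_admissible.
case: eps h {qmax} => h v [q' q'B <-]; have := h q' q'B; rewrite /sgn ?mul1r// !mulN1r lerN2//.
Qed.

End Sums.

Theorem theorem1p1 (R : realType) (p r : R) (m : nat)
  (hp : 1 < p) (hr : 0 < r) (hm : (2 <= m)%N) :
  let p' := p / (p - 1) in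
  forall eps : sign,
  exists (mu : 'I_m -> R) (u : 'I_m -> R -> R),
    let rho := fun x : R => \sum_(j < m) u j x ^+ 2 in
    let q := fun x : R => sgn eps * rho x `^ (p' - 1) in
    [/\ (* the u_i form a non-trivial solution of the system *)
        (forall i, exists2 u'' : R -> R, C2_derivative2 (u i) u'' &
           forall x, Omega x ->
             - u'' x + sgn eps * rho x `^ (p' - 1) * u i x = mu i * u i x) /\
        (exists i, exists2 x, Omega x & u i x != 0),
        (* (i) *)
        forall i, dirichlet (u i),
        (* (ii) *)
        (\int[@lebesgue_measure R]_(x in Omega) (rho x `^ p')%:E
           = (r `^ p)%:E)%E,
        Lp_ball p r q /\ optimal_value eps p r m (eigenvalue_sum m q) &
        (* (iii) *)
        optimal_value eps p r m (\sum_(i < m) mu i)].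
Proof.
move=> p' eps; have m0 : (0 < m)%N by exact: ltnW.
have he : `|sgn eps| = 1 :> R by case: eps; rewrite ?normrN normr1.
have [Q aQ Qmax] := ev_sum_max hp hr m (sgn eps).
exists (fun i => ev Q i), (fun i => eigenfunction p r m Q i) => rho q.
have qB : Lp_ball p r q := optimal_potential_ball hp hr he m0 aQ.
have QE : Q = lprim (q \_ Omega) := optimal_primitive hp hr he m0 aQ Qmax.
have opt : optimal_value eps p r m (eigenvalue_sum m q).
  by apply: optimal_valueE => //; rewrite -QE.
split.
- split; last by exists (Ordinal m0); exact (eigenfunction_neq0 hp hr m0 aQ (Ordinal m0)).
  move=> i; exists (fun x => (q x - ev Q i) * eigenfunction p r m Q i x).
    exact (eigenfunction_C2 hp hr he m0 aQ Qmax i).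
  by move=> x _; rewrite -/(q x); ring.
- by move=> i; exact (eigenfunction_boundary m hp hr aQ i).
- exact (density_integral hp hr m0 aQ).
- by [].
- by move: opt; rewrite (eigenvalue_sumE hp hr m qB) -QE.
Qed.
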